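(* Let $\mathfrak g$ be a finite-dimensional semisimple Lie algebra over an algebraically closed field $\mathbb K$ of characteristic $0$, of rank $l$, with adjoint group $G$, let $e\in\mathfrak g$ be a nonzero non-regular nilpotent element, and suppose ${\rm ind}\,\mathfrak g_e=l$. Let $F_1,\dots,F_l$ be any homogeneous generating system of $\mathcal S(\mathfrak g)^G$ and $r=\dim\mathfrak g_e$. Then: (i) $\sum_{i=1}^l\deg{}^{e}\!F_i\le(r+l)/2$; (ii) ${}^{e}\!F_1,\dots,{}^{e}\!F_l$ are algebraically independent if and only if $\sum_{i=1}^l\deg{}^{e}\!F_i=(r+l)/2$; (iii) if $\sum_{i=1}^l\deg{}^{e}\!F_i=(r+l)/2$, then for $\gamma\in\mathfrak g_e^*$ the differentials $d_\gamma({}^{e}\!F_1),\dots,d_\gamma({}^{e}\!F_l)$ are linearly independent if and only if $\gamma$ is regular in $\mathfrak g_e^*$, i.e. $\dim\mathfrak g_e^\gamma={\rm ind}\,\mathfrak g_e$.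
   Context: Include $e$ in an $\mathfrak{sl}_2$-triple $(e,h,f)$; $(\cdot,\cdot)$ is the multiple of the Killing form with $(e,f)=1$, $\kappa:\mathcal S(\mathfrak g)\to\mathbb K[\mathfrak g]$ the algebra isomorphism extending $x\mapsto(x,\cdot)$, and $\kappa_e:\mathcal S(\mathfrak g_e)\to\mathbb K[\mathfrak g_f]$ the algebra isomorphism extending $x\mapsto (x,\cdot)|_{\mathfrak g_f}$ ($\mathfrak g_e,\mathfrak g_f$ the centralisers). Elements of $\mathcal S(\mathfrak g_e)$ are regarded as polynomial functions on $\mathfrak g_e^*$. For homogeneous $F\in\mathcal S(\mathfrak g)$, ${}^{e}\!F:=\kappa_e^{-1}(\mathrm{in}(\psi_F))$, where $\psi_F(x)=\kappa(F)(e+x)$ on $\mathfrak g_f$ and $\mathrm{in}$ is the nonzero homogeneous component of lowest degree. For a Lie algebra $\mathfrak q$ and $\gamma\in\mathfrak q^*$, $\mathfrak q^\gamma=\{x\in\mathfrak q:\gamma([x,\mathfrak q])=0\}$ and ${\rm ind}\,\mathfrak q=\min_\gamma\dim\mathfrak q^\gamma$. *)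

(* Defs.v *)
From HB Require Import structures.
From mathcomp Require Import all_boot all_order all_algebra.
From mathcomp Require Import mpoly.
Set Implicit Arguments. Unset Strict Implicit. Unset Printing Implicit Defensive.
Import Order.TTheory GRing.Theory.
Local Open Scope ring_scope.

(* A Lie algebra structure on g = 'rV[K]_n is given by structure constants
   c i j = [e_i, e_j]; the bracket is the bilinear extension. *)
Section Lie.
Variables (K : fieldType) (n : nat) (c : 'I_n -> 'I_n -> 'rV[K]_n).

Definition br (x y : 'rV[K]_n) : 'rV[K]_n :=
  \sum_(i < n) \sum_(j < n) (x 0 i * y 0 j) *: c i j.

Definition is_lie : Prop :=
  (forall x, br x x = 0) /\
  (forall x y z, br x (br y z) + br y (br z x) + br z (br x y) = 0).

(* matrix of ad x acting on row vectors: v *m ad x = [x, v] *)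
Definition ad (x : 'rV[K]_n) : 'M[K]_n :=
  \matrix_(i < n, j < n) (br x (delta_mx 0 i)) 0 j.

Definition killing (x y : 'rV[K]_n) : K := \tr (ad x *m ad y).

(* subspaces of g are represented by square matrices (row spaces) *)
Definition is_ideal (U : 'M[K]_n) : Prop :=
  forall x y : 'rV[K]_n, (x <= U)%MS -> (br x y <= U)%MS.

Definition derived (U : 'M[K]_n) : 'M[K]_n :=
  (\sum_(i < n) \sum_(j < n) <<br (row i U) (row j U)>>)%MS.

Definition solvable_sub (U : 'M[K]_n) : Prop :=
  exists k, (iter k derived U == (0 : 'M[K]_n))%MS.

Definition semisimple : Prop :=
  forall U : 'M[K]_n, is_ideal U -> solvable_sub U -> (U == (0 : 'M[K]_n))%MS.

Definition cent_dim (x : 'rV[K]_n) : nat := \rank (kermx (ad x)).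

Definition lie_rank (l : nat) : Prop :=
  (exists x, cent_dim x = l) /\ (forall x, (l <= cent_dim x)%N).

Definition ad_nilpotent (x : 'rV[K]_n) : bool := ad x ^+ n == 0.

Definition expm (A : 'M[K]_n) : 'M[K]_n :=
  \sum_(k < n.+1) (k`!%:R)^-1 *: A ^+ k.

Definition msubst (m k : nat) (h : 'I_m -> {mpoly K[k]}) (p : {mpoly K[m]})
  : {mpoly K[k]} := mmap (@mpolyC k K) h p.

(* natural action of a linear map s of g on S(g) = {mpoly K[n]}:
   X_i (the i-th basis vector of g) |-> e_i *m s *)
Definition act (s : 'M[K]_n) (F : {mpoly K[n]}) : {mpoly K[n]} :=
  msubst (fun i => \sum_(j < n) s i j *: 'X_j) F.

(* invariance under the adjoint group G, generated by the exp(ad x),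
   x ad-nilpotent *)
Definition G_invariant (F : {mpoly K[n]}) : Prop :=
  forall x, ad_nilpotent x -> act (expm (ad x)) F = F.

Definition homogeneous (m : nat) (p : {mpoly K[m]}) : Prop :=
  exists d, p \is [in K[m], d.-homog].

Definition homog_gen_system (l : nat) (F : 'I_l -> {mpoly K[n]}) : Prop :=
  (forall i, homogeneous (F i)) /\ (forall i, G_invariant (F i)) /\
  (forall P, G_invariant P -> exists Q : {mpoly K[l]}, P = msubst F Q).

End Lie.

Section Slice.
Variables (K : fieldType) (n : nat) (c : 'I_n -> 'I_n -> 'rV[K]_n).
Local Notation br := (br c).

Definition nform (e f x y : 'rV[K]_n) : K := killing c x y / killing c e f.

Definition sl2_triple (e h f : 'rV[K]_n) : Prop :=
  br h e = 2%:R *: e /\ br h f = - (2%:R *: f) /\ br e f = h.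

Definition mindeg (m : nat) (p : {mpoly K[m]}) : nat :=
  \big[minn/msize p]_(mo <- msupp p) mdeg mo.
Definition initpart (m : nat) (p : {mpoly K[m]}) : {mpoly K[m]} :=
  \sum_(mo <- msupp p | mdeg mo == mindeg p) p@_mo *: 'X_[mo].

Variables (e f : 'rV[K]_n) (r : nat) (Be Bf : 'M[K]_(r, n)).
(* Be (resp. Bf) : a basis of g_e (resp. g_f);
   S(g_e) = {mpoly K[r]}, variable a <-> basis vector row a Be;
   K[g_f] = {mpoly K[r]}, variable b <-> coordinate of row b Bf. *)

(* psi_F (t) = kappa(F)(e + sum_b t_b Bf_b) as a polynomial on g_f *)
Definition psi (F : {mpoly K[n]}) : {mpoly K[r]} :=
  msubst (fun i => (nform e f (delta_mx 0 i) e)%:MP +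
     \sum_(b < r) nform e f (delta_mx 0 i) (row b Bf) *: 'X_b) F.

Definition pairing : 'M[K]_r := \matrix_(a < r, b < r) nform e f (row a Be) (row b Bf).

Definition kappa_e (p : {mpoly K[r]}) : {mpoly K[r]} :=
  msubst (fun a => \sum_(b < r) pairing a b *: 'X_b) p.

Definition kappa_e_inv (q : {mpoly K[r]}) : {mpoly K[r]} :=
  msubst (fun b => \sum_(a < r) invmx pairing b a *: 'X_a) q.

Definition eF (F : {mpoly K[n]}) : {mpoly K[r]} := kappa_e_inv (initpart (psi F)).

Definition mdegree (m : nat) (p : {mpoly K[m]}) : nat := (msize p).-1.

Definition alg_indep (m l : nat) (P : 'I_l -> {mpoly K[m]}) : Prop :=
  forall Q : {mpoly K[l]}, msubst P Q = 0 -> Q = 0.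

(* differentials at gamma in g_e^* (gamma given by its values on the basis Be) *)
Definition diff_mx (l : nat) (P : 'I_l -> {mpoly K[r]}) (gamma : 'rV[K]_r) : 'M[K]_(l, r) :=
  \matrix_(i < l, a < r) (mderiv a (P i)).@[fun b => gamma 0 b].

(* dim (g_e)^gamma : g_e^gamma = {x in g_e | gamma([x, g_e]) = 0} *)
Definition stab_mx (gamma : 'rV[K]_r) : 'M[K]_r :=
  \matrix_(a < r, b < r) (br (row a Be) (row b Be) *m pinvmx Be *m gamma^T) 0 0.
Definition stab_dim (gamma : 'rV[K]_r) : nat := \rank (kermx (stab_mx gamma)).

Definition index_is (m : nat) : Prop :=
  (exists gamma, stab_dim gamma = m) /\ (forall gamma, (m <= stab_dim gamma)%N).

End Slice.

(* Main.v *)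
(** Let M be the Lie-Poisson matrix on the dual of g, D the Jacobian matrix of F_1, ..., F_l,
    a(T,T') = det (M + T^T T') and b(T) = det (D T^T) for l x n matrices T, T'. Richardson's
    tangency argument shows that, at the generic point of the dual and at the generic point of
    every invariant prime divisor, the rows of D span the kernel of M. Hence a(T,T') and
    b(T) b(T') are proportional over the function field; a prime dividing the numerator or the
    denominator of the ratio would be an invariant divisor on which all frames degenerate, so
    the ratio is a nonzero constant (Kostant's identity).

    Restrict this identity to the line e + s y with y in g_f, in a basis adapted to the
    decomposition of g into g_e and [f,g]. The left side is s^r times a polynomial whose value
    at s = 0 is, up to a nonzero factor, det (stab_mx gamma + T^T T'), where gamma is the form
    (y, -) on g_e. The right side is s^(l + 2 sum (d_i - 1)) times a polynomial whose value at
    s = 0 is, up to a nonzero factor, the product of two maximal minors of the differentials at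
    gamma of the eF_i, with d_i = deg eF_i. Comparing the orders at s = 0 gives (i), and
    comparing leading terms, with the Jacobian criterion for algebraic independence, gives
    (ii) and (iii). *)

Require Import Defs.
From HB Require Import structures.
From mathcomp Require Import all_boot all_order all_algebra.
From mathcomp Require Import mpoly.
From mathcomp Require Import separable ring_quotient generic_quotient fraction.
From mathcomp Require Import ring zify.
From Stdlib Require Import ClassicalEpsilon.
Set Implicit Arguments. Unset Strict Implicit. Unset Printing Implicit Defensive.
Import Order.TTheory GRing.Theory Num.Theory.
Local Open Scope ring_scope.

(** * Derivations and conjugacy of matrices *)

(** Geometry is done with fields instead of varieties. A generic point is a ring morphism from the
    polynomial ring to a field generated by its image (the fraction field, or the residue field of a
    prime), and a tangent vector at it is a derivation of that field. Tangency to orbits then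
    becomes a fact on matrices over a differential field: if the characteristic polynomial of N is
    constant, dN is trace-orthogonal to the commutant of N. It is applied to ad of the generic
    point, whose characteristic polynomial has invariant coefficients. The ranks at such a point
    come from counting: D has l rows, M has rank at most n - l by definition of the rank of g, and
    tangency gives n - rank D <= rank M, so all are equalities. Prime divisors require unique
    factorization. That the prime factors of an invariant ratio are themselves invariant reflects
    the connectedness of G: along exp(t ad x) they satisfy u' = b u, and a polynomial in t can do so
    only if u' = 0. Semisimplicity is given as the absence of solvable ideals, so nondegeneracy of
    the Killing form has to be obtained first, by Cartan's criterion. *)

Section MatrixPolynomials.
Variable (F : fieldType).

(** The size may be 0: the splittings below can produce empty blocks. *)
Definition mxp n (N : 'M[F]_n) (p : {poly F}) : 'M[F]_n :=
  \sum_(i < size p) p`_i *: N ^+ i.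

Lemma mxp_horner n (N : 'M[F]_n.+1) p : mxp N p = horner_mx N p.
Proof.
rewrite -{2}[p]coefK poly_def rmorph_sum /=; apply: eq_bigr => i _.
by rewrite -mul_polyC rmorphM rmorphXn /= horner_mx_C horner_mx_X -mul_scalar_mx.
Qed.

Lemma mxpD n (N : 'M[F]_n) p q : mxp N (p + q) = mxp N p + mxp N q.
Proof. by case: n N => [|n] N; rewrite ?thinmx0 ?[RHS]thinmx0 // !mxp_horner rmorphD. Qed.

Lemma mxpM n (N : 'M[F]_n) p q : mxp N (p * q) = mxp N p *m mxp N q.
Proof. by case: n N => [|n] N; rewrite ?thinmx0 ?[RHS]thinmx0 // !mxp_horner rmorphM. Qed.

Lemma mxpC n (N : 'M[F]_n) a : mxp N a%:P = a%:M.
Proof. by case: n N => [|n] N; rewrite ?thinmx0 ?[RHS]thinmx0 // mxp_horner horner_mx_C. Qed.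

Lemma mxpX n (N : 'M[F]_n) : mxp N 'X = N.
Proof. by case: n N => [|n] N; rewrite ?thinmx0 ?[RHS]thinmx0 // mxp_horner horner_mx_X. Qed.

Lemma mxp1 n (N : 'M[F]_n) : mxp N 1 = 1%:M.
Proof. by rewrite -polyC1 mxpC. Qed.

Lemma mxp0 n (N : 'M[F]_n) : mxp N 0 = 0.
Proof. by rewrite /mxp size_poly0 big_ord0. Qed.

Lemma mxpXn n (N : 'M[F]_n) p k : mxp N (p ^+ k) = mxp N p ^+ k.
Proof. by elim: k => [|k IH]; rewrite ?expr0 ?mxp1 // !exprS mxpM IH. Qed.

Lemma mxp_comm n (N Y : 'M[F]_n) p : N *m Y = Y *m N ->
  mxp N p *m Y = Y *m mxp N p.
Proof.
case: n N Y => [|n] N Y; first by move=> _; rewrite [LHS]thinmx0 [RHS]thinmx0.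
by rewrite mxp_horner => /comm_horner_mx; apply.
Qed.

Lemma mxp_char n (N : 'M[F]_n) : mxp N (char_poly N) = 0.
Proof. by case: n N => [|n] N; rewrite ?thinmx0 ?[RHS]thinmx0 // mxp_horner Cayley_Hamilton. Qed.

End MatrixPolynomials.

(** * Block decompositions along stable subspaces *)

Section Splitting.
Variable (F : fieldType).

(* [U], [V] are bases of complementary row spaces, and [A], [B] the dual columns. *)
Definition mxsplit k k' n (U : 'M[F]_(k, n)) (V : 'M[F]_(k', n))
   (A : 'M[F]_(n, k)) (B : 'M[F]_(n, k')) :=
  [/\ U *m A = 1%:M, U *m B = 0, V *m A = 0, V *m B = 1%:M & A *m U + B *m V = 1%:M].

Lemma exists_mxsplit n (W : 'M[F]_n) :
  exists k k' U V A B, @mxsplit k k' n U V A B /\ (U :=: W)%MS.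
Proof.
set C := (W^C)%MS.
exists (\rank W), (\rank C), (row_base W), (row_base C),
  (proj_mx W C *m pinvmx (row_base W)), (proj_mx C W *m pinvmx (row_base C)).
have dWC : (W :&: C = 0)%MS by apply: capmx_compl.
have dCW : (C :&: W = 0)%MS by rewrite capmxC.
have UP : row_base W *m proj_mx W C = row_base W by rewrite proj_mx_id ?eq_row_base.
have VP : row_base C *m proj_mx C W = row_base C by rewrite proj_mx_id ?eq_row_base.
have UQ : row_base W *m proj_mx C W = 0 by rewrite proj_mx_0 ?eq_row_base.
have VQ : row_base C *m proj_mx W C = 0 by rewrite proj_mx_0 ?eq_row_base.
have full : (1%:M <= W + C)%MS by rewrite sub1mx addsmx_compl_full.
split; last exact: eq_row_base.
have PW : (proj_mx W C <= row_base W)%MS by rewrite eq_row_base -[proj_mx _ _]mul1mx proj_mx_sub.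
have PC : (proj_mx C W <= row_base C)%MS by rewrite eq_row_base -[proj_mx _ _]mul1mx proj_mx_sub.
have PD : proj_mx W C + proj_mx C W = 1%:M.
  by rewrite -[proj_mx W C]mul1mx -[proj_mx C W]mul1mx add_proj_mx.
move: (mulmxVp (row_base_free W)) (mulmxVp (row_base_free C)) (mulmxKpV PW) (mulmxKpV PC).
move: (pinvmx (row_base W)) (pinvmx (row_base C)) => A B hA hB.
move: (proj_mx W C) (proj_mx C W) UP VP UQ VQ PD => P Q UP VP UQ VQ PD hP hQ.
by split; rewrite ?hP ?hQ // ?mulmxA ?UP ?VP ?UQ ?VQ ?mul0mx ?hA ?hB.
Qed.

Section Split.
Variables (k k' n : nat) (U : 'M[F]_(k, n)) (V : 'M[F]_(k', n)).
Variables (A : 'M[F]_(n, k)) (B : 'M[F]_(n, k')).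
Hypothesis H : mxsplit U V A B.

Lemma mxsplit_mid m p (X : 'M[F]_(m, n)) (Y : 'M[F]_(n, p)) :
  X *m Y = (X *m A) *m (U *m Y) + (X *m B) *m (V *m Y).
Proof.
case: H => _ _ _ _ H1; rewrite !mulmxA -mulmxDl -!(mulmxA X) -mulmxDr.
by rewrite H1 mulmx1.
Qed.

Lemma mxsplit_tr (X : 'M[F]_n) : \tr X = \tr (U *m X *m A) + \tr (V *m X *m B).
Proof.
case: H => _ _ _ _ H1.
rewrite -{1}[X]mulmx1 -H1 mulmxDr mxtraceD !mulmxA.
by rewrite mxtrace_mulC mulmxA [X in _ + X = _]mxtrace_mulC !mulmxA.
Qed.

(** [U *m X *m B = 0] says that the row space of [U] is stable under [X]; then [X] is block
    triangular and diagonal blocks multiply. *)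
Lemma mxsplit_ul (X Y : 'M[F]_n) : U *m X *m B = 0 ->
  U *m (X *m Y) *m A = (U *m X *m A) *m (U *m Y *m A).
Proof. by move=> h; rewrite mulmxA -mulmxA mxsplit_mid h mul0mx addr0 !mulmxA. Qed.

Lemma mxsplit_lr (X Y : 'M[F]_n) : U *m Y *m B = 0 ->
  V *m (X *m Y) *m B = (V *m X *m B) *m (V *m Y *m B).
Proof.
by move=> h; rewrite mulmxA -mulmxA mxsplit_mid [U *m _]mulmxA h mulmx0 add0r !mulmxA.
Qed.

Lemma mxsplit_ur (X Y : 'M[F]_n) : U *m X *m B = 0 -> U *m Y *m B = 0 ->
  U *m (X *m Y) *m B = 0.
Proof.
by move=> h h'; rewrite mulmxA -mulmxA mxsplit_mid h mul0mx addr0 !mulmxA -(mulmxA _ U) -(mulmxA _ (_ *m _)) h' mulmx0.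
Qed.

Variable N : 'M[F]_n.
Hypothesis HN : U *m N *m B = 0.

Lemma mxsplit_exp i : U *m N ^+ i *m B = 0.
Proof.
elim: i => [|i IH]; first by case: H => _ h _ _ _; rewrite expr0 mulmx1.
by rewrite exprS; apply: mxsplit_ur.
Qed.

Lemma mxsplit_mxp p : U *m mxp N p *m B = 0.
Proof.
rewrite mulmx_sumr mulmx_suml big1 // => i _.
by rewrite -scalemxAr -scalemxAl mxsplit_exp scaler0.
Qed.

Lemma mxp_split_u p : mxp (U *m N *m A) p = U *m mxp N p *m A.
Proof.
have hX i : (U *m N *m A) ^+ i = U *m N ^+ i *m A.
  elim: i => [|i IH]; first by case: H => h _ _ _ _; rewrite !expr0 mulmx1.
  by rewrite !exprS IH mxsplit_ul.
rewrite mulmx_sumr mulmx_suml; apply: eq_bigr => i _.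
by rewrite hX -scalemxAr -scalemxAl.
Qed.

Lemma mxp_split_d p : mxp (V *m N *m B) p = V *m mxp N p *m B.
Proof.
have hX i : (V *m N *m B) ^+ i = V *m N ^+ i *m B.
  elim: i => [|i IH]; first by case: H => _ _ _ h _; rewrite !expr0 mulmx1.
  by rewrite !exprSr IH [RHS]mxsplit_lr.
rewrite mulmx_sumr mulmx_suml; apply: eq_bigr => i _.
by rewrite hX -scalemxAr -scalemxAl.
Qed.

End Split.

(** [U] spans the kernel of q(N), which the commutant of [N] preserves. The image of s(N) lies in
    this kernel, so [s] annihilates the block of [N] on the quotient. *)
Lemma exists_mxsplit_ker n (N : 'M[F]_n) (q s : {poly F}) :
  mxp N (q * s) = 0 ->
  exists k k' U V A B, [/\ @mxsplit k k' n U V A B,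
     forall Y, N *m Y = Y *m N -> U *m Y *m B = 0,
     mxp (U *m N *m A) q = 0 & mxp (V *m N *m B) s = 0].
Proof.
move=> Nqs; have [k [k' [U [V [A [B [H UW]]]]]]] := exists_mxsplit (kermx (mxp N q)).
exists k, k', U, V, A, B.
have UWs m (C : 'M_(m, n)) : (C <= U)%MS = (C <= kermx (mxp N q))%MS by rewrite UW.
have Uq : U *m mxp N q = 0 by apply/sub_kermxP; rewrite UW.
have UY Y : N *m Y = Y *m N -> U *m Y *m B = 0.
  move=> NY; have : (U *m Y <= U)%MS.
    rewrite UWs; apply/sub_kermxP.
    by rewrite -mulmxA -(mxp_comm _ NY) mulmxA Uq mul0mx.
  case/submxP => D ->; case: H => _ h _ _ _.
  by rewrite -mulmxA h mulmx0.
split=> //; first by rewrite (mxp_split_u H) ?Uq ?mul0mx //; apply: UY.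
have : (mxp N s <= U)%MS.
  by rewrite UW; apply/sub_kermxP; rewrite -mxpM mulrC.
case/submxP => D hD; rewrite (mxp_split_d H) ?hD; last exact: UY.
by case: H => _ h _ _ _; rewrite -mulmxA -(mulmxA D) h !mulmx0.
Qed.

End Splitting.

(** * Matrices over a differential field *)

Section Derivations.
Variable (L : fieldType).

Definition derivation (d : L -> L) :=
  (forall x y, d (x + y) = d x + d y) /\ (forall x y, d (x * y) = d x * y + x * d y).

Variable d : L -> L.
Hypothesis dP : derivation d.

Let dD x y : d (x + y) = d x + d y. Proof. by case: dP. Qed.
Let dM x y : d (x * y) = d x * y + x * d y. Proof. by case: dP. Qed.

Lemma derivation_0 : d 0 = 0.
Proof. by apply: (addrI (d 0)); rewrite -dD !addr0. Qed.

Lemma derivation_1 : d 1 = 0.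
Proof. by apply: (addrI (d 1)); rewrite addr0 -{3}[1]mulr1 dM mulr1 mul1r. Qed.

Lemma derivation_sum I (r : seq I) P (F : I -> L) :
  d (\sum_(i <- r | P i) F i) = \sum_(i <- r | P i) d (F i).
Proof. exact: (big_morph d dD derivation_0). Qed.

Definition dmx m n (A : 'M[L]_(m, n)) := map_mx d A.

Lemma dmxD m n (A B : 'M[L]_(m, n)) : dmx (A + B) = dmx A + dmx B.
Proof. by apply/matrixP=> i j; rewrite !mxE dD. Qed.

Lemma dmx0 m n : dmx (0 : 'M_(m, n)) = 0.
Proof. by apply/matrixP=> i j; rewrite !mxE derivation_0. Qed.

Lemma dmxM m n p (A : 'M[L]_(m, n)) (B : 'M[L]_(n, p)) :
  dmx (A *m B) = dmx A *m B + A *m dmx B.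
Proof.
apply/matrixP=> i j; rewrite !mxE derivation_sum -big_split; apply: eq_bigr => k _ /=.
by rewrite dM !mxE.
Qed.

Lemma dmx_scalar n (a : L) : dmx (a%:M : 'M_n) = (d a)%:M.
Proof. by apply/matrixP=> i j; rewrite !mxE; case: (i == j); rewrite ?mulr1n ?mulr0n ?derivation_0. Qed.

Definition const_poly (p : {poly L}) := forall i, d p`_i = 0.

Definition dpoly (p : {poly L}) := \poly_(i < size p) d p`_i.

Lemma coef_dpoly p i : (dpoly p)`_i = d p`_i.
Proof. by rewrite coef_poly; case: ltnP => // h; rewrite nth_default ?derivation_0. Qed.

Lemma dpolyM p q : dpoly (p * q) = dpoly p * q + p * dpoly q.
Proof.
apply/polyP=> i; rewrite coef_dpoly coefD !coefM derivation_sum -big_split.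
by apply: eq_bigr => j _ /=; rewrite dM !coef_dpoly.
Qed.

Lemma const_polyP p : const_poly p <-> dpoly p = 0.
Proof.
split=> [h|h i]; last by rewrite -coef_dpoly h coef0.
by apply/polyP=> i; rewrite coef_dpoly h coef0.
Qed.

Lemma size_dpoly p : p \is monic -> (size (dpoly p) < size p)%N.
Proof.
move=> pm; have p0 := monic_neq0 pm.
have s0 : (0 < size p)%N by rewrite size_poly_gt0.
rewrite -(prednK s0) ltnS; apply/leq_sizeP => j.
rewrite leq_eqVlt => /orP [/eqP <-|h].
  by rewrite coef_dpoly -lead_coefE (monicP pm) derivation_1.
by rewrite coef_dpoly nth_default ?derivation_0 // -(prednK s0).
Qed.

Lemma const_deriv p : const_poly p -> const_poly p^`().
Proof.
move=> h i; rewrite coef_deriv; elim: {2}(i.+1) => [|k IH]; first by rewrite mulr0n derivation_0.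
by rewrite mulrS dD h IH addr0.
Qed.

Hypothesis char0 : [pchar L] =i pred0.

(* A constant polynomial is the product of a constant separable polynomial and a
   constant polynomial of smaller degree, namely its gcd with its derivative. *)
Lemma const_poly_split p : p \is monic -> const_poly p -> (1 < size p)%N ->
  exists q s, [/\ p = q * s /\ s \is monic, const_poly q, const_poly s,
    coprimep q q^`() & (size s < size p)%N].
Proof.
move=> pm pc p1; have p0 := monic_neq0 pm.
have p'0 : p^`() != 0.
  apply/eqP => /polyP; case E: (size p) p1 => [|[|k]] // _ /(_ k).
  rewrite coef_deriv coef0; move/monicP: pm; rewrite lead_coefE E /= => -> /eqP.
  by rewrite ((pcharf0P _).1 char0).
set g0 := gcdp p p^`(); have g00 : g0 != 0 by rewrite gcdp_eq0 negb_and p0.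
set g := (lead_coef g0)^-1 *: g0.
have lg0 : (lead_coef g0)^-1 != 0 by rewrite invr_eq0 lead_coef_eq0.
have gm : g \is monic by rewrite monicE lead_coefZ mulVf // lead_coef_eq0.
have gg0 : g %= g0 by apply: eqp_scale.
have g0' := monic_neq0 gm.
have gp : g %| p by rewrite (eqp_dvdl _ gg0) dvdp_gcdl.
have gp' : g %| p^`() by rewrite (eqp_dvdl _ gg0) dvdp_gcdr.
have pq : p = p %/ g * g by rewrite divpK.
have p'w : p^`() = p^`() %/ g * g by rewrite divpK.
set q := p %/ g in pq; set w := p^`() %/ g in p'w.
have cqw : coprimep q w.
  have : coprimep (p %/ g0) (p^`() %/ g0) by apply: coprimep_div_gcd; rewrite p0.
  by rewrite /q /w (eqp_coprimepl _ (eqp_divr _ gg0)) (eqp_coprimepr _ (eqp_divr _ gg0)).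
have e1 : dpoly q * g = - (q * dpoly g).
  by apply/eqP; rewrite -addr_eq0 -dpolyM -pq; apply/eqP/const_polyP.
have e2 : dpoly w * g = - (w * dpoly g).
  by apply/eqP; rewrite -addr_eq0 -dpolyM -p'w; apply/eqP/const_polyP/const_deriv.
(* Since p = q g and p' = w g are constant, [g] divides [q * dpoly g] and [w * dpoly g], hence
   [dpoly g] by coprimality; but [dpoly g] has smaller size than the monic [g]. *)
have dg0 : dpoly g = 0.
  have gdg : g %| dpoly g.
    have : g %| q * dpoly g by rewrite -dvdpNr -e1 dvdp_mull.
    have : g %| w * dpoly g by rewrite -dvdpNr -e2 dvdp_mull.
    move/Bezout_eq1_coprimepP: cqw => [[u v] /= uv] h1 h2.
    rewrite -[dpoly g]mul1r -uv mulrDl -!mulrA.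
    by apply: dvdp_add; apply: dvdp_mull.
  apply/eqP; apply: contraTT (size_dpoly gm) => h.
  by rewrite -leqNgt dvdp_leq.
have qm : q \is monic.
  by rewrite -(monicMr q gm) -pq.
exists q, g; split=> //.
- apply/const_polyP; apply: (mulIf g0').
  by rewrite e1 dg0 mulr0 oppr0 mul0r.
- exact/const_polyP.
- suff: separable_poly q by rewrite unlock.
  apply: dvdp_separable (make_separable p0).
  by rewrite (eqp_dvdl _ (eqp_divr _ gg0)).
- apply: leq_ltn_trans (_ : (size p^`() < size p)%N); first exact: dvdp_leq.
  by rewrite lt_size_deriv.
Qed.

(** The rule d(p(N)) = p'(N) dN requires commutation, but under the trace against an element of the
    commutant of [N] cyclicity supplies it. *)
Lemma tr_dmx_mxp n (N : 'M[L]_n) p : const_poly p ->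
  forall Z, N *m Z = Z *m N ->
  \tr (dmx (mxp N p) *m Z) = \tr (dmx N *m (mxp N p^`() *m Z)).
Proof.
elim/poly_ind: p => [|p a IH] pc Z NZ.
  by rewrite deriv0 !mxp0 mul0mx mulmx0 dmx0 mul0mx.
have pc' : const_poly p by move=> i; have := pc i.+1; rewrite coefD coefMX coefC /= addr0.
have ac : d a = 0 by have := pc 0%N; rewrite coefD coefMX coefC /= add0r.
rewrite mxpD mxpC dmxD dmx_scalar ac.
rewrite derivD derivM derivX derivC mulr1 addr0 mxpD !mxpM !mxpX dmxM.
rewrite raddf0 addr0 mulmxDl mxtraceD.
rewrite -mulmxA IH //; last by rewrite -[RHS]mulmxA -NZ.
rewrite mulmxDl mulmxDr mxtraceD -!mulmxA; congr (_ + _).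
by rewrite mxtrace_mulC -!mulmxA (mxp_comm p NZ).
Qed.

(** Differentiating the conjugating matrix adds a commutator with [N], which is trace-orthogonal to
    the commutant: the terms [t1] and [t3] cancel. *)
Lemma conj_dmx_tr n (N Y E E' : 'M[L]_n) : E *m E' = 1%:M -> N *m Y = Y *m N ->
  \tr (dmx (E *m N *m E') *m (E *m Y *m E')) = \tr (dmx N *m Y).
Proof.
move=> EE' NY; have E'E : E' *m E = 1%:M by apply: mulmx1C.
have hE' : dmx E' = - (E' *m dmx E *m E').
  have : dmx (E *m E') = 0 by rewrite EE' dmx_scalar derivation_1 -scalemx1 scale0r.
  rewrite dmxM => /eqP; rewrite addrC addr_eq0 => /eqP h.
  by rewrite -[dmx E']mul1mx -E'E -mulmxA h mulmxN mulmxA.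
rewrite !dmxM hE' mulmxN !mulmxDl !mxtraceD mulNmx raddfN /=.
set t1 := \tr _; set t2 := \tr _; set t3 := \tr _.
have -> : t1 = t3.
  transitivity (\tr (E' *m (dmx E *m (N *m Y)))).
    by rewrite /t1 [in RHS]mxtrace_mulC -!mulmxA (mulmxA E' E) E'E mul1mx.
  rewrite /t3 -!mulmxA (mulmxA E' E) E'E mul1mx [in RHS]mxtrace_mulC.
  by rewrite -!mulmxA E'E mulmx1 [in RHS]mxtrace_mulC -!mulmxA NY.
rewrite addrAC subrr add0r /t2 -!mulmxA (mulmxA E' E) E'E mul1mx.
by rewrite mxtrace_mulC -!mulmxA E'E mulmx1.
Qed.

(* If the characteristic polynomial of [N] is constant, then [dN] is orthogonal, for the
   trace form, to the commutant of [N]: infinitesimally, [N] moves in its conjugacy class. *)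
Theorem tr_deriv_commutant n (N Y : 'M[L]_n) : const_poly (char_poly N) ->
  N *m Y = Y *m N -> \tr (dmx N *m Y) = 0.
Proof.
(* Only annihilation by some monic constant polynomial is kept, a property that passes to the
   blocks. *)
move: (char_poly_monic N) (mxp_char N); move: (char_poly N) => p.
elim: {p}_.+1 {-2}p (ltnSn (size p)) => // b IH p pb in n N Y *.
move=> pm Np pc NY.
have [p1|p1] := leqP (size p) 1.
  have pE : p = 1.
    by move: pm; rewrite (size1_polyC p1) monicE lead_coefC => /eqP ->.
  by move: Np; rewrite pE mxp1 => h; rewrite -[Y]mulmx1 h !mulmx0 mxtrace0.
have [q [s [[pqs sm] qc sc qq' ssp]]] := const_poly_split pm pc p1.
rewrite pqs in Np.
have [k [k' [U [V [A [B [H UY Nq Ns]]]]]]] := exists_mxsplit_ker Np.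
have kk : n = (k + k')%N.
  case: (H) => h1 h2 h3 h4 h5; apply/eqP; rewrite eqn_leq; apply/andP; split.
    by apply: (@mulmx1_min _ _ _ (row_mx A B) (col_mx U V)); rewrite mul_row_col.
  apply: (@mulmx1_min _ _ _ (col_mx U V) (row_mx A B)).
  by rewrite mul_col_row h1 h2 h3 h4 -scalar_mx_block.
subst n; case: (H) => h1 h2 h3 h4 h5.
have EE' : col_mx U V *m row_mx A B = 1%:M by rewrite mul_col_row h1 h2 h3 h4 -scalar_mx_block.
rewrite -(conj_dmx_tr EE' NY) (mul_col_mx U V N) (mul_col_mx U V Y) !mul_col_row UY // (UY Y) // /dmx map_block_mx.
rewrite -!/(dmx _) dmx0 mulmx_block mxtrace_block mulmx0 mul0mx addr0 add0r.
have cu : (U *m N *m A) *m (U *m Y *m A) = (U *m Y *m A) *m (U *m N *m A).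
  by rewrite -!(mxsplit_ul H) ?NY //; apply: UY.
have cd : (V *m N *m B) *m (V *m Y *m B) = (V *m Y *m B) *m (V *m N *m B).
  by rewrite -!(mxsplit_lr H) ?NY //; apply: UY.
(* The quotient block is annihilated by [s], of smaller size. The other block is annihilated by the
   separable [q]. *)
rewrite (IH s _ _ _ _ sm Ns sc cd) ?addr0; last by rewrite -ltnS (leq_trans _ pb).
move/Bezout_eq1_coprimepP: qq' => [[u v] /= uv].
(* Differentiate q(N) = 0 against v(N) Y: since v q' is 1 modulo q, the factor q'(N) v(N) is the
   identity and tr(dN Y) remains. *)
have := @tr_dmx_mxp _ (U *m N *m A) q qc (mxp (U *m N *m A) v *m (U *m Y *m A)).
rewrite Nq dmx0 mul0mx mxtrace0.
rewrite [mxp _ q^`() *m _]mulmxA -mxpM mulrC (_ : v * q^`() = 1 - u * q); last by rewrite -uv addrAC subrr add0r.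
have -> : mxp (U *m N *m A) (1 - u * q) = 1%:M.
  by rewrite mxpD mxp1 -mulNr mxpM Nq mulmx0 addr0.
rewrite mul1mx => <- //.
by rewrite -[RHS]mulmxA -cu [LHS]mulmxA [RHS]mulmxA (mxp_comm v (erefl _)).
Qed.

End Derivations.

(** * Cartan's criterion *)

Section LieBasics.
Variables (F : fieldType) (n : nat) (c : 'I_n -> 'I_n -> 'rV[F]_n).
Local Notation br := (br c).
Local Notation ad := (ad c).
Implicit Types (x y z u v w : 'rV[F]_n).

Lemma br_linear_l y a x z : br (a *: x + z) y = a *: br x y + br z y.
Proof.
rewrite /Defs.br scaler_sumr -big_split; apply: eq_bigr => i _ /=.
rewrite scaler_sumr -big_split; apply: eq_bigr => j _ /=.
by rewrite !mxE scalerA -scalerDl mulrDl mulrA.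
Qed.

Lemma br_linear_r x a y z : br x (a *: y + z) = a *: br x y + br x z.
Proof.
rewrite /Defs.br scaler_sumr -big_split; apply: eq_bigr => i _ /=.
rewrite scaler_sumr -big_split; apply: eq_bigr => j _ /=.
by rewrite !mxE scalerA -scalerDl mulrDr mulrCA.
Qed.

Lemma brDl y x z : br (x + z) y = br x y + br z y.
Proof. by rewrite -[x]scale1r br_linear_l !scale1r. Qed.
Lemma brDr x y z : br x (y + z) = br x y + br x z.
Proof. by rewrite -[y]scale1r br_linear_r !scale1r. Qed.
Lemma br0l y : br 0 y = 0.
Proof. by apply: (addrI (br 0 y)); rewrite -brDl !addr0. Qed.
Lemma br0r y : br y 0 = 0.
Proof. by apply: (addrI (br y 0)); rewrite -brDr !addr0. Qed.
Lemma brZl y a x : br (a *: x) y = a *: br x y.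
Proof. by rewrite -[a *: x]addr0 br_linear_l br0l addr0. Qed.
Lemma brZr y a x : br y (a *: x) = a *: br y x.
Proof. by rewrite -[a *: x]addr0 br_linear_r br0r addr0. Qed.
Lemma brNl y x : br (- x) y = - br x y.
Proof. by rewrite -scaleN1r brZl scaleN1r. Qed.
Lemma brNr y x : br y (- x) = - br y x.
Proof. by rewrite -scaleN1r brZr scaleN1r. Qed.

Lemma br_suml I (r : seq I) P (f : I -> 'rV_n) y :
  br (\sum_(i <- r | P i) f i) y = \sum_(i <- r | P i) br (f i) y.
Proof. exact: (big_morph (br^~ y) (brDl y) (br0l y)). Qed.
Lemma br_sumr I (r : seq I) P (f : I -> 'rV_n) y :
  br y (\sum_(i <- r | P i) f i) = \sum_(i <- r | P i) br y (f i).
Proof. exact: (big_morph (br y) (brDr y) (br0r y)). Qed.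

Lemma br_basis i j : br (delta_mx 0 i) (delta_mx 0 j) = c i j.
Proof.
rewrite /Defs.br (bigD1 i) //= (bigD1 j) //= !mxE !eqxx mulr1 scale1r !big1 ?addr0 //.
  move=> k ki; rewrite big1 // => k' _; rewrite !mxE eqxx (negPf ki) /= mul0r scale0r //.
by move=> k kj; rewrite !mxE eqxx (negPf kj) /= mulr0 scale0r.
Qed.

Lemma mul_ad v x : v *m ad x = br x v.
Proof.
rewrite [v in RHS]row_sum_delta br_sumr; apply/rowP => j.
rewrite mxE summxE; apply: eq_bigr => i _.
by rewrite brZr !mxE.
Qed.

Lemma row_ad x i : row i (ad x) = br x (delta_mx 0 i).
Proof. by rewrite rowE mul_ad. Qed.

Lemma adD x y : ad (x + y) = ad x + ad y.
Proof. by apply/row_matrixP=> i; rewrite linearD /= !row_ad brDl. Qed.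
Lemma adZ a x : ad (a *: x) = a *: ad x.
Proof. by apply/row_matrixP=> i; rewrite linearZ /= !row_ad brZl. Qed.
Lemma ad0 : ad 0 = 0.
Proof. by apply/row_matrixP=> i; rewrite !row_ad br0l row0. Qed.
Lemma adN x : ad (- x) = - ad x.
Proof. by rewrite -scaleN1r adZ scaleN1r. Qed.
Lemma ad_sum I (r : seq I) P (f : I -> 'rV_n) :
  ad (\sum_(i <- r | P i) f i) = \sum_(i <- r | P i) ad (f i).
Proof. exact: (big_morph ad adD ad0). Qed.

Lemma killingDl y x z : killing c (x + z) y = killing c x y + killing c z y.
Proof. by rewrite /killing adD mulmxDl mxtraceD. Qed.
Lemma killingDr y x z : killing c y (x + z) = killing c y x + killing c y z.
Proof. by rewrite /killing adD mulmxDr mxtraceD. Qed.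
Lemma killingZl a x y : killing c (a *: x) y = a * killing c x y.
Proof. by rewrite /killing adZ -scalemxAl mxtraceZ. Qed.
Lemma killingZr a x y : killing c y (a *: x) = a * killing c y x.
Proof. by rewrite /killing adZ -scalemxAr mxtraceZ. Qed.
Lemma killing0l y : killing c 0 y = 0.
Proof. by rewrite /killing ad0 mul0mx mxtrace0. Qed.
Lemma killing0r y : killing c y 0 = 0.
Proof. by rewrite /killing ad0 mulmx0 mxtrace0. Qed.
Lemma killingC x y : killing c x y = killing c y x.
Proof. exact: mxtrace_mulC. Qed.

Definition gram : 'M[F]_n := \matrix_(i, j) killing c (delta_mx 0 i) (delta_mx 0 j).

Lemma gram_tr : gram^T = gram.
Proof. by apply/matrixP=> i j; rewrite !mxE killingC. Qed.

Lemma mul_gramE x j : (x *m gram) 0 j = killing c x (delta_mx 0 j).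
Proof.
rewrite [x in RHS]row_sum_delta (big_morph (killing c ^~ _) (killingDl _) (killing0l _)).
by rewrite mxE; apply: eq_bigr => i _; rewrite killingZl mxE.
Qed.

Lemma mul_gram x y : (x *m gram *m y^T) 0 0 = killing c x y.
Proof.
rewrite [y in RHS]row_sum_delta (big_morph (killing c _) (killingDr _) (killing0r _)).
rewrite mxE; apply: eq_bigr => j _.
by rewrite mul_gramE killingZr [y^T j 0]mxE mulrC.
Qed.

Lemma gram_kerP x : reflect (forall y, killing c x y = 0) (x *m gram == 0).
Proof.
apply: (iffP eqP) => [h y|h]; first by rewrite -mul_gram h mul0mx mxE.
apply/rowP => j; rewrite [RHS]mxE -(h (delta_mx 0 j)) -mul_gram trmx_delta -colE.
by rewrite [RHS]mxE.
Qed.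

Hypothesis Hlie : is_lie c.

Lemma br_xx x : br x x = 0. Proof. by case: Hlie. Qed.

Lemma brC x y : br x y = - br y x.
Proof.
have := br_xx (x + y); rewrite brDl !brDr !br_xx addr0 add0r => /eqP.
by rewrite addr_eq0 => /eqP.
Qed.

Lemma br_jacobi x y z : br (br x y) z = br x (br y z) - br y (br x z).
Proof.
case: Hlie => _ /(_ x y z) /eqP; rewrite addr_eq0 => /eqP h.
by rewrite [LHS]brC -h (brC z x) brNr.
Qed.

Lemma ad_br x y : ad (br x y) = ad y *m ad x - ad x *m ad y.
Proof.
apply/row_matrixP=> i; rewrite linearB /= !row_mul !row_ad !mul_ad.
by rewrite br_jacobi.
Qed.

Lemma killing_inv x y z : killing c (br x y) z = killing c x (br y z).
Proof.
rewrite /killing !ad_br mulmxBl mulmxBr !raddfB /=; congr (_ - _); last by rewrite mulmxA.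
by rewrite -mulmxA mxtrace_mulC mulmxA.
Qed.

Lemma br_ad_derivation x u v :
  br u v *m ad x = br (u *m ad x) v + br u (v *m ad x).
Proof.
by rewrite !mul_ad br_jacobi subrK.
Qed.

Lemma ad_gram_skew x : ad x *m gram = - (gram *m (ad x)^T).
Proof.
apply/matrixP=> i j.
have E (A : 'M[F]_n) : A i j = ((delta_mx 0 i : 'rV_n) *m A *m (delta_mx 0 j : 'rV_n)^T) 0 0.
  by rewrite -rowE trmx_delta -colE !mxE.
rewrite E mulmxA mul_gram mul_ad [RHS]E mulmxN mulNmx [RHS]mxE.
rewrite (mulmxA (delta_mx 0 i)) -(mulmxA _ (ad x)^T) -trmx_mul mul_gram mul_ad.
by rewrite brC -scaleN1r killingZl mulN1r killing_inv.
Qed.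

End LieBasics.

(** * Engel's theorem and solvability of algebras of ad-nilpotent elements *)

Section Engel.
Variables (F : fieldType) (n : nat) (c : 'I_n -> 'I_n -> 'rV[F]_n).
Local Notation br := (br c).
Local Notation ad := (ad c).
Implicit Types (x y z u v w : 'rV[F]_n) (s : seq 'rV[F]_n).

Lemma derived_ind (U : 'M[F]_n) (P : 'rV[F]_n -> Prop) :
  P 0 -> (forall a u v, P u -> P v -> P (a *: u + v)) ->
  (forall i j, P (br (row i U) (row j U))) ->
  forall v, (v <= derived c U)%MS -> P v.
Proof.
move=> P0 PD Pbr.
have Psum I (r : seq I) (f : I -> 'rV_n) : (forall i, P (f i)) -> P (\sum_(i <- r) f i).
  by move=> Pf; elim/big_ind: _ => // u v Pu Pv; rewrite -[u]scale1r; apply: PD.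
have PZ a u : P u -> P (a *: u) by move=> Pu; rewrite -[a *: u]addr0; apply: PD.
move=> v /sub_sumsmxP [u ->]; apply: (Psum) => i.
have := submxMl (u i) (\sum_(j < n) <<br (row i U) (row j U)>>)%MS.
case/sub_sumsmxP => u' ->; apply: Psum => j.
have : (u' j *m <<br (row i U) (row j U)>>%MS <= br (row i U) (row j U))%MS.
  by apply: submx_trans (submxMl _ _) _; rewrite genmxE.
by case/sub_rVP => a ->; apply: PZ.
Qed.

Lemma br_in_derived (U : 'M[F]_n) u v :
  (u <= U)%MS -> (v <= U)%MS -> (br u v <= derived c U)%MS.
Proof.
move=> /submxP [a ->] /submxP [b ->].
rewrite [a *m U]mulmx_sum_row [b *m U]mulmx_sum_row br_suml summx_sub // => i _.
rewrite br_sumr summx_sub // => j _.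
rewrite brZl brZr !scalemx_sub //.
apply: (@submx_trans _ _ _ _ _ _ <<br (row i U) (row j U)>>%MS); first by rewrite genmxE.
apply: submx_trans (_ : (\sum_(j < n) <<br (row i U) (row j U)>> <= _)%MS).
  exact: (sumsmx_sup j).
exact: (sumsmx_sup i).
Qed.

Definition acts v s := foldl (fun v m => br m v) v s.

Lemma acts_linear a u v s : acts (a *: u + v) s = a *: acts u s + acts v s.
Proof. by elim: s u v => //= w s IH u v; rewrite br_linear_r IH. Qed.

Lemma acts0 s : acts 0 s = 0.
Proof. by elim: s => //= w s IH; rewrite br0r. Qed.

Definition in_mx (m : 'M[F]_n) : pred 'rV[F]_n := fun u => (u <= m)%MS.

(** Step [i] of the ascending annihilator filtration of g as a module over [m]. *)
Definition killed (m : 'M[F]_n) i v := forall s, all (in_mx m) s -> size s = i -> acts v s = 0.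

Lemma killed_linear m i a u v : killed m i u -> killed m i v -> killed m i (a *: u + v).
Proof. by move=> hu hv s sm si; rewrite acts_linear hu // hv // scaler0 addr0. Qed.

Lemma killed0 m i : killed m i 0.
Proof. by move=> s _ _; rewrite acts0. Qed.

Lemma killed_0 m v : killed m 0 v -> v = 0.
Proof. by move/(_ [::] isT (erefl _)). Qed.

Lemma killed_br m i u v : (u <= m)%MS -> killed m i.+1 v -> killed m i (br u v).
Proof. by move=> um h s sm si; apply: (h (u :: s)) => /=; rewrite ?si // /in_mx um. Qed.

Lemma killed_S m i v : killed m i v -> killed m i.+1 v.
Proof.
move=> h s; elim/last_ind: s => // s w _; rewrite all_rcons size_rcons => /andP [_ sm] [si].
by rewrite /acts -cats1 foldl_cat /= -/(acts v s) h // br0r.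
Qed.

Lemma killed_stable m i u v : (u <= m)%MS -> killed m i v -> killed m i (br u v).
Proof.
case: i => [|i] um h; last by apply/killed_S/killed_br.
by rewrite (killed_0 h) br0r; apply: killed0.
Qed.

Definition subalgebra (m : 'M[F]_n) := forall u v, (u <= m)%MS -> (v <= m)%MS -> (br u v <= m)%MS.

Hypothesis Hlie : is_lie c.

Lemma killed_norm m x i v : (forall u, (u <= m)%MS -> (br u x <= m)%MS) ->
  killed m i v -> killed m i (br x v).
Proof.
move=> xm; elim: i v => [|i IH] v h.
  by rewrite (killed_0 h) br0r; apply: killed0.
case=> // u s /= /andP [um sm] [si]; move: s sm si.
have -> : br u (br x v) = 1 *: br x (br u v) + br (br u x) v.
  by rewrite scale1r (br_jacobi Hlie) addrC subrK.
by apply: killed_linear; [apply: IH; apply: killed_br | apply: killed_br; first exact: xm].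
Qed.

(** The inductive step of Engel's theorem: an element of [D] outside [m] that normalizes [m] can be
    adjoined, and the larger algebra still acts nilpotently. *)
Lemma engel_extend (D m : 'M[F]_n) k :
  subalgebra D -> (forall x, (x <= D)%MS -> ad_nilpotent c x) ->
  subalgebra m -> (forall v, killed m k v) -> (m <= D)%MS -> ~~ (D <= m)%MS ->
  exists m' k', [/\ subalgebra m', (forall v, killed m' k' v), (m' <= D)%MS & (\rank m < \rank m')%N].
Proof.
move=> Ds Dn ms mk mD Dm.
have [x [xD xm xnorm]] : exists x, [/\ (x <= D)%MS, ~~ (x <= m)%MS & forall u, (u <= m)%MS -> (br u x <= m)%MS].
  case/row_subPn: Dm => i0; set y := row i0 D => ym.
  have yD : (y <= D)%MS by apply: row_sub.
  have yk s : all (in_mx m) s -> size s = k -> (acts y s <= m)%MS.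
    by move=> h1 h2; rewrite (mk y) // sub0mx.
  (* While [y] does not normalize [m], replace it by a bracket with a row of [m] that stays outside
     [m]. This stops because all [k]-fold brackets fall into [m]. *)
  elim: k y yD ym yk {mk} => [|k IH] y yD ym yk; first by case/negP: ym; apply: (yk [::]).
  have [h|] := boolP (m *m ad y <= m)%MS.
    exists y; split=> // u um; rewrite (brC Hlie) -scaleN1r scalemx_sub // -mul_ad.
    by apply: submx_trans h; apply: submxMr.
  case/row_subPn => i; rewrite row_mul mul_ad => h.
  apply: (IH (br (row i m) y)).
  - by apply: Ds => //; apply: submx_trans mD; apply: row_sub.
  - by apply: contra h => h; rewrite (brC Hlie) -scaleN1r scalemx_sub.
  - by move=> s sm sk; apply: (yk (row i m :: s)); rewrite /= ?sk // /in_mx row_sub.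
have m'P w : (w <= m + x)%MS -> exists2 u, (u <= m)%MS & exists a, w = u + a *: x.
  case/sub_addsmxP => -[a b] /= ->; exists (a *m m); first exact: submxMl.
  by exists (b 0 0); rewrite [b]mx11_scalar mul_scalar_mx !mxE eqxx mulr1n.
(* A word of length [n] lowers the filtration of [m] by one step, since modulo the lower step it is
   a multiple of (ad x)^n = 0; [k] such words reach zero. *)
exists (m + x)%MS, (n * k)%N; split.
- move=> _ _ /m'P [u um [a ->]] /m'P [v vm [b ->]].
  have sm w : (w <= m)%MS -> (w <= m + x)%MS by move=> h; apply: submx_trans h (addsmxSl _ _).
  rewrite brDl !brDr !brZl !brZr (br_xx Hlie) !scaler0 addr0 !addmx_sub //.
  + by apply/sm/ms.
  + by apply/sm/scalemx_sub/xnorm.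
  + by rewrite (brC Hlie); apply/sm/scalemx_sub; rewrite -scaleN1r; apply/scalemx_sub/xnorm.
- have stab i v w : (w <= m + x)%MS -> killed m i v -> killed m i (br w v).
    case/m'P => u um [a ->] h; rewrite brDl brZl addrC; apply: killed_linear.
      exact: killed_norm.
    exact: killed_stable.
  have stabs i v s : all (in_mx (m + x)%MS) s -> killed m i v -> killed m i (acts v s).
    by elim: s v => //= w s IH v /andP [wm sm] h; apply: IH => //; apply: stab.
  (* Each letter is u + a x with u in [m]; the part in [m] drops into the lower step, and only the
     powers of ad x survive. *)
  have step i v s : all (in_mx (m + x)%MS) s -> killed m i.+1 v ->
      exists a, killed m i (a *: (v *m ad x ^+ size s) + acts v s).
    elim: s v => [|w s IH] v /=; first by exists (-1); rewrite expr0 mulmx1 scaleN1r addNr; apply: killed0.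
    case/andP=> /m'P [u um [a ->]] sm h.
    have h' : killed m i.+1 (br x v) by apply: killed_norm.
    have [b hb] := IH _ sm h'.
    exists (a * b).
    have -> : (a * b) *: (v *m ad x ^+ (size s).+1) + acts (br (u + a *: x) v) s =
        a *: (b *: (br x v *m ad x ^+ size s) + acts (br x v) s) + acts (br u v) s.
      rewrite exprS [v *m (_ * _)]mulmxA mul_ad brDl brZl addrC (addrC (br u v)) acts_linear.
      by rewrite scalerDr scalerA addrC addrA.
    by apply: killed_linear => //; apply: stabs => //; apply: killed_br.
  have xn : ad x ^+ n = 0 by apply/eqP/Dn.
  have main i : forall v s, killed m i v -> all (in_mx (m + x)%MS) s -> size s = (n * i)%N -> acts v s = 0.
    elim: i => [|i IH] v s vk sm; first by rewrite muln0 => /size0nil ->; apply: (vk [::]).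
    rewrite mulnS => ss.
    have [s1 [s2 [es sn]]] : exists s1 s2, s = s1 ++ s2 /\ size s1 = n.
      by exists (take n s), (drop n s); rewrite cat_take_drop size_takel // ss leq_addr.
    move: sm ss; rewrite es all_cat size_cat sn /acts foldl_cat -!/(acts _ _) => /andP [st sd] /addnI ss.
    apply: IH => //.
    by have [a] := step _ _ _ st vk; rewrite sn xn mulmx0 scaler0 add0r.
  by move=> v s; apply: main.
- by rewrite addsmx_sub mD.
- rewrite ltn_neqAle mxrankS ?addsmxSl // andbT; apply: contra xm => h.
  have [_ e] := mxrank_leqif_sup (addsmxSl m x); rewrite e in h.
  exact: submx_trans (addsmxSr _ _) h.
Qed.

Lemma engel (D : 'M[F]_n) :
  subalgebra D -> (forall x, (x <= D)%MS -> ad_nilpotent c x) ->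
  exists k, forall v, killed D k v.
Proof.
move=> Ds Dn.
suff main r : forall m k, subalgebra m -> (forall v, killed m k v) -> (m <= D)%MS ->
    (\rank D - \rank m <= r)%N -> exists k, forall v, killed D k v.
  apply: (main _ (0 : 'M_n) 1%N _ _ _ (leqnn _)); rewrite ?sub0mx //.
    by move=> u v; rewrite submx0 => /eqP -> _; rewrite br0l sub0mx.
  by move=> v [|u [|//]] //=; rewrite /in_mx submx0 andbT => /eqP -> _; rewrite br0l.
elim: r => [|r IH] m k ms mk mD hr.
  exists k => v s sD; apply: mk; apply: sub_all sD => u; rewrite /in_mx => uD.
  apply: submx_trans uD _.
  by have [_ <-] := mxrank_leqif_sup mD; rewrite eqn_leq mxrankS //= -subn_eq0 -leqn0.
have [h|h] := boolP (D <= m)%MS.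
  by exists k => v s sD; apply: mk; apply: sub_all sD => u uD; apply: submx_trans uD h.
have [m' [k' [ms' mk' mD' rr]]] := engel_extend Ds Dn ms mk mD h.
apply: (IH m' k') => //.
by rewrite -ltnS (leq_trans _ hr) // ltn_sub2l // (leq_trans rr) // mxrankS.
Qed.

(** The derived series descends the annihilator filtration: a bracket with an element of [D] lowers
    the index by one, and index 0 leaves only zero. *)
Lemma nilpotent_solvable (D : 'M[F]_n) :
  subalgebra D -> (forall x, (x <= D)%MS -> ad_nilpotent c x) -> solvable_sub c D.
Proof.
move=> Ds Dn; have [k hk] := engel Ds Dn; exists k.
suff main j : (j <= k)%N -> forall v, (v <= iter j (derived c) D)%MS -> (v <= D)%MS /\ killed D (k - j) v.
  apply/eqmx0P/row_matrixP => i; rewrite row0.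
  by have [_] := main k (leqnn _) _ (row_sub i _); rewrite subnn => /killed_0.
elim: j => [|j IH] jk v /=; first by move=> vD; split=> //; rewrite subn0.
move: v; apply: derived_ind; first by split; [rewrite sub0mx | apply: killed0].
  by move=> a u v [u1 u2] [v1 v2]; split; [rewrite addmx_sub // scalemx_sub | apply: killed_linear].
move=> a b; have [a1 _] := IH (ltnW jk) _ (row_sub a _); have [b1 b2] := IH (ltnW jk) _ (row_sub b _).
by split; [apply: Ds | apply: killed_br; rewrite // -subSn].
Qed.

End Engel.

(** * Rational linear functionals on the span of eigenvalues *)

Section RationalFunctional.
Variable (K : fieldType).
Hypothesis char0 : [pchar K] =i pred0.

Lemma natr_neq0 k : (k != 0)%N -> k%:R != 0 :> K.
Proof. by rewrite ((pcharf0P _).1 char0). Qed.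

Lemma intr_neq0 (k : int) : k != 0 -> k%:~R != 0 :> K.
Proof.
case: k => k; first by move=> h; rewrite natr_neq0.
by move=> _; rewrite NegzE mulrNz oppr_eq0 natr_neq0.
Qed.

Lemma ratr_frac (x : rat) (a b : int) : b != 0 -> x * b%:~R = a%:~R -> ratr x = a%:~R / b%:~R :> K.
Proof.
move=> b0 h; have d0 := intr_neq0 (denq_neq0 x); have b0' := intr_neq0 b0.
apply/eqP; rewrite /ratr eqr_div //; apply/eqP.
rewrite -!intrM; congr (_%:~R); apply: (@intr_inj rat).
by rewrite !intrM -h numqE mulrAC.
Qed.

Lemma ratr_zmod_morphism : zmod_morphism (@ratr K).
Proof.
move=> x y; have dx := intr_neq0 (denq_neq0 x); have dy := intr_neq0 (denq_neq0 y).
rewrite (@ratr_frac _ (numq x * denq y - numq y * denq x) (denq x * denq y)).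
- by rewrite /ratr rmorphB /= !intrM -[- (_ / _)]mulNr addf_div // mulNr.
- by rewrite mulf_neq0 ?denq_neq0.
by rewrite rmorphB /= !intrM !numqE mulrBl !mulrA [y * _ * _]mulrAC.
Qed.

Lemma ratr_monoid_morphism : monoid_morphism (@ratr K).
Proof.
split; first by rewrite (@ratr_frac 1 1 1) ?divr1.
move=> x y; have dx := intr_neq0 (denq_neq0 x); have dy := intr_neq0 (denq_neq0 y).
rewrite (@ratr_frac _ (numq x * numq y) (denq x * denq y)).
- by rewrite /ratr !intrM /= mulf_div.
- by rewrite mulf_neq0 ?denq_neq0.
by rewrite !intrM /= !numqE mulrACA.
Qed.

Lemma exists_spanning (F : fieldType) m (P : 'rV[F]_m -> Prop) :
  exists2 s : seq 'rV[F]_m, (forall v, v \in s -> P v) &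
    forall v, P v -> (v <= \sum_(u <- s) <<u>>)%MS.
Proof.
suff main r : forall s : seq 'rV[F]_m, (forall v, v \in s -> P v) ->
    (m - \rank (\sum_(u <- s) <<u>>)%MS <= r)%N ->
    exists2 s : seq 'rV[F]_m, (forall v, v \in s -> P v) &
    forall v, P v -> (v <= \sum_(u <- s) <<u>>)%MS by apply: (main m [::]); rewrite ?leq_subr.
elim: r => [|r IH] s sP hr.
  exists s => // v _; apply: submx_full.
  by rewrite /row_full eqn_leq rank_leq_col -subn_eq0 -leqn0.
case: (excluded_middle_informative (forall v, P v -> (v <= \sum_(u <- s) <<u>>)%MS)) => [|h]; first by exists s.
have [v Pv vs] : exists2 v, P v & ~~ (v <= \sum_(u <- s) <<u>>)%MS.
  apply: NNPP => h'; apply: h => v Pv; apply/negPn/negP => vs; apply: h'.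
  by exists v.
apply: (IH (v :: s)) => [w|]; first by rewrite inE => /orP [/eqP ->|/sP].
rewrite big_cons -ltnS (leq_trans _ hr) //; set U := (\sum_(u <- s) _)%MS in vs *.
have rU : (\rank U < \rank (<<v>> + U)%MS)%N.
  rewrite ltn_neqAle mxrankS ?addsmxSr // andbT; apply: contra vs => h'.
  have [_ e] := mxrank_leqif_sup (addsmxSr <<v>>%MS U); rewrite e in h'.
  by apply: submx_trans h'; apply: submx_trans (addsmxSl _ _); rewrite genmxE.
by rewrite ltn_sub2l // (leq_trans rU) // rank_leq_col.
Qed.

(** The rational relations between the z_i form a proper subspace, because some z_i is nonzero. A
    nonzero vector orthogonal to it is the table of values of a nonzero rational functional on the
    span of the z_i. *)
Lemma rational_functional m (z : 'I_m -> K) : (exists i, z i != 0) ->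
  exists2 phi : 'I_m -> rat, exists i, phi i != 0 &
   forall a : 'I_m -> rat, \sum_i ratr (a i) * z i = 0 -> \sum_i a i * phi i = 0.
Proof.
have r0 : @ratr K 0 = 0 by rewrite (@ratr_frac 0 0 1) ?mul0r.
have radd : {morph @ratr K : x y / x + y}.
  move=> x y; have := ratr_zmod_morphism x (- y); rewrite opprK => ->.
  have := ratr_zmod_morphism 0 y; rewrite sub0r => ->.
  by rewrite r0 sub0r opprK.
have [_ rM] := ratr_monoid_morphism.
pose P (v : 'rV[rat]_m) := \sum_i ratr (v 0 i) * z i = 0.
have [s sP sE] := exists_spanning P; set U := (\sum_(u <- s) <<u>>)%MS in sE.
have UP v : (v <= U)%MS -> P v.
  have PZ a w : P w -> P (a *: w).
    rewrite /P => h; under eq_bigr do rewrite mxE rM -mulrA.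
    by rewrite -mulr_sumr h mulr0.
  have PD w w' : P w -> P w' -> P (w + w').
    rewrite /P => h h'; under eq_bigr do rewrite mxE radd mulrDl.
    by rewrite big_split /= h h' addr0.
  rewrite /U; elim: s v sP {sE U} => [|u s IH] v sP.
    by rewrite big_nil submx0 => /eqP ->; rewrite /P big1 // => i _; rewrite mxE r0 mul0r.
  rewrite big_cons => /sub_addsmxP [[a b] /= ->]; apply: PD.
    have : (a *m <<u>>%MS <= u)%MS by apply: submx_trans (submxMl _ _) _; rewrite genmxE.
    by case/sub_rVP => t ->; apply: PZ; apply: sP; rewrite mem_head.
  by apply: IH (submxMl _ _) => w ws; apply: sP; rewrite in_cons ws orbT.
case=> i0 zi0; have /negP Ufull : ~~ row_full U.
  apply/negP => fU; case/eqP: zi0.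
  have : P (delta_mx 0 i0) by apply/UP/submx_full.
  rewrite /P (bigD1 i0) //= big1 => [|j ji]; rewrite mxE eqxx.
    by rewrite eqxx /= addr0 (_ : ratr 1 = 1) ?mul1r //; case: ratr_monoid_morphism.
  by rewrite (negPf ji) r0 mul0r.
have : kermx U^T != 0.
  rewrite kermx_eq0 /row_free mxrank_tr; apply/negP; exact: Ufull.
case/rowV0Pn => v /sub_kermxP vU v0; exists (fun i => v 0 i).
  apply: NNPP => h; case/eqP: v0; apply/rowP => i; rewrite mxE; apply/eqP/negPn/negP => vi.
  by apply: h; exists i.
move=> a ha; have : ((\row_i a i) <= U)%MS.
  by apply: sE; rewrite /P; under eq_bigr do rewrite mxE.
case/submxP => D hD; have : (\row_i a i) *m v^T = 0.
  by rewrite hD -mulmxA -[U]trmxK -trmx_mul vU trmx0 mulmx0.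
by move/matrixP/(_ 0 0); rewrite [RHS]mxE => h; rewrite -[RHS]h mxE; apply: eq_bigr => i _; rewrite !mxE.
Qed.

End RationalFunctional.

Section Spectrum.
Variable (K : closedFieldType).

(** Eigenvalues with multiplicity, found by splitting off the kernel of one linear factor at a time;
    the trace is additive over the blocks. *)
Lemma mx_spectrum n (N : 'M[K]_n) : exists z : 'I_n -> K,
  mxp N (\prod_i ('X - (z i)%:P)) = 0 /\ forall p, \tr (mxp N p) = \sum_i p.[z i].
Proof.
suff main (l : seq K) : forall n (N : 'M[K]_n), mxp N (\prod_(x <- l) ('X - x%:P)) = 0 ->
    exists rs : seq K, [/\ size rs = n, mxp N (\prod_(x <- rs) ('X - x%:P)) = 0 &
      forall p, \tr (mxp N p) = \sum_(x <- rs) p.[x]].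
  have [l hl] := closed_field_poly_normal (char_poly N).
  have [] := main l n N.
    by rewrite -(scale1r (\prod_(x <- l) _)) -(monicP (char_poly_monic N)) -hl mxp_char.
  move=> rs [rn h1 h2]; have x0 : K := 0.
  have rE (T : Type) (idx : T) op (f : K -> T) :
     \big[op/idx]_(x <- rs) f x = \big[op/idx]_(i < n) f (nth x0 rs i).
    by rewrite (big_nth x0) big_mkord rn.
  exists (fun i => nth x0 rs i); split=> [|p]; first by rewrite -h1 rE.
  by rewrite h2 rE.
elim: l => [|x l IH] {}n {}N.
  rewrite big_nil mxp1 => h; have n0 : n = 0%N.
    by case: n N h => // n N /matrixP /(_ 0 0) /eqP; rewrite !mxE eqxx oner_eq0.
  subst n; exists [::]; split=> // [|p]; first by rewrite big_nil mxp1.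
  by rewrite big_nil [mxp _ _]thinmx0 mxtrace0.
rewrite big_cons => h; have [k [k' [U [V [A [B [H UY Nq Ns]]]]]]] := exists_mxsplit_ker h.
have N1 : U *m N *m A = x%:M.
  by move: Nq; rewrite mxpD mxpX -polyCN mxpC raddfN /= => /eqP; rewrite subr_eq0 => /eqP.
have UN := UY N (erefl _).
have [rs [rn h1 h2]] := IH _ _ Ns.
(* [N] is the scalar [x] on the first block, of size [k], so [x] counts [k] times. *)
exists (nseq k x ++ rs); split.
- rewrite size_cat size_nseq rn; case: (H) => e1 e2 e3 e4 e5; apply/eqP; rewrite eqn_leq; apply/andP; split.
    apply: (@mulmx1_min _ _ _ (col_mx U V) (row_mx A B)).
    by rewrite mul_col_row e1 e2 e3 e4 -scalar_mx_block.
  by apply: (@mulmx1_min _ _ _ (row_mx A B) (col_mx U V)); rewrite mul_row_col.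
- rewrite big_cat /= mulrC mxpM.
  set P1 := \prod_(j <- nseq k x) _; set P2 := \prod_(j <- rs) _ in h1 *.
  have U1 : U *m mxp N P1 = 0.
    case: (H) => e1 e2 e3 e4 e5.
    rewrite -[LHS]mulmx1 -e5 mulmxDr !mulmxA (mxsplit_mxp H UN) mul0mx addr0.
    have [k0|k0] := posnP k; first by apply/matrixP => i; have := ltn_ord i; rewrite {2}k0.
    have -> : P1 = ('X - x%:P) * \prod_(j <- nseq k.-1 x) ('X - j%:P).
      by rewrite /P1 -{1}(prednK k0) big_cons.
    by rewrite -(mxp_split_u H UN) mxpM Nq !mul0mx.
  case: (H) => e1 e2 e3 e4 e5.
  have UP : U *m (mxp N P2 *m mxp N P1) = 0 by rewrite -mxpM mulrC mxpM mulmxA U1 mul0mx.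
  have VP : V *m (mxp N P2 *m mxp N P1) = 0.
    have VP2 : V *m mxp N P2 = V *m mxp N P2 *m A *m U.
      by rewrite -[LHS]mulmx1 -e5 mulmxDr !mulmxA -(mxp_split_d H UN) h1 mul0mx addr0.
    by rewrite mulmxA VP2 -!mulmxA U1 !mulmx0.
  by rewrite -[LHS]mul1mx -e5 mulmxDl -!mulmxA UP VP !mulmx0 addr0.
- move=> p; rewrite (mxsplit_tr H) -(mxp_split_u H UN) -(mxp_split_d H UN) h2 big_cat /=; congr (_ + _).
  rewrite N1 big_nseq iter_addr addr0.
  have -> : mxp (x%:M : 'M_k) p = (p.[x])%:M.
    elim/poly_ind: p => [|p a IHp]; first by rewrite mxp0 horner0 raddf0.
    by rewrite mxpD mxpM mxpX mxpC IHp -scalar_mxM -raddfD /= !hornerE.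
  by rewrite mxtrace_scalar.
Qed.

End Spectrum.

(** * Primary decomposition and polynomial interpolation *)

Section PrimaryDecomposition.
Variable (K : fieldType).

Lemma coprime_XsubC_exp (x y : K) a b : x != y -> coprimep (('X - x%:P) ^+ a) (('X - y%:P) ^+ b).
Proof.
move=> xy; apply/coprimep_expl/coprimep_expr; rewrite coprimep_XsubC root_XsubC.
by rewrite eq_sym.
Qed.

Lemma coprime_prod_XsubC_exp (y : K) (ms : seq K) a b : y \notin ms ->
  coprimep (('X - y%:P) ^+ a) (\prod_(x <- ms) ('X - x%:P) ^+ b).
Proof.
elim: ms => [|x ms IH]; first by rewrite big_nil coprimep1.
rewrite inE negb_or big_cons coprimepMr => /andP [xy /IH ->].
by rewrite coprime_XsubC_exp.
Qed.

Lemma chinese_XsubC (ms : seq K) (f : K -> K) M : uniq ms ->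
  exists s, forall y, y \in ms -> ('X - y%:P) ^+ M %| s - (f y)%:P.
Proof.
elim: ms => [|y ms IH] /=; first by exists 0.
case/andP => yms /IH [s hs].
have /Bezout_eq1_coprimepP [[a b] /= hab] := coprime_prod_XsubC_exp M M yms.
set P := \prod_(x <- ms) _ in hab.
exists (s + ((f y)%:P - s) * (b * P)) => w; rewrite inE => /orP [/eqP ->|wms].
  have -> : s + ((f y)%:P - s) * (b * P) - (f y)%:P = (s - (f y)%:P) * a * ('X - y%:P) ^+ M.
    rewrite -mulrA -[a * _](addrK (b * P)) hab mulrBr mulr1 addrAC -[(f y)%:P - s]opprB mulNr //.
  by rewrite dvdp_mull.
rewrite addrAC; apply: dvdp_add; first exact: hs.
rewrite dvdp_mull // dvdp_mull // /P (big_rem w) //=; exact: dvdp_mulr.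
Qed.

Lemma primary_decomposition n (N : 'M[K]_n) M (ms : seq K) (v : 'rV_n) : uniq ms ->
  v *m mxp N (\prod_(y <- ms) ('X - y%:P) ^+ M) = 0 ->
  exists w : K -> 'rV[K]_n, v = \sum_(y <- ms) w y /\
   forall y, y \in ms -> w y *m mxp N (('X - y%:P) ^+ M) = 0.
Proof.
elim: ms v => [|y ms IH] v /=.
  by rewrite big_nil mxp1 mulmx1 => _ ->; exists (fun _ => 0); rewrite big_nil.
case/andP => yms ums; rewrite big_cons => hv.
have /Bezout_eq1_coprimepP [[a b] /= hab] := coprime_prod_XsubC_exp M M yms.
set P := \prod_(x <- ms) _ in hab hv.
have [|w [vw hw]] := IH (v *m mxp N (a * ('X - y%:P) ^+ M)) ums.
  by rewrite -/P -mulmxA -mxpM -mulrA mulrC mxpM mulmxA hv mul0mx.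
exists (fun x => if x == y then v *m mxp N (b * P) else w x); split.
  rewrite big_cons eqxx.
  have -> : \sum_(j <- ms) (if j == y then v *m mxp N (b * P) else w j) = \sum_(j <- ms) w j.
    rewrite big_seq [RHS]big_seq; apply: eq_bigr => x xms; case: eqP => // xy.
    by case/negP: yms; rewrite -xy.
  by rewrite -vw -mulmxDr -mxpD addrC hab mxp1 mulmx1.
move=> x; rewrite inE; case: eqP => /= [-> _|_ xms]; last exact: hw.
by rewrite -mulmxA -mxpM -mulrA (mulrC P) [b * _]mulrC mxpM mulmxA hv mul0mx.
Qed.

End PrimaryDecomposition.

(** * Nondegeneracy of the Killing form, by means of replicas *)

Section Cartan.
Variables (K : closedFieldType).
Hypothesis char0 : [pchar K] =i pred0.
Variables (n : nat) (c : 'I_n -> 'I_n -> 'rV[K]_n).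
Hypothesis Hlie : is_lie c.
Local Notation br := (br c).
Local Notation ad := (ad c).
Implicit Types (x y u v w : 'rV[K]_n).

(** By the Leibniz rule, ad x - (a + b) acts on a bracket as ad x - a on the left entry plus ad x -
    b on the right one; each application spends one of the i + j exponents. *)
Lemma br_generalized_eigen x (a b : K) i j u v :
  u *m mxp (ad x) (('X - a%:P) ^+ i) = 0 -> v *m mxp (ad x) (('X - b%:P) ^+ j) = 0 ->
  br u v *m mxp (ad x) (('X - (a + b)%:P) ^+ (i + j)) = 0.
Proof.
have E t : mxp (ad x) ('X - t%:P) = ad x - t%:M.
  by rewrite mxpD mxpX -polyCN mxpC raddfN.
move: {2}(i + j)%N (leqnn (i + j)%N) => k; elim: k i j u v => [|k IH] i j u v.
  rewrite leqn0 addn_eq0 => /andP [/eqP -> /eqP ->].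
  by rewrite expr0 mxp1 !mulmx1 => -> _; rewrite br0l ?mul0mx.
case: i => [|i]; first by rewrite expr0 mxp1 mulmx1 => _ -> _; rewrite br0l mul0mx.
case: j => [|j]; first by rewrite expr0 mxp1 mulmx1 => _ _ ->; rewrite br0r mul0mx.
rewrite addSn ltnS => hk hu hv.
have hbr : br u v *m mxp (ad x) ('X - (a + b)%:P) =
    br (u *m mxp (ad x) ('X - a%:P)) v + br u (v *m mxp (ad x) ('X - b%:P)).
  rewrite !E !mulmxBr !mul_mx_scalar (br_ad_derivation Hlie) brDl brDr brNl brNr brZl brZr scalerDl.
  by rewrite opprD addrACA.
rewrite exprS mxpM mulmxA hbr mulmxDl [X in X + _]IH ?add0r.
- by rewrite addnS -addSn IH // -?mulmxA -?mxpM -?exprS // addSn -addnS.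
- by [].
- by rewrite -mulmxA -mxpM -exprS.
- by [].
Qed.

(* The replica of [ad x]: it acts on each generalized eigenspace of [ad x] by the image of
   the eigenvalue under an additive function, hence it is again a derivation. *)
Lemma replica_derivation x (z : 'I_n -> K) (f : K -> K) :
  mxp (ad x) (\prod_i ('X - (z i)%:P)) = 0 ->
  (forall i j k, z i + z j = z k -> f (z i) + f (z j) = f (z k)) ->
  exists s : {poly K}, (forall i, s.[z i] = f (z i)) /\
    forall u v, br u v *m mxp (ad x) s = br (u *m mxp (ad x) s) v + br u (v *m mxp (ad x) s).
Proof.
move=> hz fD; set ms := undup (codom z).
have zms i : z i \in ms by rewrite mem_undup codom_f.
have msz (y : K) : y \in ms -> exists i, y = z i by rewrite mem_undup => /codomP.
have ums : uniq ms by apply: undup_uniq.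
have hms : mxp (ad x) (\prod_(y <- ms) ('X - y%:P) ^+ n) = 0.
  have : \prod_i ('X - (z i)%:P) %| \prod_(y <- ms) ('X - y%:P) ^+ n.
    rewrite prodrXl -[X in _ ^+ X]card_ord -prodr_const.
    apply: (big_ind2 (fun p q => p %| q)) => // [p p' q q'|i _]; first exact: dvdp_mul.
    by rewrite (big_rem (z i)) //= dvdp_mulr.
  by case/dvdpP => q ->; rewrite mxpM hz mulmx0.
(* The exponent is doubled because the bracket of two vectors killed by n-th powers is only known to
   be killed by a power 2n. *)
have [s hs] := chinese_XsubC f (n + n) ums.
have Es t (y : K) k : y \in ms -> (k <= n + n)%N -> t *m mxp (ad x) (('X - y%:P) ^+ k) = 0 ->
    t *m mxp (ad x) s = f y *: t.
  move=> yms hk ht; have /dvdpP [q hq] := hs y yms.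
  rewrite -[s](subrK (f y)%:P) hq mxpD mxpC mulmxDr mul_mx_scalar -(subnKC hk) exprD.
  by rewrite mulrC -mulrA mxpM mulmxA ht mul0mx add0r.
exists s; split=> [i|].
  have n0 : (0 < n)%N by case: (n) i => // -[].
  have /dvdpP [q hq] := hs _ (zms i); rewrite -[s](subrK (f (z i))%:P) hq.
  by rewrite !hornerE subrr expr0n /= addn_eq0 (gtn_eqF n0) mulr0 add0r.
have dec u := primary_decomposition (N := ad x) (v := u) ums (etrans (congr1 (mulmx u) hms) (mulmx0 _ u)).
move=> u v; have [wu [-> hu]] := dec u; have [wv [-> hv]] := dec v.
rewrite !br_suml !mulmx_suml !br_suml -big_split big_seq [RHS]big_seq; apply: eq_bigr => a ams /=.
rewrite !br_sumr !mulmx_suml -big_split big_seq [RHS]big_seq; apply: eq_bigr => b bms /=.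
rewrite (Es _ (wu a) a n ams) ?leq_addr ?hu // (Es _ (wv b) b n bms) ?leq_addr ?hv //.
rewrite brZl brZr -scalerDl.
have ht := br_generalized_eigen (hu a ams) (hv b bms).
have [abms|abms] := boolP (a + b \in ms).
  rewrite (Es _ _ (a + b) (n + n)%N) //; congr (_ *: _).
  have [i ei] := msz _ ams; have [j ej] := msz _ bms; have [k ek] := msz _ abms.
  by rewrite ei ej in ek *; rewrite (fD _ _ _ ek) ek.
(* If a + b is no eigenvalue, the bracket is annihilated by two coprime polynomials, hence zero. *)
have /Bezout_eq1_coprimepP [[p q] /= hpq] := coprime_prod_XsubC_exp (n + n) n abms.
suff -> : br (wu a) (wv b) = 0 by rewrite mul0mx scaler0.
rewrite -[LHS]mulmx1 -(mxp1 (ad x)) -hpq mxpD !mxpM hms mulmx0 addr0.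
by rewrite -mxpM mulrC mxpM mulmxA ht mul0mx.
Qed.

Let R := kermx (gram c).

Lemma killing_radicalP x : (x <= R)%MS -> forall y, killing c x y = 0.
Proof. by move/sub_kermxP/eqP/gram_kerP. Qed.

Lemma killing_radical_ideal : is_ideal c R.
Proof.
move=> x y xR; apply/sub_kermxP/eqP/gram_kerP => z.
by rewrite killing_inv // (killing_radicalP xR).
Qed.

(** If an eigenvalue z_i of ad x were nonzero, a nonzero rational functional phi would give a
    replica S of ad x with eigenvalues phi(z_i). Membership in [R, R] forces tr(S ad x) = sum
    phi(z_i) z_i = 0; applying phi gives sum phi(z_i)^2 = 0 over the rationals, a contradiction. *)
Lemma radical_derived_nilpotent x : (x <= derived c R)%MS -> ad_nilpotent c x.
Proof.
move=> xR'; have [z [hz htr]] := mx_spectrum (ad x).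
have [z0|z0] := boolP [forall i, z i == 0].
  have : mxp (ad x) ('X ^+ n) = 0.
    rewrite -hz; congr mxp; rewrite -[n in LHS]card_ord -prodr_const; apply: eq_bigr => i _.
    by rewrite (eqP (forallP z0 i)) subr0.
  by rewrite /ad_nilpotent mxpXn mxpX => ->.
have zn0 : exists i, z i != 0 by move: z0; rewrite negb_forall => /existsP.
have [phi [i0 phi0] hphi] := rational_functional char0 zn0.
have r0 : @ratr K 0 = 0 by rewrite (ratr_frac char0 (a := 0) (b := 1)) ?mul0r.
have r1 : @ratr K 1 = 1 by rewrite (ratr_frac char0 (a := 1) (b := 1)) ?divr1.
have rB := ratr_zmod_morphism char0; have [_ rM] := ratr_monoid_morphism char0.
have rN a : @ratr K (- a) = - ratr a by have := rB 0 a; rewrite !sub0r r0 sub0r.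
have rD a b : @ratr K (a + b) = ratr a + ratr b by have := rB a (- b); rewrite opprK rN opprK.
have phiD i j k : z i + z j = z k -> phi i + phi j = phi k.
  move=> h; have := hphi (fun t => (t == i)%:R + (t == j)%:R - (t == k)%:R).
  have rd (F : fieldType) (g : 'I_n -> F) t0 : \sum_t (t == t0)%:R * g t = g t0.
    rewrite (bigD1 t0) //= eqxx mul1r big1 ?addr0 // => t /negPf ->; by rewrite mul0r.
  have rb (b : bool) : @ratr K b%:R = b%:R by case: b; rewrite ?r1 ?r0.
  under eq_bigr do rewrite rB rD !rb mulrBl mulrDl.
  under [X in _ -> X = 0]eq_bigr do rewrite mulrBl mulrDl.
  rewrite !big_split /= !sumrN !rd h subrr => /(_ (erefl _)) /eqP.
  by rewrite subr_eq0 => /eqP.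
have phiE i j : z i = z j -> phi i = phi j.
  move=> h; have := hphi (fun t => (t == i)%:R - (t == j)%:R).
  have rd (F : fieldType) (g : 'I_n -> F) t0 : \sum_t (t == t0)%:R * g t = g t0.
    rewrite (bigD1 t0) //= eqxx mul1r big1 ?addr0 // => t /negPf ->; by rewrite mul0r.
  have rb (b : bool) : @ratr K b%:R = b%:R by case: b; rewrite ?r1 ?r0.
  under eq_bigr do rewrite rB !rb mulrBl.
  under [X in _ -> X = 0]eq_bigr do rewrite mulrBl.
  rewrite !big_split /= !sumrN !rd h subrr => /(_ (erefl _)) /eqP.
  by rewrite subr_eq0 => /eqP.
pose f (y : K) : K := if [pick i | z i == y] is Some i then ratr (phi i) else 0.
have fE i : f (z i) = ratr (phi i).
  rewrite /f; case: pickP => [j /eqP /phiE -> //|/(_ i)]; by rewrite eqxx.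
have fD i j k : z i + z j = z k -> f (z i) + f (z j) = f (z k).
  by move=> h; rewrite !fE -(phiD _ _ _ h) rD.
have [s [sz sder]] := replica_derivation hz fD.
have Rs (a : 'rV_n) : (a <= R)%MS -> (a *m mxp (ad x) s <= R)%MS.
  move=> aR; rewrite mulmx_sumr summx_sub // => i _; rewrite -scalemxAr scalemx_sub //.
  elim: (nat_of_ord i) => [|k IH]; first by rewrite expr0 mulmx1.
  rewrite exprSr -mulmxE mulmxA. rewrite mul_ad (brC Hlie) -scaleN1r scalemx_sub //.
  exact: killing_radical_ideal.
(* As S is a derivation, tr(S ad [u, v]) is, up to sign, a value of the Killing form with [u] as an
   argument, and [u] is in the radical. *)
have tr0 : \tr (mxp (ad x) s *m ad x) = 0.
  apply: (derived_ind (P := fun v => \tr (mxp (ad x) s *m ad v) = 0)) xR'.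
  - by rewrite ad0 mulmx0 mxtrace0.
  - by move=> a u v hu hv; rewrite adD adZ mulmxDr -scalemxAr mxtraceD mxtraceZ hu hv mulr0 addr0.
  move=> i j; set u := row i R; set v := row j R; set S := mxp _ s.
  have Sv : ad v *m S = ad (v *m S) + S *m ad v.
    by apply/row_matrixP=> k; rewrite linearD /= !row_mul !row_ad !mul_ad sder -rowE.
  rewrite ad_br // mulmxBr raddfB /= mulmxA [\tr (S *m (_ *m _))]mxtrace_mulC -(mulmxA (ad u)) Sv.
  rewrite mulmxDr mxtraceD [\tr (ad u *m (S *m _))]mxtrace_mulC opprD addrCA subrr addr0.
  have := killing_radicalP (row_sub i R) (v *m S); rewrite /killing => ->; by rewrite oppr0.
move: tr0; rewrite -{2}(mxpX (ad x)) -mxpM htr.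
under eq_bigr do rewrite hornerM hornerX sz fE.
move/hphi => /eqP; rewrite psumr_eq0; last by move=> i _; rewrite -expr2 sqr_ge0.
by move/allP/(_ i0 (mem_index_enum _)); rewrite mulf_eq0 orbb (negPf phi0).
Qed.

(** The radical of the Killing form is an ideal whose derived algebra consists of ad-nilpotent
    elements. Engel makes it solvable, so semisimplicity makes it zero. *)
Theorem cartan_criterion : semisimple c -> gram c \in unitmx.
Proof.
move=> Hss; rewrite -row_free_unit -kermx_eq0 -/R; apply/eqP/eqmx0P/Hss.
  exact: killing_radical_ideal.
have R'R v : (v <= derived c R)%MS -> (v <= R)%MS.
  move: v; apply: derived_ind; rewrite ?sub0mx //.
    by move=> a u v uR vR; rewrite addmx_sub // scalemx_sub.
  by move=> i j; apply/killing_radical_ideal/row_sub.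
have [||k hk] := @nilpotent_solvable _ _ _ Hlie (derived c R).
- by move=> u v /R'R uR /R'R vR; apply: br_in_derived.
- exact: radical_derived_nilpotent.
by exists k.+1; rewrite iterSr.
Qed.

End Cartan.

Lemma mpoly_alg_ind (n : nat) (R : nzRingType) (P : {mpoly R[n]} -> Prop) :
  (forall a, P a%:MP) -> (forall i, P 'X_i) ->
  (forall p q, P p -> P q -> P (p + q)) -> (forall p q, P p -> P q -> P (p * q)) ->
  forall p, P p.
Proof.
move=> PC PX PD PM; apply: mpolyind => [|a m p _ _ Pp]; first by rewrite -mpolyC0.
apply: PD => //; rewrite -mul_mpolyC; apply: (PM) => //.
rewrite mpolyXE_id; elim/big_ind: _ => [||i _]; [by rewrite -mpolyC1|exact: PM|].
elim: (m i) => [|k IH]; first by rewrite expr0 -mpolyC1.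
by rewrite exprS; apply: PM.
Qed.

(** * Derivations of polynomial rings *)

Section ChainRule.
Variables (n : nat) (R : comNzRingType) (S : comPzRingType).
Variable (phi : {rmorphism {mpoly R[n]} -> S}).

(** A tangent vector at the [S]-valued point [phi] of affine space. *)
Definition rel_derivation (d : {mpoly R[n]} -> S) :=
  [/\ forall p q, d (p + q) = d p + d q,
      forall p q, d (p * q) = d p * phi q + phi p * d q &
      forall a, d a%:MP = 0].

Lemma rel_derivation_pd (v : 'I_n -> S) :
  rel_derivation (fun p => \sum_i phi p^`M(i) * v i).
Proof.
split=> [p q|p q|a].
- by rewrite -big_split; apply: eq_bigr => i _ /=; rewrite mderivD rmorphD mulrDl.
- rewrite mulr_suml mulr_sumr -big_split; apply: eq_bigr => i _ /=.
  rewrite mderivM rmorphD !rmorphM mulrDl; ring.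
by rewrite big1 // => i _; rewrite mderivC rmorph0 mul0r.
Qed.

(** A tangent vector is determined by its values on the coordinates; the chain rules below are
    instances of this. *)
Lemma rel_derivationE d : rel_derivation d ->
  forall p, d p = \sum_i phi p^`M(i) * d 'X_i.
Proof.
case=> dD dM dC.
have [eD eM eC] := rel_derivation_pd (fun i => d 'X_i).
apply: mpoly_alg_ind => [a|j|p q hp hq|p q hp hq].
- by rewrite dC eC.
- have jj : (U_(j) - U_(j))%MM = 0%MM :> 'X_{1..n} by apply/mnmP=> i; rewrite mnmBE subnn mnm0E.
  rewrite (bigD1 j) //= mderivX mnm1E eqxx scale1r jj mpolyX0 rmorph1 mul1r.
  rewrite big1 ?addr0 // => i ij; rewrite mderivX mnm1E eq_sym (negPf ij) scale0r.
  by rewrite rmorph0 mul0r.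
- by rewrite dD eD hp hq.
- by rewrite dM eM hp hq.
Qed.

End ChainRule.

Section ExtendDerivation.
Variables (R : comNzRingType) (L : fieldType) (phi : {rmorphism R -> L}) (d : R -> L).
Hypothesis dD : forall p q, d (p + q) = d p + d q.
Hypothesis dM : forall p q, d (p * q) = d p * phi q + phi p * d q.
Hypothesis frac : forall x : L, exists a b, phi b != 0 /\ x = phi a / phi b.
Hypothesis ker : forall a, phi a = 0 -> d a = 0.

(** The quotient rule, well defined on fractions because [d] vanishes on the kernel of [phi]: the
    tangent vector is tangent to the closure of the point. *)
Lemma extend_derivation : exists delta : L -> L,
  derivation delta /\ forall a, delta (phi a) = d a.
Proof.
have dN a : d (- a) = - d a.
  apply/eqP; rewrite -addr_eq0 -dD addrC subrr; apply/eqP.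
  by apply: ker; rewrite rmorph0.
pose val a b := (d a * phi b - phi a * d b) / (phi b ^+ 2).
have wd a b a' b' : phi b != 0 -> phi b' != 0 -> phi a / phi b = phi a' / phi b' -> val a b = val a' b'.
  move=> b0 b'0 /eqP; rewrite eqr_div // => /eqP h.
  have := ker (a := a * b' - a' * b).
  rewrite rmorphB !rmorphM /= h subrr => /(_ (erefl _)).
  rewrite dD dN !dM => h2.
  have ea : d a = (d a' * phi b + phi a' * d b - phi a * d b') / phi b'.
    apply: (mulIf b'0); rewrite divfK //; apply/eqP; rewrite -subr_eq0; apply/eqP.
    by rewrite -[RHS]h2; ring.
  have ea' : phi a = phi a' * phi b / phi b' by rewrite -h mulfK.
  rewrite /val ea ea'; field; by rewrite b0 b'0.
have ex (x : L) : exists ab : R * R, phi ab.2 != 0 /\ x = phi ab.1 / phi ab.2.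
  by have [a [b h]] := frac x; exists (a, b).
have [nd hnd] := choice _ ex.
exists (fun x => val (nd x).1 (nd x).2).
have E a b : phi b != 0 -> val (nd (phi a / phi b)).1 (nd (phi a / phi b)).2 = val a b.
  by move=> b0; have [h1 h2] := hnd (phi a / phi b); apply: wd.
have d1 : d 1 = 0.
  by apply: (addIr (d 1)); rewrite add0r -{3}(mulr1 1) dM rmorph1 mulr1 mul1r.
split; last first.
  move=> a; have -> : phi a = phi a / phi 1 by rewrite rmorph1 divr1.
  by rewrite E ?rmorph1 ?oner_eq0 // /val rmorph1 d1 mulr0 subr0 mulr1 expr1n divr1.
split=> x y; have [x0 ex1] := hnd x; have [y0 ey1] := hnd y.
  have -> : x + y = phi ((nd x).1 * (nd y).2 + (nd y).1 * (nd x).2) / phi ((nd x).2 * (nd y).2).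
    by rewrite rmorphD !rmorphM /= {1}ex1 {1}ey1; field; rewrite x0 y0.
  rewrite E ?rmorphM ?mulf_neq0 // /val dD !dM rmorphD !rmorphM /=.
  move: (nd x) (nd y) x0 y0 {ex1 ey1} => [a b] [a' b'] /=.
  move: (d a) (d b) (d a') (d b') (phi a) (phi b) (phi a') (phi b') => {a b a' b'} *.
  by field; apply/andP.
have -> : x * y = phi ((nd x).1 * (nd y).1) / phi ((nd x).2 * (nd y).2).
  by rewrite !rmorphM /= {1}ex1 {1}ey1; field; rewrite x0 y0.
rewrite E ?rmorphM ?mulf_neq0 // /val !dM !rmorphM /=.
move: (nd x) (nd y) x0 y0 ex1 ey1 => [a b] [a' b'] /= h h' -> ->; move: h h'.
move: (d a) (d b) (d a') (d b') (phi a) (phi b) (phi a') (phi b') => {a b a' b'} *.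
by field; apply/andP.
Qed.

End ExtendDerivation.

(** * Unique factorization in multivariate polynomial rings *)

Section Divisibility.
Variable R : idomainType.
Implicit Types (a b p : R) (s : seq R).

Definition rdvd a b := exists c, b = a * c.

Definition rprime p := [/\ p != 0, p \isn't a GRing.unit &
  forall a b, rdvd p (a * b) -> rdvd p a \/ rdvd p b].

Definition factorizes c :=
  exists u s, [/\ u \is a GRing.unit, forall p, p \in s -> rprime p & c = u * \prod_(p <- s) p].

(** The factors are primes rather than irreducibles, so uniqueness is automatic. *)
Definition factorial_ring := forall c, c != 0 -> factorizes c.

Lemma rdvd_mulr a b c : rdvd a b -> rdvd a (b * c).
Proof. by case=> d ->; exists (d * c); rewrite mulrA. Qed.

Lemma rdvd_mull a b c : rdvd a b -> rdvd a (c * b).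
Proof. by rewrite mulrC; apply: rdvd_mulr. Qed.

Lemma rdvdD a b c : rdvd a b -> rdvd a c -> rdvd a (b + c).
Proof. by case=> x -> [y ->]; exists (x + y); rewrite mulrDr. Qed.

Lemma rdvd_refl a : rdvd a a.
Proof. by exists 1; rewrite mulr1. Qed.

Lemma rprime_dvd_prod p s : rprime p -> rdvd p (\prod_(x <- s) x) -> exists2 x, x \in s & rdvd p x.
Proof.
case=> p0 pu pp; elim: s => [|x s IH].
  by rewrite big_nil => -[c /esym pc]; case/negP: pu; apply/unitrPr; exists c.
rewrite big_cons => /pp [|/IH [y ys py]]; first by exists x; rewrite ?mem_head.
by exists y; rewrite ?inE ?ys ?orbT.
Qed.

Lemma rprime_unit p u : rprime p -> u \is a GRing.unit -> ~ rdvd p u.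
Proof.
case=> _ pu _ uu [c e]; case/negP: pu; apply/unitrPr; exists (c / u).
by rewrite mulrA -e divrr.
Qed.

Lemma rprime_dvdM p a b : rprime p -> rdvd p (a * b) -> rdvd p a \/ rdvd p b.
Proof. by case=> _ _; apply. Qed.

End Divisibility.

(** * Gauss's lemma and factoriality of [{poly R}] *)

Section GaussLemma.
Variable R : idomainType.
Hypothesis HR : factorial_ring R.
Implicit Types (f g h : {poly R}) (a b c p : R).

Lemma rdvd_polyC p f : rdvd p%:P f -> forall i, rdvd p f`_i.
Proof. by case=> g -> i; exists g`_i; rewrite coefCM. Qed.

Lemma rprime_polyC p : rprime p -> rprime (p%:P).
Proof.
move=> pp; case: (pp) => p0 pu _; split; first by rewrite polyC_eq0.
  apply: contra pu; rewrite poly_unitE coefC eqxx /=; by case/andP.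
move=> f g; move: {2}(size f + size g)%N (leqnn (size f + size g)%N) => m.
elim: m f g => [|m IH] f g hm hd.
  move: hm; rewrite leqn0 addn_eq0 size_poly_eq0 => /andP [/eqP -> _]; left.
  by exists 0; rewrite mulr0.
have [->|f0] := eqVneq f 0; first by left; exists 0; rewrite mulr0.
have [->|g0] := eqVneq g 0; first by right; exists 0; rewrite mulr0.
have trunc h : h != 0 -> rdvd p (lead_coef h) ->
   exists2 h' : {poly R}, (size h' < size h)%N & exists k, h = h' + p%:P * k.
  move=> h0 [t ht]; have sh : (0 < size h)%N by rewrite size_poly_gt0.
  exists (h - lead_coef h *: 'X^((size h).-1)); last first.
    by exists (t *: 'X^((size h).-1)); rewrite ht -!mul_polyC polyCM -mulrA subrK.
  rewrite -[X in (_ < X)%N]prednK // ltnS; apply/leq_sizeP => j.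
  rewrite coefB coefZ coefXn leq_eqVlt => /orP [/eqP <-|hj].
    by rewrite eqxx mulr1 lead_coefE subrr.
  by rewrite (gtn_eqF hj) mulr0 subr0 nth_default // -(prednK sh).
have : rdvd p (lead_coef f * lead_coef g).
  by rewrite -lead_coefM lead_coefE; apply: rdvd_polyC.
case/(rprime_dvdM pp) => [/(trunc _ f0)|/(trunc _ g0)] [h' sh [k ek]].
  have [||[q hq]|] := IH h' g.
  - by rewrite -ltnS (leq_trans _ hm) // ltn_add2r.
  - case: hd => q hq; exists (q - k * g); rewrite mulrBr mulrA -hq ek; ring.
  - by left; exists (q + k); rewrite ek hq mulrDr.
  - by right.
have [||[q hq]|[q hq]] := IH f h'.
- by rewrite -ltnS (leq_trans _ hm) // ltn_add2l.
- case: hd => q hq; exists (q - k * f); rewrite mulrBr mulrA -hq ek; ring.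
- by left; exists q.
- by right; exists (q + k); rewrite ek hq mulrDr.
Qed.

Definition primitive_poly f := forall p, rprime p -> ~ rdvd p%:P f.

(** The prime factors of [c] are cancelled one by one: each stays prime in [{poly R}] and cannot
    divide the primitive [f], so it divides the cofactor. *)
Lemma strip_constant f g c : primitive_poly f -> c != 0 -> rdvd f (c%:P * g) -> rdvd f g.
Proof.
move=> fp /HR [u [s [uu ps ->]]]; elim: s ps g => [|p s IH] ps g.
  rewrite big_nil mulr1 => -[k hk]; exists ((u^-1)%:P * k).
  by rewrite mulrCA -hk mulrA -polyCM mulVr // mul1r.
rewrite big_cons => -[k hk].
have pp : rprime p by apply: ps; rewrite mem_head.
have pp' := rprime_polyC pp; case: (pp') => p0 _ _.
have : rdvd p%:P (f * k).
  by rewrite -hk mulrCA !polyCM -!mulrA; exists ((u%:P * (\prod_(j <- s) j)%:P) * g); rewrite -!mulrA.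
case/(rprime_dvdM pp') => [/(fp _ pp) //|[k' ek]].
apply: IH => [q qs|]; first by apply: ps; rewrite inE qs orbT.
exists k'; apply: (mulfI p0); by rewrite [RHS]mulrCA -ek -hk !polyCM; ring.
Qed.

Lemma split_constant f q d c : c != 0 -> c%:P * f = q * d ->
  exists q' d' a b, [/\ q = a%:P * q', d = b%:P * d' & f = q' * d'].
Proof.
move=> /HR [u [s [uu ps ->]]]; elim: s ps q d => [|p s IH] ps q d.
  rewrite big_nil mulr1 => hk; exists ((u^-1)%:P * q), d, u, 1; split.
  - by rewrite mulrA -polyCM mulrV // mul1r.
  - by rewrite mul1r.
  - by rewrite -mulrA -hk mulrA -polyCM mulVr // mul1r.
rewrite big_cons => hk.
have pp : rprime p by apply: ps; rewrite mem_head.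
have ps' q0 : q0 \in s -> rprime q0 by move=> qs; apply: ps; rewrite inE qs orbT.
have pp' := rprime_polyC pp; case: (pp') => p0 _ _.
have hk' : p%:P * ((u * \prod_(x <- s) x)%:P * f) = q * d by rewrite -hk !polyCM; ring.
have : rdvd p%:P (q * d) by exists ((u * \prod_(x <- s) x)%:P * f).
case/(rprime_dvdM pp') => [[q1 eq]|[d1 ed]].
  have [|q' [d' [a [b [h1 h2 h3]]]]] := IH ps' q1 d.
    by apply: (mulfI p0); rewrite hk' eq mulrA.
  by exists q', d', (p * a), b; split; rewrite // eq h1 polyCM mulrA.
have [|q' [d' [a [b [h1 h2 h3]]]]] := IH ps' q d1.
  by apply: (mulfI p0); rewrite hk' ed mulrCA.
by exists q', d', a, (p * b); split; rewrite // ed h2 polyCM mulrA.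
Qed.

(** An element [d] of least size in the ideal (f, g) plays the role of the gcd over the fraction
    field. Pseudo-division makes it divide f and g up to constants, and irreducibility leaves two
    cases: [d] is proportional to f, which then divides g, or [d] is constant, and f divides a
    constant times h. *)
Lemma irreducible_rprime f : (1 < size f)%N -> primitive_poly f ->
  (forall a b : {poly R}, f = a * b -> (size a <= 1)%N \/ (size b <= 1)%N) -> rprime f.
Proof.
move=> f1 fp firr; have f0 : f != 0 by rewrite -size_poly_gt0 ltnW.
split=> //; first by rewrite poly_unitE (gtn_eqF f1).
move=> g h fgh.
pose I w := exists u v, w = u * f + v * g.
have If : I f by exists 1, 0; rewrite mul1r mul0r addr0.
have Ig : I g by exists 0, 1; rewrite mul1r mul0r add0r.
have [d [dI d0 dmin]] : exists d, [/\ I d, d != 0 & forall w, I w -> w != 0 -> (size d <= size w)%N].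
  apply: NNPP => hno.
  suff main m : forall w, I w -> w != 0 -> (size w <= m)%N -> False by apply: (main _ f If f0 (leqnn _)).
  elim: m => [|m IH] w wI w0 wm; first by move: w0; rewrite -size_poly_gt0 ltnNge wm.
  apply: hno; exists w; split=> // w' w'I w'0; rewrite leqNgt; apply/negP => hw.
  by apply: (IH w' w'I w'0); rewrite -ltnS (leq_trans hw).
have red w : I w -> exists c q, c != 0 /\ c%:P * w = q * d.
  move=> wI; exists (lead_coef d ^+ scalp w d), (w %/ d); split.
    by rewrite expf_neq0 // lead_coef_eq0.
  have := Pdiv.Idomain.divp_eq w d; rewrite -mul_polyC => e; rewrite e.
  have [->|r0] := eqVneq (w %% d) 0; first by rewrite addr0.
  have rI : I (w %% d).
    case: wI dI => u [v ew] [u' [v' ed]].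
    exists ((lead_coef d ^+ scalp w d)%:P * u - w %/ d * u'), ((lead_coef d ^+ scalp w d)%:P * v - w %/ d * v').
    have -> : w %% d = (lead_coef d ^+ scalp w d)%:P * w - w %/ d * d by rewrite e addrC addKr.
    by move: (w %/ d) ((lead_coef d ^+ scalp w d)%:P) => Q lc; rewrite ew ed; ring.
  by have := dmin _ rI r0; rewrite leqNgt ltn_modp d0.
have [c [q [c0 cf]]] := red f If.
have [q' [d' [a [b [h1 h2 h3]]]]] := split_constant c0 cf.
have b0 : b != 0 by apply: contraNneq d0 => b0; rewrite h2 b0 mul0r.
case: (firr _ _ h3) => [/size1_polyC eq'|/size1_polyC ed'].
  left; have [c' [q2 [c'0 cg]]] := red g Ig.
  set t := q'`_0 in eq'; have t0 : t != 0 by apply: contraNneq f0 => t0; rewrite h3 eq' t0 mul0r.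
  apply: (strip_constant fp (mulf_neq0 t0 c'0)).
  by exists (q2 * b%:P); rewrite polyCM -mulrA cg h2 h3 eq'; ring.
right; case: dI => u [v ed].
apply: (strip_constant (c := b * d'`_0) fp).
  by rewrite mulf_neq0 //; apply: contraNneq d0 => t0; rewrite h2 ed' t0 mulr0.
rewrite polyCM -ed' -h2 ed mulrDl; apply: rdvdD.
  by exists (u * h); ring.
by rewrite -mulrA; apply: rdvd_mull.
Qed.

(** A prime dividing [f] divides its leading coefficient, so the number of prime factors of that
    coefficient bounds the number of divisions. *)
Lemma remove_content f : f != 0 -> exists c f', [/\ c != 0, f = c%:P * f' & primitive_poly f'].
Proof.
move=> f0; have lf : lead_coef f != 0 by rewrite lead_coef_eq0.
have [u [s [uu ps es]]] := HR lf.
elim: {s}(size s) {-2}s (erefl (size s)) u uu ps f f0 es lf => [|m IH] s sm u uu ps f f0 es lf.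
  exists 1, f; split; rewrite ?oner_eq0 ?mul1r // => p pp /rdvd_polyC /(_ (size f).-1).
  rewrite -lead_coefE es (size0nil sm) big_nil mulr1; exact: rprime_unit.
case: (excluded_middle_informative (primitive_poly f)) => fp.
  by exists 1, f; rewrite oner_eq0 mul1r.
have [p [pp [g fg]]] : exists p, rprime p /\ rdvd p%:P f.
  apply: NNPP => h; apply: fp => p pp pf; apply: h; by exists p.
have p0 : p != 0 by case: pp.
have g0 : g != 0 by apply: contraNneq f0 => g0; rewrite fg g0 mulr0.
have elf : lead_coef f = p * lead_coef g by rewrite fg lead_coefM lead_coefC.
have : rdvd p (\prod_(x <- s) x).
  have : rdvd p (u * \prod_(x <- s) x) by rewrite -es elf; exists (lead_coef g).
  by case/(rprime_dvdM pp) => // /(rprime_unit pp uu).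
case/(rprime_dvd_prod pp) => x xs [t ext].
have [x0 xu xp] := ps x xs.
have tu : t \is a GRing.unit.
  have : rdvd x (p * t) by rewrite -ext; apply: rdvd_refl.
  case/xp => [[y ey]|[y ey]].
    apply/unitrPr; exists y; apply: (mulfI x0); rewrite mulr1 {2}ext ey; ring.
  case/negP: (xu); case: pp => _ pu _; case/negP: pu; apply/unitrPr; exists y.
  by apply: (mulfI x0); rewrite mulr1 [in RHS]ext ey; ring.
have := IH (rem x s) _ (u * t) _ _ g g0.
rewrite size_rem // sm unitrM uu tu => /(_ (erefl _) isT).
case=> [q /mem_rem /ps //||| c [f' [c0 ef fp']]].
- apply: (mulfI p0); rewrite -elf es (big_rem x) //= ext; ring.
- by rewrite lead_coef_eq0.
by exists (p * c), f'; split; rewrite ?mulf_neq0 // fg ef polyCM mulrA.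
Qed.

Theorem factorial_poly : factorial_ring {poly R}.
Proof.
move=> f; move: {2}(size f) (leqnn (size f)) => m; elim: m f => [|m IH] f fm f0.
  by move: f0; rewrite -size_poly_leq0 fm.
have constF c : c != 0 -> factorizes c%:P.
  move=> /HR [u [s [uu ps ->]]]; exists u%:P, (map polyC s); split.
  - by rewrite poly_unitE size_polyC coefC eqxx /= uu andbT; have [u0|//] := eqVneq u 0; move: uu; rewrite u0 unitr0.
  - by move=> _ /mapP [p pins ->]; apply/rprime_polyC/ps.
  - by rewrite polyCM big_map rmorph_prod.
have mulF (a b c : {poly R}) : c = a * b -> factorizes a -> factorizes b -> factorizes c.
  move=> -> [u [s [uu ps ->]]] [u' [s' [uu' ps' ->]]].
  exists (u * u'), (s ++ s'); split; first by rewrite unitrM uu.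
    by move=> p; rewrite mem_cat => /orP [/ps|/ps'].
  by rewrite big_cat /= mulrACA.
have [s1|s1] := leqP (size f) 1.
  rewrite (size1_polyC s1); apply: constF; apply: contraNneq f0 => h.
  by rewrite (size1_polyC s1) h.
case: (excluded_middle_informative (forall a b : {poly R}, f = a * b -> (size a <= 1)%N \/ (size b <= 1)%N)) => irr.
  have [c [f' [c0 ef fp]]] := remove_content f0.
  apply: (mulF _ _ _ ef); first exact: constF.
  have sf : size f = size f' by rewrite ef size_Cmul.
  exists 1, [:: f']; split; rewrite ?unitr1 ?big_seq1 ?mul1r // => p; rewrite inE => /eqP ->.
  apply: irreducible_rprime; rewrite -?sf // => a b eab.
  have [] := irr (c%:P * a) b; rewrite ?ef ?eab ?mulrA //; first by rewrite size_Cmul //; left.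
  by right.
have [a [b [eab sa sb]]] : exists a b : {poly R}, [/\ f = a * b, (1 < size a)%N & (1 < size b)%N].
  apply: NNPP => h; apply: irr => a b eab; case: (leqP (size a) 1) => sa; first by left.
  by case: (leqP (size b) 1) => sb; [right|case: h; exists a, b].
have a0 : a != 0 by rewrite -size_poly_gt0 ltnW.
have b0 : b != 0 by rewrite -size_poly_gt0 ltnW.
have sz : (size a + size b).-1 = size f by rewrite eab size_mul.
by apply: (mulF _ _ _ eab); apply: IH => //; rewrite -ltnS (leq_trans _ fm) // -sz;
   [rewrite -[X in (X < _)%N]addn0 -subn1 -addnBA ?ltn_add2l ?subn_gt0 // ltnW|
    rewrite -[X in (X < _)%N]add0n -subn1 -addnBAC ?ltn_add2r ?subn_gt0 // ltnW].
Qed.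

End GaussLemma.

(** * Multivariate polynomials, one variable at a time *)

Section FactorialMpoly.
Variable K : fieldType.

Local Notation widen := (widen_ord (leqnSn _)).

Lemma rdvd_rmorph (R S : idomainType) (f : {rmorphism R -> S}) a b : rdvd a b -> rdvd (f a) (f b).
Proof. by case=> c ->; exists (f c); rewrite rmorphM. Qed.

Lemma factorial_iso (R S : idomainType) (f : {rmorphism R -> S}) (g : {rmorphism S -> R}) :
  cancel f g -> cancel g f -> factorial_ring R -> factorial_ring S.
Proof.
move=> fg gf HR x x0.
have prf p : rprime p -> rprime (f p).
  case=> p0 pu pp; split.
  - by apply: contraNneq p0 => h; rewrite -(fg p) h rmorph0.
  - by apply: contra pu => h; rewrite -(fg p) rmorph_unit.
  move=> a b; rewrite -{1}(gf a) -{1}(gf b) -rmorphM => /(rdvd_rmorph g).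
  rewrite !fg => /pp [] /(rdvd_rmorph f); rewrite gf; by [left|right].
have gx0 : g x != 0 by apply: contraNneq x0 => h; rewrite -(gf x) h rmorph0.
have [u [s [uu ps eg]]] := HR _ gx0.
exists (f u), (map f s); split; first by rewrite rmorph_unit.
  by move=> _ /mapP [p pins ->]; apply/prf/ps.
by rewrite -(gf x) eg rmorphM rmorph_prod big_map.
Qed.

Definition munmulti (n : nat) : {poly {mpoly K[n]}} -> {mpoly K[n.+1]} :=
  horner_eval 'X_ord_max \o map_poly (@mwiden n K).
HB.instance Definition _ n := GRing.RMorphism.on (@munmulti n).

Lemma munmulti_C n (p : {mpoly K[n]}) : munmulti p%:P = mwiden p.
Proof. by rewrite /munmulti /= map_polyC /= /horner_eval hornerC. Qed.

Lemma munmulti_X n : munmulti ('X : {poly {mpoly K[n]}}) = 'X_ord_max.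
Proof. by rewrite /munmulti /= map_polyX /horner_eval hornerX. Qed.

Lemma muni_max n : muni ('X_ord_max : {mpoly K[n.+1]}) = 'X.
Proof.
rewrite /muni mmapX mmap1U; case: splitP => // -[j lt_jn] /= e.
by exfalso; move: lt_jn; rewrite -e ltnn.
Qed.

Lemma muni_widen n (i : 'I_n) : muni ('X_(widen i) : {mpoly K[n.+1]}) = ('X_i)%:P.
Proof.
rewrite /muni mmapX mmap1U; case: splitP => [j /= e|j /= e].
  by congr ('X__)%:P; apply/val_inj.
by have := ltn_ord i; rewrite e ord1 addn0 ltnn.
Qed.

Lemma muni_mwiden n (p : {mpoly K[n]}) : muni (mwiden p) = p%:P.
Proof.
elim/mpoly_alg_ind: p => [a|i|p q hp hq|p q hp hq].
- by rewrite mwidenC muniC.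
- by rewrite mwidenX mnmwiden1 muni_widen.
- by rewrite mwidenD muniD hp hq polyCD.
- by rewrite rmorphM muniM hp hq polyCM.
Qed.

Lemma muniK n : cancel (@munmulti n) (@muni n K).
Proof.
elim/poly_ind => [|p a IH]; first by rewrite !raddf0.
by rewrite rmorphD rmorphM /= munmulti_X munmulti_C muniD muniM IH muni_max muni_mwiden.
Qed.

Lemma munmultiK n : cancel (@muni n K) (@munmulti n).
Proof.
elim/mpoly_alg_ind => [a|i|p q hp hq|p q hp hq].
- by rewrite muniC munmulti_C mwidenC.
- have [ei|[j ->]] : i = ord_max \/ exists j, i = widen j.
    have [h|h] := ltnP i n; last by left; apply/val_inj/eqP; rewrite eqn_leq h -ltnS ltn_ord.
    by right; exists (Ordinal h); apply/val_inj.
  + by rewrite ei muni_max munmulti_X.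
  + by rewrite muni_widen munmulti_C mwidenX mnmwiden1.
- rewrite muniD -[in RHS]hp -[in RHS]hq; exact: rmorphD.
- rewrite muniM -[in RHS]hp -[in RHS]hq; exact: rmorphM.
Qed.

Theorem factorial_mpoly n : factorial_ring {mpoly K[n]}.
Proof.
elim: n => [|n IH]; last exact: factorial_iso (@muniK n) (@munmultiK n) (factorial_poly IH).
move=> p p0; exists p, [::]; split=> //; last by rewrite big_nil mulr1.
have a0 : p@_0%MM != 0 by apply: contraNneq p0 => h; rewrite (nvar0_mpolyC p) h mpolyC0.
by rewrite (nvar0_mpolyC p); apply/unitrPr; exists ((p@_0%MM)^-1)%:MP; rewrite -mpolyCM divff.
Qed.

Lemma msize_rprime n (P : {mpoly K[n]}) : rprime P -> (1 < msize P)%N.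
Proof.
case=> P0 Pu _; rewrite ltnNge; apply: contra Pu => /msize1_polyC e.
have a0 : P@_0%MM != 0 by apply: contraNneq P0 => h; rewrite e h mpolyC0.
by rewrite e; apply/unitrPr; exists ((P@_0%MM)^-1)%:MP; rewrite -mpolyCM divff.
Qed.

Lemma rprime_power n (P u : {mpoly K[n]}) : rprime P -> u != 0 ->
  exists k w, u = P ^+ k * w /\ ~ rdvd P w.
Proof.
move=> pP; have P0 : P != 0 by case: pP.
elim: {u}_.+1 {-2}u (ltnSn (msize u)) => // m IH u um u0.
case: (excluded_middle_informative (rdvd P u)) => [[w ew]|h]; last first.
  by exists 0%N, u; rewrite expr0 mul1r.
have w0 : w != 0 by apply: contraNneq u0 => h; rewrite ew h mulr0.
have [|k [w' [ew' hw']]] := IH w _ w0.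
  rewrite -ltnS (leq_trans _ um) // ltnS ew msizeM // -subn1.
  by rewrite -[X in (X < _)%N]add0n -addnBAC ?ltn_add2r ?subn_gt0 ?msize_rprime // ltnW ?msize_rprime.
by exists k.+1, w'; rewrite exprS -mulrA -ew'.
Qed.

Lemma msize_unit n (t : {mpoly K[n]}) : t \is a GRing.unit -> msize t = 1%N.
Proof.
case/unitrPr => t' h; have t0 : t != 0.
  by apply: contraTneq isT => e; move/eqP: h; rewrite e mul0r eq_sym oner_eq0.
have t'0 : t' != 0.
  by apply: contraTneq isT => e; move/eqP: h; rewrite e mulr0 eq_sym oner_eq0.
have := msizeM t0 t'0; rewrite h msize1.
rewrite -msize_poly_eq0 in t0; rewrite -msize_poly_eq0 in t'0.
by case: (msize t) t0 (msize t') t'0 => [//|[|a]] _ [//|[|b]] _; rewrite ?addnS.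
Qed.

Lemma exists_rprime_dvd n (u : {mpoly K[n]}) : (1 < msize u)%N ->
  exists2 P, rprime P & rdvd P u.
Proof.
move=> u1; have u0 : u != 0 by apply: contraTneq u1 => ->; rewrite msize0.
have [t [s [tu ps eu]]] := factorial_mpoly u0.
case: s => [|P s] in ps eu *; last first.
  exists P; first by apply: ps; rewrite mem_head.
  by exists (t * \prod_(p <- s) p); rewrite eu big_cons mulrCA.
move: u1; rewrite eu big_nil mulr1 ltnNge.
by rewrite (msize_unit tu).
Qed.

End FactorialMpoly.

(** * Residue fields *)

Section DomainStructure.
Variable Q : comNzRingType.

(** An alias indexed by the proof of integrality, so that a domain structure can be attached to it,
    with units and inverses chosen classically. *)
Definition domain_of (H : forall x y : Q, x * y = 0 -> (x == 0) || (y == 0)) : Type := Q.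

Variable H : forall x y : Q, x * y = 0 -> (x == 0) || (y == 0).

HB.instance Definition _ := GRing.ComNzRing.on (domain_of H).

Let D : comNzRingType := domain_of H.

Definition dom_unit : {pred D} :=
  fun x => if excluded_middle_informative (exists y, y * x = 1) then true else false.

Definition dom_inv (x : D) : D :=
  if excluded_middle_informative (exists y, y * x = 1) is left h
  then proj1_sig (constructive_indefinite_description _ h) else x.

Lemma dom_mulVx : {in dom_unit, left_inverse 1 dom_inv *%R}.
Proof.
move=> x; rewrite unfold_in /dom_unit /dom_inv.
by case: excluded_middle_informative => // h _; case: constructive_indefinite_description.
Qed.

Lemma dom_unitPl (x y : D) : y * x = 1 -> dom_unit x.
Proof. by rewrite /dom_unit; case: excluded_middle_informative => // h e; case: h; exists y. Qed.

Lemma dom_inv_out : {in [predC dom_unit], dom_inv =1 id}.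
Proof. by move=> x; rewrite inE unfold_in /dom_unit /dom_inv; case: excluded_middle_informative. Qed.

HB.instance Definition _ := GRing.ComNzRing_hasMulInverse.Build (domain_of H)
  dom_mulVx dom_unitPl dom_inv_out.
HB.instance Definition _ := GRing.ComUnitRing_isIntegral.Build (domain_of H) H.

Lemma fraction_field_of_domain : exists (L : fieldType) (phi : {rmorphism Q -> L}),
  (forall a, phi a = 0 -> a = 0) /\ forall x, exists a b, phi b != 0 /\ x = phi a / phi b.
Proof.
pose E : idomainType := domain_of H.
exists {fraction E}, (@tofrac E : {rmorphism E -> {fraction E}}); split=> [a|x].
  by move/eqP; rewrite tofrac_eq0 => /eqP.
move: x; elim/quotW => x; exists (\n_x), (\d_x).
have d0 : (tofrac (\d_x) : {fraction E}) != 0 by rewrite tofrac_eq0 denom_ratioP.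
split=> //; apply: (mulIf d0); rewrite divfK //.
suff : FracField.mul (\pi_(FracField.type E) x)%qT (tofrac (\d_x)) = tofrac (\n_x) by [].
rewrite !piE; apply/eqmodP; rewrite /= FracField.equivfE /FracField.mulf.
by rewrite !numden_Ratio ?mulf_neq0 ?oner_eq0 ?denom_ratioP // !mulr1 mulrC.
Qed.

End DomainStructure.

Section ResidueField.
Variable (R : idomainType) (P : R).
Hypothesis HP : rprime P.

Definition prime_pred : R -> bool :=
  fun a => if excluded_middle_informative (rdvd P a) then true else false.

Lemma prime_predP a : reflect (rdvd P a) (prime_pred a).
Proof. by rewrite /prime_pred; case: excluded_middle_informative => h; constructor. Qed.

End ResidueField.

(** The generic point of the divisor of [P]: the fraction field of the quotient by the prime ideal
    that [P] generates. *)
Theorem residue_field (R : idomainType) (P : R) : rprime P ->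
  exists (L : fieldType) (phi : {rmorphism R -> L}),
   (forall a, phi a = 0 <-> rdvd P a) /\
   forall x, exists a b, phi b != 0 /\ x = phi a / phi b.
Proof.
move=> HP.
have c1 : idealr_closed (prime_pred P).
  split; first by apply/prime_predP; exists 0; rewrite mulr0.
    by apply/prime_predP; apply: rprime_unit => //; apply: unitr1.
  move=> a u v /prime_predP hu /prime_predP hv; apply/prime_predP/rdvdD => //.
  exact: rdvd_mull.
have c2 : prime_idealr_closed (prime_pred P).
  move=> u v /prime_predP /(rprime_dvdM HP) h; apply/orP.
  by case: h => h; [left|right]; apply/prime_predP.
pose I0 := isIdealr.Build R (prime_pred P) c1.
pose J0 := isPrimeIdealrClosed.Build R (prime_pred P) c2.
pose J : prime_idealr R := HB.pack (prime_pred P) I0 J0.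
pose Q : comNzRingType := {ideal_quot J}.
have [L [phi [phi0 phifrac]]] := fraction_field_of_domain (@Quotient.rquot_IdomainAxiom R J).
pose pi : {rmorphism R -> Q} := (\pi_Q)%qT.
exists L, (phi \o pi); split=> [a|x].
  have piE : pi a = 0 <-> rdvd P a.
    rewrite -(rmorph0 pi); split=> [/eqmodP|h].
      by rewrite /= Quotient.equivE subr0 => /prime_predP.
    by apply/eqmodP; rewrite /= Quotient.equivE subr0; apply/prime_predP.
  by split=> [/phi0 /piE|/piE /= ->]; rewrite ?rmorph0.
have [a [b [b0 ->]]] := phifrac x.
by exists (repr a), (repr b) => /=; rewrite !reprK.
Qed.

Lemma expmxZ (R : comPzRingType) m (a : R) (A : 'M_m) k : (a *: A) ^+ k = a ^+ k *: A ^+ k.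
Proof.
elim: k => [|k IH]; first by rewrite !expr0 scale1r.
by rewrite !exprS IH -!mulmxE -scalemxAl -scalemxAr scalerA.
Qed.

(** * One-parameter groups *)

Section ExpAutomorphism.
Variables (K : fieldType).
Hypothesis char0 : [pchar K] =i pred0.
Variables (n : nat) (c : 'I_n -> 'I_n -> 'rV[K]_n).
Hypothesis Hlie : is_lie c.
Local Notation br := (br c).
Local Notation ad := (ad c).

Lemma triangular_sum (V : nmodType) (f : nat -> nat -> V) m :
  \sum_(k < m) \sum_(i < k.+1) f i (k - i)%N = \sum_(i < m) \sum_(j < m - i) f i j.
Proof.
elim: m => [|m IH]; first by rewrite !big_ord0.
rewrite big_ord_recr IH /= [RHS]big_ord_recr /= subSnn big_ord1 big_ord_recr /= subnn addrA.
congr (_ + _); rewrite -big_split; apply: eq_bigr => i _ /=.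
by rewrite subSn 1?ltnW // big_ord_recr.
Qed.

Section Exp.
Variable N : 'M[K]_n.
Let E k : 'M[K]_n := (k`!%:R)^-1 *: N ^+ k.

Lemma divided_powerS k : E k *m N = (k.+1)%:R *: E k.+1.
Proof.
rewrite /E -scalemxAl scalerA exprSr; congr (_ *: _).
by rewrite factS natrM invfM mulrA divff ?mul1r // natr_neq0.
Qed.

Hypothesis HN : forall u v, br u v *m N = br (u *m N) v + br u (v *m N).

Lemma leibniz_divided u v k :
  br u v *m E k = \sum_(i < k.+1) br (u *m E i) (v *m E (k - i)%N).
Proof.
elim: k => [|k IH].
  by rewrite big_ord1 /E subnn expr0 fact0 invr1 scale1r !mulmx1.
have k0 : (k.+1)%:R != 0 :> K by rewrite natr_neq0.
apply: (scalerI k0); rewrite scalemxAr -divided_powerS mulmxA IH mulmx_suml.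
under eq_bigr => i _.
  rewrite HN -!mulmxA !divided_powerS -(scalemxAr (i.+1)%:R u) -(scalemxAr ((k - i).+1)%:R v).
  rewrite (brZl _ _ (i.+1)%:R) (brZr _ _ ((k - i).+1)%:R) -subSn -1?ltnS //.
  over.
rewrite big_split /= [X in X + _ = _](_ : _ = \sum_(i < k.+2) i%:R *: br (u *m E i) (v *m E (k.+1 - i)%N)); last first.
  rewrite [RHS]big_ord_recl /= scale0r add0r; apply: eq_bigr => i _.
  by rewrite /bump /= add1n subSS.
rewrite [X in _ + X = _](_ : _ = \sum_(i < k.+2) (k.+1 - i)%:R *: br (u *m E i) (v *m E (k.+1 - i)%N)); last first.
  by rewrite [RHS]big_ord_recr /= subnn scale0r addr0.
rewrite -big_split scaler_sumr; apply: eq_bigr => i _ /=.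
by rewrite -scalerDl -natrD subnKC // -ltnS.
Qed.

Hypothesis Nn : N ^+ n = 0.

Lemma divided_power0 k : (n <= k)%N -> E k = 0.
Proof. by move=> h; rewrite /E -(subnKC h) exprD Nn mul0r scaler0. Qed.

Lemma expm_sum m : (n <= m)%N -> expm N = \sum_(k < m) E k.
Proof.
have H q : (n <= q)%N -> \sum_(k < q) E k = \sum_(k < n) E k.
  move=> nq; rewrite -(subnKC nq) big_split_ord /= [X in _ + X]big1 ?addr0 // => i _.
  by rewrite divided_power0 // leq_addr.
by move=> h; rewrite /expm -/(E _) (H n.+1) // H.
Qed.

Lemma expm_morphism u v : br (u *m expm N) (v *m expm N) = br u v *m expm N.
Proof.
(* Truncation at 2n: for each i < n the triangular sum over i + j < 2n then contains every j < n,
   and the other terms vanish. *)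
have nn : (n <= n + n)%N by rewrite leq_addr.
rewrite (expm_sum nn) !mulmx_sumr br_suml.
under [RHS]eq_bigr do rewrite leibniz_divided.
rewrite (triangular_sum (fun i j => br (u *m E i) (v *m E j))).
apply: eq_bigr => i _; rewrite br_sumr.
have [hi|hi] := leqP n i.
  by rewrite divided_power0 // mulmx0 !big1 // => j _; rewrite br0l.
have hin : (n <= n + n - i)%N by rewrite -addnBA ?leq_addr // ltnW.
have H q : (n <= q)%N -> \sum_(k < q) br (u *m E i) (v *m E k) = \sum_(k < n) br (u *m E i) (v *m E k).
  move=> nq; rewrite -(subnKC nq) big_split_ord /= [X in _ + X]big1 ?addr0 // => j _.
  by rewrite (divided_power0 (leq_addr j n)) mulmx0 br0r.
by rewrite !H.
Qed.

Lemma expm_unit : expm N \in unitmx.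
Proof.
have [n0|n0] := posnP n; first by rewrite unitmxE [expm N](_ : _ = 1%:M) ?det1 ?unitr1 //; apply/matrixP=> i; have := ltn_ord i; rewrite {2}n0.
pose Q := \sum_(k < n) ((k.+1)`!%:R)^-1 *: N ^+ k : 'M[K]_n.
have NQ : expm N = 1%:M - (- (N *m Q)).
  rewrite opprK /expm big_ord_recl /= fact0 invr1 scale1r expr0; congr (_ + _).
  rewrite mulmx_sumr; apply: eq_bigr => i _.
  by rewrite -scalemxAr /bump /= add1n exprS.
have cNQ : N *m Q = Q *m N.
  rewrite mulmx_sumr mulmx_suml; apply: eq_bigr => i _.
  by rewrite -scalemxAr -scalemxAl !mulmxE -exprS -exprSr.
have Zn : (- (N *m Q)) ^+ n = 0.
  rewrite exprNn -[N *m Q]/(N * Q) exprMn_comm // Nn mul0r mulr0 //.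
move: NQ Zn; move: (- (N *m Q)) => Z -> Zn.
have : (1 - Z) * (\sum_(i < n) Z ^+ i) = 1.
  by rewrite -opprB mulNr -subrX1 Zn sub0r opprK.
by case/mulmx1_unit.
Qed.

End Exp.

Lemma expm_br x u v : ad_nilpotent c x ->
  br (u *m expm (ad x)) (v *m expm (ad x)) = br u v *m expm (ad x).
Proof. by move=> /eqP xn; apply: expm_morphism => // u' v'; apply: br_ad_derivation. Qed.

Lemma nilpotentZ t x : ad_nilpotent c x -> ad_nilpotent c (t *: x).
Proof. by move=> /eqP xn; rewrite /ad_nilpotent adZ expmxZ xn scaler0. Qed.

End ExpAutomorphism.

(** For nonzero [u], the size of u' is less than that of [u], while a nonzero multiple of [u] is at
    least as large. *)
Lemma deriv_eq_mul (R : idomainType) (u v : {poly R}) : u^`() = v * u -> u^`() = 0.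
Proof.
move=> e; have [->|u0] := eqVneq u 0; first by rewrite deriv0.
apply/eqP; apply: contraTT (lt_size_deriv u0) => h; rewrite -leqNgt e.
have v0 : v != 0 by apply: contraNneq h => v0; rewrite e v0 mul0r.
rewrite size_mul //; move: v0; rewrite -size_poly_gt0.
by case: (size v) => // k _; rewrite addSn leq_addl.
Qed.

Section OneParameter.
Variables (K : closedFieldType).
Hypothesis char0 : [pchar K] =i pred0.
Variables (n : nat) (c : 'I_n -> 'I_n -> 'rV[K]_n).
Variable x : 'rV[K]_n.
Hypothesis xn : ad_nilpotent c x.
Local Notation N := (ad c x).

Definition exp_poly : 'M[{poly K}]_n := \matrix_(i, j) \poly_(k < n.+1) ((k`!%:R)^-1 * (N ^+ k) i j).

Lemma exp_polyE t : map_mx (horner_eval t) exp_poly = expm (ad c (t *: x)).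
Proof.
apply/matrixP => i j; rewrite !mxE /horner_eval horner_poly summxE; apply: eq_bigr => k _.
by rewrite adZ expmxZ !mxE; ring.
Qed.

Lemma coef_exp_poly i j k :
  (exp_poly i j)`_k = if (k < n.+1)%N then (k`!%:R)^-1 * (N ^+ k) i j else 0.
Proof. by rewrite mxE coef_poly. Qed.

Lemma exp_poly_deriv i j : (exp_poly i j)^`() = \sum_k (N i k)%:P * exp_poly k j.
Proof.
apply/polyP => k; rewrite coef_deriv coef_sum coef_exp_poly.
under eq_bigr do rewrite coefCM coef_exp_poly.
have [hk|hk] := ltnP k n; last first.
  have -> : (k.+1 < n.+1)%N = false by rewrite ltnS ltnNge hk.
  rewrite mul0rn; have [hk'|hk'] := ltnP k n.+1; last by rewrite big1 // => m _; rewrite mulr0.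
  have -> : k = n by apply/eqP; rewrite eqn_leq hk -ltnS hk'.
  by rewrite big1 // => m _; rewrite (eqP xn) [(0 : 'M_n) m j]mxE !mulr0.
rewrite !ltnS hk (ltnW hk) exprS -mulmxE [(N *m _) i j]mxE -(mulr_natl (_ * _)) mulrA mulr_sumr.
apply: eq_bigr => m _; rewrite mulrCA; congr (_ * _); congr (_ * _).
by rewrite factS natrM invfM mulrA divff ?mul1r // natr_neq0.
Qed.

(** The action of exp(t ad x) with the time t kept as a polynomial variable, so that invariance can
    be tested by differentiating in t. *)
Definition flow : {mpoly K[n]} -> {poly {mpoly K[n]}} :=
  mmap (polyC \o @mpolyC n K) (fun i => \sum_j map_poly (@mpolyC n K) (exp_poly i j) * ('X_j)%:P).
Lemma flow_is_zmod_morphism : zmod_morphism flow.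
Proof. exact: raddfB. Qed.

Lemma flow_is_monoid_morphism : monoid_morphism flow.
Proof. by split; [exact: rmorph1|exact: rmorphM]. Qed.

HB.instance Definition _ := GRing.isZmodMorphism.Build _ _ flow flow_is_zmod_morphism.
HB.instance Definition _ := GRing.isMonoidMorphism.Build _ _ flow flow_is_monoid_morphism.

Lemma flowD p q : flow (p + q) = flow p + flow q.
Proof. exact: (rmorphD flow). Qed.

Lemma flowM p q : flow (p * q) = flow p * flow q.
Proof. exact: (rmorphM flow). Qed.

Lemma flow_sum I (r : seq I) P (f : I -> {mpoly K[n]}) :
  flow (\sum_(i <- r | P i) f i) = \sum_(i <- r | P i) flow (f i).
Proof. exact: (raddf_sum flow). Qed.

Lemma flowC a : flow a%:MP = (a%:MP)%:P.
Proof. by rewrite /flow mmapC. Qed.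

Lemma flowX i : flow 'X_i = \sum_j map_poly (@mpolyC n K) (exp_poly i j) * ('X_j)%:P.
Proof. by rewrite /flow mmapX mmap1U. Qed.

Lemma actC (s : 'M[K]_n) a : act s a%:MP = a%:MP.
Proof. by rewrite /act /msubst mmapC. Qed.

Lemma actX (s : 'M[K]_n) i : act s 'X_i = \sum_j s i j *: 'X_j.
Proof. by rewrite /act /msubst mmapX mmap1U. Qed.

Lemma actD (s : 'M[K]_n) p q : act s (p + q) = act s p + act s q.
Proof. exact: mmapD. Qed.

Lemma actM (s : 'M[K]_n) p q : act s (p * q) = act s p * act s q.
Proof. exact: rmorphM. Qed.

Lemma flowE t p : (flow p).[t%:MP] = act (expm (ad c (t *: x))) p.
Proof.
elim/mpoly_alg_ind: p => [a|i|p q hp hq|p q hp hq].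
- by rewrite flowC hornerC actC.
- rewrite flowX actX horner_sum; apply: eq_bigr => j _.
  by rewrite hornerM hornerC horner_map /= -exp_polyE [in RHS]mxE mul_mpolyC.
- by rewrite flowD hornerD actD; congr (_ + _).
- by rewrite flowM hornerM actM; congr (_ * _).
Qed.

Lemma flow0 p : (flow p).[0] = p.
Proof.
rewrite -[0]mpolyC0 flowE scale0r ad0 /expm big_ord_recl fact0 invr1 scale1r expr0 big1 ?addr0; last first.
  by move=> i _; rewrite /bump /= exprS mul0r scaler0.
elim/mpoly_alg_ind: p => [a|i|p q hp hq|p q hp hq]; rewrite ?actC ?actD ?actM ?hp ?hq //.
rewrite actX (bigD1 i) //= mxE eqxx scale1r big1 ?addr0 // => j /negPf ji.
by rewrite mxE eq_sym ji scale0r.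
Qed.

Definition ad_deriv (p : {mpoly K[n]}) := \sum_i p^`M(i) * \sum_j N i j *: 'X_j.

Lemma flow_deriv p : (flow p)^`() = flow (ad_deriv p).
Proof.
have rd : rel_derivation (flow : {rmorphism _ -> _}) (fun p => (flow p)^`()).
  split=> [p' q|p' q|a].
  - by rewrite flowD derivD.
  - by rewrite flowM derivM.
  - by rewrite flowC derivC.
rewrite (rel_derivationE rd) flow_sum; apply: eq_bigr => i _ /=.
rewrite flowM; congr (_ * _); rewrite flowX flow_sum (raddf_sum (@deriv _)) /=.
under [RHS]eq_bigr => k _ do rewrite -mul_mpolyC flowM flowC flowX mulr_sumr.
rewrite exchange_big /=; apply: eq_bigr => j _.
rewrite derivM derivC mulr0 addr0 deriv_map exp_poly_deriv rmorph_sum mulr_suml.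
by apply: eq_bigr => k _ /=; rewrite rmorphM /= map_polyC mulrA.
Qed.

Lemma horner_inj (p q : {poly {mpoly K[n]}}) : (forall t : K, p.[t%:MP] = q.[t%:MP]) -> p = q.
Proof.
move=> h; apply/eqP; rewrite -subr_eq0; apply/eqP.
have [//|r0] := eqVneq (p - q) 0.
have inj : injective (fun k : nat => (k%:R)%:MP : {mpoly K[n]}).
  move=> a b /eqP; rewrite mpolyC_eq; wlog ab : a b / (a <= b)%N.
    by move=> H hab; case/orP: (leq_total a b) => ab; [exact: H|apply/esym/H; rewrite // eq_sym].
  rewrite -(subnKC ab) natrD -[X in X == _]addr0 (inj_eq (addrI _)) eq_sym.
  rewrite ((pcharf0P _).1 char0) => /eqP ->; by rewrite addn0.
have : (size [seq ((k%:R)%:MP : {mpoly K[n]}) | k <- iota 0 (size (p - q)%R)] < size (p - q)%R)%N.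
  apply: max_poly_roots => //; last by rewrite map_inj_uniq // iota_uniq.
  by apply/allP => _ /mapP [k _ ->]; rewrite rootE hornerD hornerN h subrr.
by rewrite size_map size_iota ltnn.
Qed.

Lemma deriv_eq0_const (p : {poly {mpoly K[n]}}) : p^`() = 0 -> p = (p`_0)%:P.
Proof.
move=> p'; apply/polyP => -[|k]; rewrite coefC //=.
have := congr1 (fun q : {poly _} => q`_k) p'; rewrite coef_deriv coef0 -mulr_natr => /eqP.
rewrite mulf_eq0 => /orP [/eqP //|]; rewrite -mpolyC1 -mpolyCMn mpolyC_eq0.
by rewrite ((pcharf0P _).1 char0).
Qed.

(* [u' = c u] for polynomials in the time parameter forces [u' = 0]. *)
Lemma semi_invariant_act p b : ad_deriv p = b * p -> act (expm (ad c x)) p = p.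
Proof.
move=> h; have e : (flow p)^`() = flow b * flow p by rewrite flow_deriv h flowM.
have p'0 := deriv_eq_mul e.
have cst := deriv_eq0_const p'0.
have := flowE 1 p; rewrite scale1r => <-.
by have := flow0 p; rewrite cst !hornerC.
Qed.

(** Along exp(t ad x) the determinant is a polynomial in t without zeros, hence constant over an
    algebraically closed field, and it is 1 at t = 0. *)
Lemma det_exp : \det (expm (ad c x)) = 1.
Proof.
have e t : (\det exp_poly).[t] = \det (expm (ad c (t *: x))).
  by rewrite -exp_polyE -[LHS]/(horner_eval t _) -det_map_mx.
have s1 : (size (\det exp_poly) <= 1)%N.
  rewrite leqNgt; apply/negP => s1.
  have [t /eqP] := closed_rootP (\det exp_poly) (negbT (gtn_eqF s1)).
  rewrite e => h; have := expm_unit (eqP (nilpotentZ t xn)); by rewrite unitmxE h unitr0.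
have := e 1; have := e 0; rewrite (size1_polyC s1) !hornerC scale1r => -> <-.
rewrite scale0r ad0 /expm big_ord_recl fact0 invr1 scale1r expr0 big1 ?addr0 ?det1 //.
by move=> i _; rewrite /bump /= exprS mul0r scaler0.
Qed.

End OneParameter.

(** * Tangent directions to orbits *)

Section BaseChange.
Variables (K L : fieldType) (iota : {rmorphism K -> L}).
Hypothesis char0 : [pchar K] =i pred0.
Variables (n : nat) (c : 'I_n -> 'I_n -> 'rV[K]_n).
Hypothesis Hlie : is_lie c.

Definition map_struct i j := map_mx iota (c i j).
Local Notation cL := map_struct.

Lemma br_map x y : br cL (map_mx iota x) (map_mx iota y) = map_mx iota (br c x y).
Proof.
rewrite /br; apply/rowP => k; rewrite mxE !summxE rmorph_sum; apply: eq_bigr => i _ /=.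
by rewrite !summxE rmorph_sum; apply: eq_bigr => j _ /=; rewrite !mxE !rmorphM.
Qed.

Lemma map_delta i : map_mx iota (delta_mx 0 i) = delta_mx 0 i :> 'rV_n.
Proof. exact: map_delta_mx. Qed.

Lemma ad_map x : ad cL (map_mx iota x) = map_mx iota (ad c x).
Proof. by apply/row_matrixP=> i; rewrite row_ad -map_row row_ad -br_map map_delta. Qed.

Lemma gram_map : gram cL = map_mx iota (gram c).
Proof.
apply/matrixP=> i j; rewrite !mxE /killing -map_delta -(map_delta j) !ad_map.
by rewrite -map_mxM trace_map_mx.
Qed.

Lemma pchar_map : [pchar L] =i pred0.
Proof.
apply/pcharf0P => k; rewrite -(rmorph_nat iota) fmorph_eq0.
exact: (pcharf0P _).1.
Qed.

(** The Jacobi identity is trilinear and is checked on the basis. Antisymmetry on the basis gives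
    [x, x] = - [x, x], and 2 is invertible. *)
Lemma is_lie_map : is_lie cL.
Proof.
have char0L := pchar_map.
have cii i : c i i = 0 by rewrite -br_basis br_xx.
have cij i j : c i j = - c j i by rewrite -!br_basis brC.
split=> [x|x y z].
  set S := br cL x x; have SN : S = - S.
    rewrite {1}/S /br exchange_big /= /S /br -sumrN; apply: eq_bigr => i _.
    rewrite -sumrN; apply: eq_bigr => j _.
    by rewrite mulrC /map_struct cij map_mxN scalerN.
  have : (2%:R : L) *: S = 0 by rewrite scaler_nat mulr2n {1}SN addNr.
  by move/eqP; rewrite scaler_eq0 (negPf (natr_neq0 char0L _)) //= => /eqP.
pose J x y z := br cL x (br cL y z) + br cL y (br cL z x) + br cL z (br cL x y).
have Jcyc x' y' z' : J x' y' z' = J y' z' x' by rewrite /J [LHS]addrC addrA addrC addrA.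
have Jlin x' y' z' : (forall i, J (delta_mx 0 i) y' z' = 0) -> J x' y' z' = 0.
  move=> h; rewrite [x']row_sum_delta /J.
  rewrite br_suml [br cL z' (\sum_(j < n) _)]br_sumr br_suml !br_sumr -!big_split big1 // => i _ /=.
  rewrite !brZl !brZr -!scalerDr.
  by have := h i; rewrite /J => ->; rewrite scaler0.
rewrite -/(J x y z); apply: (Jlin) => i; rewrite Jcyc; apply: (Jlin) => j; rewrite Jcyc.
apply: Jlin => k; rewrite /J -!map_delta !br_map -!map_mxD.
by case: Hlie => _ ->; rewrite map_mx0.
Qed.

End BaseChange.

(** * The Lie-Poisson matrix and Richardson's tangency argument *)

Section LiePoisson.
Variables (K : closedFieldType).
Hypothesis char0 : [pchar K] =i pred0.
Variables (n : nat) (c : 'I_n -> 'I_n -> 'rV[K]_n).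
Hypothesis Hlie : is_lie c.
Hypothesis HG : gram c \in unitmx.
Local Notation Pn := {mpoly K[n]}.
Local Notation G := (gram c).

Definition lie_poisson : 'M[Pn]_n := \matrix_(i, j) \sum_k c i j 0 k *: 'X_k.

Lemma lie_poisson_tr : lie_poisson^T = - lie_poisson.
Proof.
apply/matrixP=> i j; rewrite !mxE -sumrN; apply: eq_bigr => k _.
by rewrite -[c j i]br_basis (brC Hlie) br_basis mxE scaleNr.
Qed.

(* [ad X] for the generic point [X], after identification with the dual by the Killing form. *)
Definition generic_ad : 'M[Pn]_n :=
  \sum_k 'X_k *: map_mx (@mpolyC n K) (ad c (row k (invmx G))).

HB.instance Definition _ s := GRing.isZmodMorphism.Build _ _ (act s : Pn -> Pn)
  (raddfB (mmap (@mpolyC n K) (fun i => \sum_(j < n) s i j *: 'X_j))).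
Lemma act_monoid (s : 'M[K]_n) : monoid_morphism (act s : Pn -> Pn).
Proof. by split; [exact: (rmorph1 (mmap _ _))|exact: actM]. Qed.
HB.instance Definition _ s := GRing.isMonoidMorphism.Build _ _ (act s : Pn -> Pn) (act_monoid s).

Section Invariance.
Variable s : 'M[K]_n.
Hypothesis Hs : s \in unitmx.
Hypothesis Hbr : forall u v, br c (u *m s) (v *m s) = br c u v *m s.

Lemma ad_automorphism x : ad c (x *m s) = invmx s *m ad c x *m s.
Proof.
apply/row_matrixP=> i; rewrite !rowE !mulmxA !mul_ad -Hbr.
by congr br; rewrite mulmxKV.
Qed.

Lemma killing_automorphism x y : killing c (x *m s) (y *m s) = killing c x y.
Proof.
by rewrite /killing !ad_automorphism !mulmxA mulmxK // mxtrace_mulC !mulmxA mulmxV // mul1mx.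
Qed.

Lemma gram_automorphism : s *m G *m s^T = G.
Proof.
apply/matrixP=> i j.
have -> : (s *m G *m s^T) i j = (row i s *m G *m (row j s)^T) 0 0.
  by rewrite -row_mul mxE [RHS]mxE; apply: eq_bigr => k _; rewrite !mxE.
by rewrite mul_gram !rowE killing_automorphism mxE.
Qed.

Local Notation "A ^K" := (map_mx (@mpolyC n K) A) (at level 2, format "A ^K").

Lemma act_lie_poisson : map_mx (act s) lie_poisson = s^K *m lie_poisson *m (s^K)^T.
Proof.
apply/matrixP=> i j; rewrite [LHS]mxE [lie_poisson i j]mxE raddf_sum /=.
have lhs : \sum_k act s (c i j 0 k *: 'X_k) = \sum_m (c i j *m s) 0 m *: 'X_m.
  under eq_bigr do rewrite -mul_mpolyC actM actC actX mulr_sumr.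
  rewrite exchange_big; apply: eq_bigr => m _ /=; rewrite mxE scaler_suml.
  by apply: eq_bigr => k _; rewrite mul_mpolyC scalerA.
rewrite lhs -br_basis -Hbr -!rowE.
rewrite mxE; under [RHS]eq_bigr do rewrite [(_ *m _) i _]mxE mulr_suml.
rewrite exchange_big /= /br.
under eq_bigr => m _ do rewrite summxE scaler_suml.
rewrite exchange_big; apply: eq_bigr => a _ /=.
under eq_bigr => m _ do rewrite summxE scaler_suml.
rewrite exchange_big; apply: eq_bigr => b _ /=.
rewrite !mxE mulr_sumr mulr_suml; apply: eq_bigr => m _.
by rewrite !mxE -!mul_mpolyC !mpolyCM; ring.
Qed.

Lemma act_generic_ad : map_mx (act s) generic_ad = s^K *m generic_ad *m (invmx s)^K.
Proof.
have hG : s^T *m invmx G = invmx G *m invmx s.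
  transitivity (invmx G *m invmx s *m (s *m G *m s^T) *m invmx G).
    by rewrite !mulmxA mulmxKV // mulVmx // mul1mx.
  by rewrite gram_automorphism mulmxK.
rewrite /generic_ad raddf_sum /= mulmx_sumr mulmx_suml.
have conj x : s^K *m (ad c x)^K *m (invmx s)^K = (ad c (x *m invmx s))^K.
  rewrite -!map_mxM; congr map_mx; rewrite -{1}[x](mulmxKV Hs) ad_automorphism.
  by rewrite !mulmxA mulmxV // mul1mx mulmxK.
under [RHS]eq_bigr => k _ do rewrite -scalemxAr -scalemxAl conj -row_mul -hG row_mul.
have actmap (A : 'M[K]_n) : map_mx (act s) A^K = A^K by apply/matrixP=> i j; rewrite !mxE actC.
under eq_bigr => k _ do rewrite map_mxZ /= actX actmap scaler_suml.
rewrite exchange_big; apply: eq_bigr => j _ /=.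
have -> : row j s^T *m invmx G = \sum_k s k j *: row k (invmx G).
  by rewrite mulmx_sum_row; apply: eq_bigr => k _; rewrite !mxE.
rewrite ad_sum raddf_sum scaler_sumr; apply: eq_bigr => k _ /=.
by rewrite adZ map_mxZ /= scalerA ['X_j * _]mulrC mul_mpolyC.
Qed.

Lemma act_char_poly : map_poly (act s) (char_poly generic_ad) = char_poly generic_ad.
Proof.
rewrite map_char_poly act_generic_ad /char_poly.
have sV : s^K *m (invmx s)^K = 1%:M by rewrite -map_mxM mulmxV // map_mx1.
have -> : char_poly_mx (s^K *m generic_ad *m (invmx s)^K) =
   map_mx polyC s^K *m char_poly_mx generic_ad *m map_mx polyC (invmx s)^K.
  rewrite /char_poly_mx mulmxBr mulmxBl !map_mxM; congr (_ - _).
  by rewrite scalar_mxC -mulmxA -map_mxM sV map_mx1 mulmx1.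
rewrite !det_mulmx mulrAC -det_mulmx -map_mxM sV map_mx1 det1 mul1r //.
Qed.

End Invariance.

(** Being polynomials in the [F i], these coefficients are killed by any derivation killing the
    [F i], which is the hypothesis of [tr_deriv_commutant]. *)
Lemma char_poly_invariant k : G_invariant c (char_poly generic_ad)`_k.
Proof.
move=> x xn; have := act_char_poly (expm_unit (eqP xn)) (fun u v => expm_br char0 Hlie u v xn).
by move/(congr1 (fun q : {poly Pn} => q`_k)); rewrite coef_map.
Qed.

Variables (l : nat) (F : 'I_l -> Pn).
Hypothesis Finv : forall i, G_invariant c (F i).
Hypothesis Fgen : forall P, G_invariant c P -> exists Q : {mpoly K[l]}, P = msubst F Q.

Definition gradient_mx : 'M[Pn]_(l, n) := \matrix_(i, a) (F i)^`M(a).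

Section Point.
Variables (L : fieldType) (phi : {rmorphism Pn -> L}).
Hypothesis frac : forall x : L, exists a b, phi b != 0 /\ x = phi a / phi b.

Let iota : {rmorphism K -> L} := (phi \o @mpolyC n K).
Local Notation cL := (map_struct iota c).
Let lieL : is_lie cL := is_lie_map iota char0 Hlie.
Let GL := gram cL.
Let Xi : 'rV[L]_n := \row_k phi 'X_k.
Let X := Xi *m invmx GL.

Lemma GL_unit : GL \in unitmx.
Proof. by rewrite /GL gram_map map_unitmx. Qed.

Lemma map_generic_ad : map_mx phi generic_ad = ad cL X.
Proof.
rewrite /X mulmx_sum_row ad_sum raddf_sum; apply: eq_bigr => k _ /=.
rewrite adZ map_mxZ -map_mx_comp /GL gram_map -map_invmx -map_row ad_map [Xi 0 k]mxE //.
Qed.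

Lemma map_lie_poisson : map_mx phi lie_poisson = ad cL X *m GL.
Proof.
apply/matrixP=> i j.
have -> : (ad cL X *m GL) i j = (row i (ad cL X) *m GL *m (delta_mx 0 j : 'rV_n)^T) 0 0.
  by rewrite trmx_delta -row_mul -colE !mxE.
rewrite mul_gram row_ad killing_inv // -mul_gram /X mulmxKV ?GL_unit // br_basis.
rewrite !mxE rmorph_sum; apply: eq_bigr => k _.
by rewrite -mul_mpolyC rmorphM !mxE mulrC.
Qed.

Lemma derivation_invariant (delta : L -> L) : derivation delta ->
  (forall a, delta (iota a) = 0) -> (forall i, delta (phi (F i)) = 0) ->
  forall P, G_invariant c P -> delta (phi P) = 0.
Proof.
move=> [dD dM] d0 dF P /Fgen [Q ->]; elim/mpoly_alg_ind: Q => [a|i|p q hp hq|p q hp hq].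
- by rewrite /msubst mmapC d0.
- by rewrite /msubst mmapX mmap1U dF.
- by rewrite /msubst mmapD rmorphD dD hp hq addr0.
- by rewrite /msubst rmorphM rmorphM dM hp hq mul0r mulr0 addr0.
Qed.

(* Richardson's argument: along a derivation killing the invariants, [ad X] moves inside
   its conjugacy class, so that [delta X] is tangent to the orbit of [X]. *)
Lemma derivation_tangent (delta : L -> L) : derivation delta ->
  (forall a, delta (iota a) = 0) -> (forall i, delta (phi (F i)) = 0) ->
  (dmx delta Xi <= map_mx phi lie_poisson)%MS.
Proof.
move=> dP d0 dF; have char0L := pchar_map iota char0.
have cst : const_poly delta (char_poly (ad cL X)).
  move=> k; rewrite -map_generic_ad -map_char_poly coef_map /=.
  exact: derivation_invariant (char_poly_invariant k).
have dmap m p (A : 'M[K]_(m, p)) : dmx delta (map_mx iota A) = 0.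
  by apply/matrixP=> i j; rewrite !mxE d0.
have dX : dmx delta X = dmx delta Xi *m invmx GL.
  by rewrite /X dmxM // /GL gram_map -map_invmx dmap mulmx0 addr0.
have dad : dmx delta (ad cL X) = ad cL (dmx delta X).
  have adE x : ad cL x = \sum_k x 0 k *: map_mx iota (ad c (delta_mx 0 k)).
    rewrite {1}[x]row_sum_delta ad_sum; apply: eq_bigr => k _.
    by rewrite adZ -(map_delta iota) ad_map.
  apply/matrixP=> i j; rewrite mxE !adE !summxE derivation_sum //; apply: eq_bigr => k _.
  by rewrite !mxE; case: (dP) => _ ->; rewrite d0 mulr0 addr0.
(* If [y] centralizes [X] then ad y is in the commutant of ad X, to which the derivative of ad X is
   trace-orthogonal. *)
have kill y : y *m ad cL X = 0 -> killing cL (dmx delta X) y = 0.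
  move=> yX; rewrite /killing -dad; apply: (tr_deriv_commutant dP char0L cst).
  have : ad cL (br cL X y) = 0 by rewrite -mul_ad yX ad0.
  by rewrite ad_br // => /eqP; rewrite subr_eq0 => /eqP.
(* Membership in the row space is tested on the columns of the cokernel; by skewness of the
   Lie-Poisson matrix these centralize [X]. *)
rewrite submxE; apply/eqP/matrixP=> i j; rewrite ord1 [RHS]mxE.
set Y := cokermx _.
have yX : row j Y^T *m ad cL X = 0.
  have : row j Y^T *m map_mx phi lie_poisson = 0.
    rewrite -row_mul -[map_mx phi _]trmxK map_trmx lie_poisson_tr map_mxN linearN /=.
    by rewrite mulmxN -trmx_mul mulmx_coker trmx0 oppr0 row0.
  rewrite map_lie_poisson mulmxA => h.
  by rewrite -[LHS](mulmxK GL_unit) h mul0mx.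
have := kill _ yX; rewrite -mul_gram dX -/GL mulmxKV ?GL_unit // => h.
by rewrite -[RHS]h tr_row trmxK !mxE; apply: eq_bigr => k _; rewrite !mxE.
Qed.

(** The first hypothesis turns [v] into a derivation of [L], and the second makes this derivation
    kill the invariants. *)
Lemma tangent_in_orbit (v : 'rV[L]_n) :
  (forall p, phi p = 0 -> \sum_i phi p^`M(i) * v 0 i = 0) ->
  v *m (map_mx phi gradient_mx)^T = 0 -> (v <= map_mx phi lie_poisson)%MS.
Proof.
move=> vker vF; have [dD dM dC] := rel_derivation_pd phi (fun i => v 0 i).
have [delta [dP dE]] := extend_derivation dD dM frac vker.
have -> : v = dmx delta Xi.
  apply/rowP => k; rewrite !mxE dE (bigD1 k) //= mderivX mnm1E eqxx scale1r.
  have -> : (U_(k) - U_(k))%MM = 0%MM :> 'X_{1..n} by apply/mnmP=> i; rewrite mnmBE subnn mnm0E.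
  rewrite mpolyX0 rmorph1 mul1r big1 ?addr0 // => i ik.
  by rewrite mderivX mnm1E eq_sym (negPf ik) scale0r rmorph0 mul0r.
apply: derivation_tangent => // [a|i]; first by rewrite /= dE dC.
rewrite dE; move/matrixP/(_ 0 i): vF; rewrite !mxE => h.
by rewrite -[RHS]h; apply: eq_bigr => a _; rewrite !mxE mulrC.
Qed.

End Point.
End LiePoisson.

(** * Ranks and bordered determinants *)

Section NonzeroEval.
Variable K : fieldType.
Hypothesis char0 : [pchar K] =i pred0.

Lemma poly_nonroot (p : {poly K}) : p != 0 -> exists t, p.[t] != 0.
Proof.
move=> p0; apply: NNPP => h.
have hr t : p.[t] = 0 by apply/eqP/negPn/negP => ht; apply: h; exists t.
have inj : injective (fun k : nat => k%:R : K).
  move=> a b /eqP; wlog ab : a b / (a <= b)%N.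
    by move=> H hab; case/orP: (leq_total a b) => ab; [exact: H|apply/esym/H; rewrite // eq_sym].
  rewrite -(subnKC ab) natrD -[X in X == _]addr0 (inj_eq (addrI _)) eq_sym.
  rewrite ((pcharf0P _).1 char0) => /eqP ->; by rewrite addn0.
have : (size [seq (k%:R : K) | k <- iota 0 (size p)] < size p)%N.
  apply: max_poly_roots => //; last by rewrite map_inj_uniq // iota_uniq.
  by apply/allP => _ /mapP [k _ ->]; rewrite rootE hr.
by rewrite size_map size_iota ltnn.
Qed.

Lemma meval_muni n (p : {mpoly K[n.+1]}) (t : 'I_n -> K) (s : K) :
  p.@[fun i => if unlift ord_max i is Some j then t j else s] =
  (map_poly (meval t) (muni p)).[s].
Proof.
elim/mpoly_alg_ind: p => [a|i|p q hp hq|p q hp hq].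
- by rewrite mevalC muniC map_polyC /= hornerC mevalC.
- rewrite mevalXU; case: unliftP => [j|] ->.
    have -> : lift ord_max j = widen_ord (leqnSn n) j by apply/val_inj; rewrite /= /bump leqNgt ltn_ord.
    by rewrite muni_widen map_polyC /= hornerC mevalXU.
  by rewrite muni_max map_polyX hornerX.
- by rewrite mevalD hp hq muniD rmorphD hornerD.
- by rewrite mevalM hp hq muniM rmorphM hornerM.
Qed.

Lemma mpoly_nonzero_eval n (p : {mpoly K[n]}) : p != 0 -> exists t, p.@[t] != 0.
Proof.
elim: n p => [|n IH] p p0.
  by exists (fun _ => 0); rewrite (nvar0_mpolyC p) mevalC; apply: contraNneq p0 => h; rewrite (nvar0_mpolyC p) h mpolyC0.
have q0 : muni p != 0 by apply: contraNneq p0 => h; rewrite -(munmultiK p) h raddf0.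
have [|t ht] := IH (lead_coef (muni p)); first by rewrite lead_coef_eq0.
have r0 : map_poly (meval t) (muni p) != 0.
  apply: contraNneq ht => h; have := congr1 (fun r : {poly K} => r`_(size (muni p)).-1) h.
  by rewrite coef_map coef0 -lead_coefE => ->.
have [s hs] := poly_nonroot r0.
by exists (fun i => if unlift ord_max i is Some j then t j else s); rewrite meval_muni.
Qed.

End NonzeroEval.

Section Minors.

Lemma exists_minor (F : fieldType) m n (A : 'M[F]_(m, n)) :
  exists (f : 'I_(\rank A) -> 'I_m) (g : 'I_(\rank A) -> 'I_n), mxsub f g A \in unitmx.
Proof.
have fA : row_free (rowsub (maxrankfun A) A) by apply: maxrowsub_free.
set B := rowsub _ A in fA.
have fB : row_full B^T by rewrite /row_full mxrank_tr.
exists (maxrankfun A), (fullrankfun fB).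
have -> : mxsub (maxrankfun A) (fullrankfun fB) A = (rowsub (fullrankfun fB) B^T)^T.
  by apply/matrixP=> i j; rewrite !mxE.
by rewrite unitmx_tr; apply: fullrowsub_unit.
Qed.

Lemma rank_mxsub_le (F : fieldType) m n p q (A : 'M[F]_(m, n)) (f : 'I_p -> 'I_m) (g : 'I_q -> 'I_n) :
  (\rank (mxsub f g A) <= \rank A)%N.
Proof.
have -> : mxsub f g A = rowsub f (rowsub g A^T)^T by apply/matrixP=> i j; rewrite !mxE.
apply: leq_trans (_ : \rank (rowsub g A^T)^T <= _)%N.
  by apply: mxrankS; apply/row_subP => i; rewrite row_rowsub row_sub.
rewrite mxrank_tr -(mxrank_tr A); apply: mxrankS.
by apply/row_subP => i; rewrite row_rowsub row_sub.
Qed.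

(** A minor that survives under [phi] is a nonzero polynomial, hence nonzero at some [K]-point,
    where the rank is bounded. *)
Lemma rank_specialization (K : fieldType) n p q k (A : 'M[{mpoly K[n]}]_(p, q))
   (L : fieldType) (phi : {rmorphism {mpoly K[n]} -> L}) : [pchar K] =i pred0 ->
  (forall t, (\rank (map_mx (meval t) A) <= k)%N) -> (\rank (map_mx phi A) <= k)%N.
Proof.
move=> char0 h; have [f [g]] := exists_minor (map_mx phi A).
rewrite -map_mxsub unitmxE det_map_mx unitfE => d0.
have d0' : \det (mxsub f g A) != 0 by apply: contraNneq d0 => ->; rewrite rmorph0.
have [t ht] := mpoly_nonzero_eval char0 d0'.
apply: leq_trans (h t); apply: leq_trans (rank_mxsub_le _ f g).
by rewrite -map_mxsub mxrank_unit // unitmxE det_map_mx unitfE.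
Qed.

End Minors.

Section BorderedDeterminant.
Variable F : fieldType.

Lemma exists_complement l k (D : 'M[F]_(l, l + k)) : row_free D ->
  exists D2 : 'M[F]_(k, l + k), col_mx D D2 \in unitmx.
Proof.
move=> fD; exists (dsubmx (row_ebase D)).
have -> : col_mx D (dsubmx (row_ebase D)) = block_mx (col_ebase D) 0 0 1%:M *m row_ebase D.
  rewrite -{2}[row_ebase D]vsubmxK mul_block_col !mul0mx addr0 add0r mul1mx; congr col_mx.
  rewrite -{1}[D]mulmx_ebase (eqP fD) pid_mx_row -[X in _ *m row_mx _ _ *m X]vsubmxK.
  by rewrite -mulmxA mul_row_col mul0mx addr0 mul1mx.
rewrite unitmx_mul row_ebase_unit andbT unitmxE det_ublock det1 mulr1 -unitmxE.
exact: col_ebase_unit.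
Qed.

(* The pairing of the top exterior power of [M] with [T], [T'] factors through the kernel of [M]. *)
Lemma det_kernel_aux l k (M : 'M[F]_(l + k)) (D : 'M[F]_(l, l + k)) :
  row_free D -> M *m D^T = 0 -> D *m M = 0 -> \rank M = k ->
  exists2 lam : F, lam != 0 & forall T T' : 'M[F]_(l, l + k),
    \det (M + T^T *m T') = lam * (\det (D *m T^T) * \det (T' *m D^T)).
Proof.
move=> fD MD DM rM; have [D2 uE] := exists_complement fD.
set E := col_mx D D2 in uE.
set M2 := D2 *m M *m D2^T.
have EME : E *m M *m E^T = block_mx 0 0 0 M2.
  rewrite /E tr_col_mx mul_col_mx DM mul_col_row !mul0mx -mulmxA MD mulmx0 //.
have M2u : M2 \in unitmx.
  rewrite -row_free_unit /row_free eqn_leq rank_leq_row /= -{1}rM.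
  have -> : \rank M = \rank (E *m M *m E^T).
    by rewrite mxrankMfree ?row_free_unit ?unitmx_tr // eqmxMfull // row_full_unit.
  by rewrite EME rank_diag_block_mx mxrank0 add0n.
have dE : \det E != 0 by rewrite -unitfE -unitmxE.
have dM2 : \det M2 != 0 by rewrite -unitfE -unitmxE.
exists (\det M2 / (\det E * \det E)); first by rewrite mulf_neq0 // invr_neq0 // mulf_neq0.
move=> T T'; apply: (mulfI (mulf_neq0 dE dE)).
have -> : \det E * \det E * \det (M + T^T *m T') = \det (E *m (M + T^T *m T') *m E^T).
  by rewrite !det_mulmx det_tr; ring.
have -> : E *m (M + T^T *m T') *m E^T =
   block_mx (D *m T^T) 0 (D2 *m T^T) 1%:M *m block_mx (T' *m D^T) (T' *m D2^T) 0 M2.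
  rewrite mulmxDr mulmxDl EME /E tr_col_mx mul_col_mx mul_col_row.
  rewrite mulmx_block add_block_mx !mul0mx !add0r !addr0 mul1mx !mulmxA.
  by rewrite mul1mx addr0 [X in block_mx _ _ _ X = _]addrC.
rewrite det_mulmx det_ublock det_lblock det1; field.
by rewrite dE.
Qed.

Lemma det_kernel n l (M : 'M[F]_n) (D : 'M[F]_(l, n)) :
  row_free D -> M *m D^T = 0 -> D *m M = 0 -> \rank M = (n - l)%N ->
  exists2 lam : F, lam != 0 & forall T T' : 'M[F]_(l, n),
    \det (M + T^T *m T') = lam * (\det (D *m T^T) * \det (T' *m D^T)).
Proof.
move=> fD; have ln : (l <= n)%N by rewrite -(eqP fD) rank_leq_col.
move: (n - l)%N (subnKC ln) => k nk; subst n.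
by apply: det_kernel_aux.
Qed.

End BorderedDeterminant.

Local Notation "A ^K" := (map_mx (@mpolyC _ _) A) (at level 2, format "A ^K").

Lemma classical_min (P : nat -> Prop) : (exists m, P m) ->
  exists m, P m /\ forall k, P k -> (m <= k)%N.
Proof.
case=> m Pm; apply: NNPP => h.
suff main k : forall j, (j <= k)%N -> ~ P j by apply: (main m m).
elim: k => [|k IH] j jk Pj.
  by apply: h; exists j; split=> // i _; move: jk; rewrite leqn0 => /eqP ->.
apply: h; exists j; split=> // i Pi; rewrite leqNgt; apply/negP => ij.
by apply: (IH i) => //; rewrite -ltnS (leq_trans ij).
Qed.

Lemma deriv0_cross (R : comNzRingType) (A B : {poly R}) (u v : R) :
  A * v%:P = u%:P * B -> A^`().[0] * v = u * B^`().[0].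
Proof.
move/(congr1 (fun p : {poly R} => p^`().[0])).
by rewrite !derivM !derivC mulr0 mul0r addr0 add0r !hornerM !hornerC.
Qed.

(** * Kostant's identity *)

Section KostantIdentity.
Variables (K : closedFieldType).
Hypothesis char0 : [pchar K] =i pred0.
Variables (n : nat) (c : 'I_n -> 'I_n -> 'rV[K]_n).
Hypothesis Hlie : is_lie c.
Hypothesis HG : gram c \in unitmx.
Variable l : nat.
Hypothesis Hrank : lie_rank c l.
Variable F : 'I_l -> {mpoly K[n]}.
Hypothesis Finv : forall i, G_invariant c (F i).
Hypothesis Fgen : forall P, G_invariant c P -> exists Q : {mpoly K[l]}, P = msubst F Q.
Local Notation Pn := {mpoly K[n]}.
Local Notation G := (gram c).
Local Notation M := (lie_poisson c).
Local Notation D := (gradient_mx F).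

Lemma lie_poisson_eval t : map_mx (meval t) M = ad c ((\row_k t k) *m invmx G) *m G.
Proof.
apply/matrixP=> i j; set x := _ *m invmx G.
have -> : (ad c x *m G) i j = (row i (ad c x) *m G *m (delta_mx 0 j : 'rV_n)^T) 0 0.
  by rewrite trmx_delta -row_mul -colE !mxE.
rewrite mul_gram row_ad killing_inv // -mul_gram /x mulmxKV // br_basis.
rewrite !mxE raddf_sum; apply: eq_bigr => k _ /=.
by rewrite mevalZ mevalXU !mxE mulrC.
Qed.

Lemma rank_le_dim : (l <= n)%N.
Proof. by case: Hrank => -[x <-] _; apply: rank_leq_row. Qed.

Lemma rank_lie_poisson_eval t : (\rank (map_mx (meval t) M) <= n - l)%N.
Proof.
rewrite lie_poisson_eval mxrankMfree ?row_free_unit //; set x := _ *m _.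
have := (Hrank.2 x); rewrite /cent_dim mxrank_ker => h.
have hx := rank_leq_row (ad c x); clear -h hx; move: (\rank _) h hx => r; lia.
Qed.

Section Point.
Variables (L : fieldType) (phi : {rmorphism Pn -> L}).
Hypothesis frac : forall x : L, exists a b, phi b != 0 /\ x = phi a / phi b.
Hypothesis ker : forall v : 'rV[L]_n, v *m (map_mx phi D)^T = 0 ->
  forall p, phi p = 0 -> \sum_i phi p^`M(i) * v 0 i = 0.

(** Tangency and minimality of [l] give n - rank D <= rank M <= n - l, while D has [l] rows: all are
    equalities, and the kernel of D^T is exactly the row space of M. *)
Lemma point_ranks : [/\ row_free (map_mx phi D), \rank (map_mx phi M) = (n - l)%N,
  map_mx phi M *m (map_mx phi D)^T = 0 & map_mx phi D *m map_mx phi M = 0].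
Proof.
have h1 : (kermx (map_mx phi D)^T <= map_mx phi M)%MS.
  apply/row_subP => i; set v := row i _.
  have vD : v *m (map_mx phi D)^T = 0 by apply/sub_kermxP/row_sub.
  exact: (tangent_in_orbit char0 Hlie HG Fgen frac (ker vD) vD).
have h2 := rank_specialization phi char0 rank_lie_poisson_eval.
have h3 := mxrankS h1; rewrite mxrank_ker mxrank_tr in h3.
have h4 : (\rank (map_mx phi D) <= l)%N by apply: rank_leq_row.
have ln := rank_le_dim.
have rD : \rank (map_mx phi D) = l.
  apply/eqP; rewrite eqn_leq h4 /=.
  by have h5 := leq_trans h3 h2; clear -h5 h4 ln; move: (\rank _) h4 h5 => r; lia.
have rM : \rank (map_mx phi M) = (n - l)%N.
  by apply/eqP; rewrite eqn_leq h2 /=; rewrite rD in h3.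
have MD : map_mx phi M *m (map_mx phi D)^T = 0.
  apply/sub_kermxP; have [_ e] := mxrank_leqif_sup h1.
  by rewrite -e mxrank_ker mxrank_tr rD rM eqxx.
split=> //; first by rewrite /row_free rD.
apply: trmx_inj; rewrite trmx_mul trmx0 map_trmx lie_poisson_tr // map_mxN mulNmx MD oppr0 //.
Qed.

Lemma exists_constant_frame : exists T : 'M[K]_(l, n), \det (map_mx phi D *m (map_mx phi T^K)^T) != 0.
Proof.
have [fD _ _ _] := point_ranks.
have fB : row_full (map_mx phi D)^T by rewrite /row_full mxrank_tr.
exists (rowsub (fullrankfun fB) 1%:M).
rewrite -det_tr trmx_mul trmxK map_mxsub map_mx1 map_mxsub map_mx1 mul_rowsub_mx mul1mx.
by rewrite -unitfE -unitmxE; apply: fullrowsub_unit.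
Qed.

End Point.

Definition frame_num (T T' : 'M[K]_(l, n)) : Pn := \det (M + (T^T *m T')^K).
Definition frame_den (T : 'M[K]_(l, n)) : Pn := \det (D *m (T^K)^T).
Local Notation a := frame_num.
Local Notation b := frame_den.

Lemma frame_numE (L : fieldType) (phi : {rmorphism Pn -> L}) T T' :
  phi (a T T') = \det (map_mx phi M + (map_mx phi T^K)^T *m map_mx phi T'^K).
Proof. by rewrite /a -det_map_mx map_mxD map_mxM map_mxM map_trmx map_trmx. Qed.

Lemma frame_denE (L : fieldType) (phi : {rmorphism Pn -> L}) T :
  phi (b T) = \det (map_mx phi D *m (map_mx phi T^K)^T).
Proof. by rewrite /b -det_map_mx map_mxM -map_trmx. Qed.

Lemma point_ratio (L : fieldType) (phi : {rmorphism Pn -> L}) :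
  (forall x : L, exists a b, phi b != 0 /\ x = phi a / phi b) ->
  (forall v : 'rV[L]_n, v *m (map_mx phi D)^T = 0 ->
    forall p, phi p = 0 -> \sum_i phi p^`M(i) * v 0 i = 0) ->
  exists2 lam : L, lam != 0 & forall T T', phi (a T T') = lam * (phi (b T) * phi (b T')).
Proof.
move=> frac ker; have [fD rM MD DM] := point_ranks frac ker.
have [lam lam0 H] := det_kernel fD MD DM rM.
exists lam => // T T'; rewrite frame_numE !frame_denE H; congr (_ * (_ * _)).
by rewrite -det_tr trmx_mul trmxK.
Qed.

Lemma generic_point : exists (L : fieldType) (phi : {rmorphism Pn -> L}),
  [/\ injective phi, forall x : L, exists a b, phi b != 0 /\ x = phi a / phi b
   & forall v : 'rV[L]_n, v *m (map_mx phi D)^T = 0 ->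
    forall p, phi p = 0 -> \sum_i phi p^`M(i) * v 0 i = 0].
Proof.
have dom (x y : Pn) : x * y = 0 -> (x == 0) || (y == 0) by move/eqP; rewrite mulf_eq0.
have [L [phi [inj frac]]] := fraction_field_of_domain dom.
exists L, phi; split=> // [x y e|v _ p /inj ->].
  by apply/eqP; rewrite -subr_eq0; apply/eqP/inj; rewrite rmorphB e subrr.
by rewrite big1 // => i _; rewrite mderiv0 rmorph0 mul0r.
Qed.

Lemma exists_frame : exists T, b T != 0.
Proof.
have [L [phi [inj frac ker]]] := generic_point.
have [T hT] := exists_constant_frame frac ker; exists T.
by apply: contraNneq hT => h; rewrite -frame_denE h rmorph0.
Qed.

Lemma gradient_annihilates : M *m D^T = 0.
Proof.
have [L [phi [inj frac ker]]] := generic_point.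
have [_ _ MD _] := point_ranks frac ker.
apply/matrixP=> i j; apply: inj.
by move/matrixP/(_ i j): MD; rewrite map_trmx -map_mxM !mxE rmorph0.
Qed.

Definition ratio_pair (u v : Pn) := forall T T', v * a T T' = u * (b T * b T').

Lemma exists_ratio_pair : exists u v, [/\ u != 0, v != 0 & ratio_pair u v].
Proof.
have [L [phi [inj frac ker]]] := generic_point.
have [lam lam0 H] := point_ratio frac ker.
have [T0 b0] := exists_frame.
have phib : phi (b T0) != 0 by rewrite -(rmorph0 phi) (inj_eq inj).
exists (a T0 T0), (b T0 * b T0); split.
- by rewrite -(inj_eq inj) rmorph0 H !mulf_neq0.
- by rewrite mulf_neq0.
move=> T T'; apply: inj; rewrite !(rmorphM phi) !H.
by rewrite mulrCA mulrA.
Qed.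

Lemma act_gradient (s : 'M[K]_n) : (forall i, act s (F i) = F i) ->
  map_mx (act s) D *m s^K = D.
Proof.
move=> hF; apply/matrixP=> i j; rewrite mxE [D i j]mxE -[in RHS]hF.
have rd : rel_derivation (act s : {rmorphism Pn -> Pn}) (fun p => (act s p)^`M(j)).
  split=> [p q|p q|t]; first by rewrite actD mderivD.
    by rewrite actM mderivM.
  by rewrite actC mderivC.
rewrite (rel_derivationE rd); apply: eq_bigr => k _ /=; rewrite !mxE; congr (_ * _).
rewrite actX raddf_sum (bigD1 j) //= mderivZ mderivX mnm1E eqxx scale1r.
have -> : (U_(j) - U_(j))%MM = 0%MM :> 'X_{1..n} by apply/mnmP=> m; rewrite mnmBE subnn mnm0E.
rewrite mpolyX0 big1 ?addr0 -?mul_mpolyC ?mulr1 // => m /negPf mj.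
by rewrite mderivZ mderivX mnm1E mj scale0r scaler0.
Qed.

(** The group acts on M and D through congruence by s, which the transported frames absorb; only
    powers of det s = 1 are left. *)
Lemma act_frames x T T' : ad_nilpotent c x -> let s := expm (ad c x) in
  act s (a (T *m s^T) (T' *m s^T)) = a T T' /\ act s (b (T *m s^T)) = b T.
Proof.
move=> xn s; have su : s \in unitmx := expm_unit (eqP xn).
have sbr u v : br c (u *m s) (v *m s) = br c u v *m s by apply: expm_br.
have sdet : \det s = 1 := det_exp xn.
have actK p q (A : 'M[K]_(p, q)) : map_mx (act s) A^K = A^K by apply/matrixP=> i j; rewrite !mxE actC.
have dK : \det s^K = 1 :> Pn by rewrite det_map_mx sdet rmorph1.
split.
  rewrite /a -det_map_mx map_mxD actK act_lie_poisson //.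
  have -> : s^K *m M *m (s^K)^T + ((T *m s^T)^T *m (T' *m s^T))^K = s^K *m (M + (T^T *m T')^K) *m (s^K)^T.
    rewrite mulmxDr mulmxDl trmx_mul trmxK !map_mxM map_trmx !mulmxA //.
  by rewrite !det_mulmx det_tr dK mul1r mulr1.
rewrite /b -det_map_mx map_mxM -map_trmx actK map_mxM -map_trmx trmx_mul trmxK mulmxA.
by rewrite act_gradient // => i; apply: Finv.
Qed.

Section MinimalPair.
Variables u v : Pn.
Hypothesis Huv : ratio_pair u v.

Lemma ratio_invariant x : ad_nilpotent c x ->
  act (expm (ad c x)) u * v = u * act (expm (ad c x)) v.
Proof.
move=> xn; set s := expm (ad c x); have [T b0] := exists_frame.
have [ha hb] := act_frames T T xn; rewrite -/s in ha hb.
have := congr1 (act s) (Huv (T *m s^T) (T *m s^T)); rewrite !actM ha hb => h.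
have bb : b T * b T != 0 by rewrite mulf_neq0.
by apply: (mulIf bb); rewrite mulrAC -h -mulrA (mulrC (a T T)) Huv mulrCA mulrA.
Qed.

(** Invariance of u/v holds at every time of the flow, hence as an identity of polynomials in t;
    this is its derivative at t = 0. *)
Lemma ratio_deriv x : ad_nilpotent c x -> ad_deriv c x u * v = u * ad_deriv c x v.
Proof.
move=> xn; have e : flow c x u * v%:P = u%:P * flow c x v.
  apply: (horner_inj char0) => t.
  rewrite (hornerM (flow c x u)).
  rewrite (hornerM _ (flow c x v)).
  rewrite !hornerC.
  apply: (etrans (congr1 (fun w => w * v) (flowE c x t u))).
  apply: (etrans _ (esym (congr1 (fun w => u * w) (flowE c x t v)))).
  by apply: ratio_invariant; apply: nilpotentZ.
have d0 w : (flow c x w)^`().[0] = ad_deriv c x w.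
  exact: etrans (congr1 (fun p : {poly Pn} => p.[0]) (flow_deriv char0 xn w)) (flow0 c x _).
apply: etrans (congr1 (fun w => w * v) (esym (d0 u))) _.
apply: etrans (deriv0_cross e) (congr1 (fun w => u * w) (d0 v)).
Qed.

Lemma ad_derivM x p q : ad_deriv c x (p * q) = ad_deriv c x p * q + p * ad_deriv c x q.
Proof.
by have [_ h _] := @rel_derivation_pd n K Pn idfun (fun i => \sum_j ad c x i j *: 'X_j); apply: h.
Qed.

Lemma ad_derivXn x p k : ad_deriv c x (p ^+ k.+1) = k.+1%:R * (p ^+ k * ad_deriv c x p).
Proof.
elim: k => [|k IH]; first by rewrite expr1 expr0 mul1r mul1r.
by rewrite exprS ad_derivM IH mulrCA (mulrA p) -exprS [ad_deriv c x p * _]mulrC [k.+2%:R]mulrS mulrDl mul1r.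
Qed.

End MinimalPair.

(** Write u = P^(k+1) w and cancel P^k: then [P] divides (k+1) (ad_deriv P) w v, hence
    [ad_deriv c x P], since k+1 is a unit and [P] divides neither w nor [v]. So [P] is
    semi-invariant, and therefore invariant. *)
Lemma prime_factor_invariant u v P : u != 0 ->
  (forall x, ad_nilpotent c x -> ad_deriv c x u * v = u * ad_deriv c x v) ->
  rprime P -> rdvd P u -> ~ rdvd P v -> G_invariant c P.
Proof.
move=> u0 Huv pP Pu Pv x xn; have [P0 Pnu _] := pP.
have [k [w [ew Pw]]] := rprime_power pP u0.
case: k ew => [|k] ew; first by case: Pw; rewrite expr0 mul1r in ew; rewrite -ew.
have e := Huv x xn.
rewrite ew ad_derivM ad_derivXn in e.
have Pk0 : P ^+ k != 0 by rewrite expf_neq0.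
have : rdvd P (k.+1%:R * (ad_deriv c x P * (w * v))).
  exists (w * ad_deriv c x v - ad_deriv c x w * v); apply: (mulfI Pk0).
  have -> : P ^+ k * (P * (w * ad_deriv c x v - ad_deriv c x w * v)) =
     P ^+ k.+1 * w * ad_deriv c x v - P ^+ k.+1 * ad_deriv c x w * v by rewrite exprS; ring.
  by rewrite -e; ring.
case/(rprime_dvdM pP) => [|/(rprime_dvdM pP) [|/(rprime_dvdM pP) [//|//]]].
  move=> h; exfalso; apply: (rprime_unit pP _ h); apply/unitrPr; exists ((k.+1%:R)^-1)%:MP.
  by rewrite -mpolyC1 -mpolyCMn -mpolyCM divff // natr_neq0.
case=> q hq; apply: (semi_invariant_act char0 xn (b := q)).
by rewrite hq mulrC.
Qed.

(* No component of the zero set of an invariant [P] lies in the locus where the frames degenerate. *)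
Lemma no_prime_factor P : rprime P -> G_invariant c P ->
  exists T, ~ rdvd P (b T) /\ ~ rdvd P (a T T).
Proof.
move=> pP /Fgen [Q eP]; have [L [phi [kerP frac]]] := residue_field pP.
(* As [P] is a polynomial in the [F i], a vector annihilated by all dF_i is annihilated by dP, hence
   is tangent to the divisor. *)
have ker (w : 'rV[L]_n) : w *m (map_mx phi D)^T = 0 ->
    forall p, phi p = 0 -> \sum_i phi p^`M(i) * w 0 i = 0.
  move=> wD p /kerP [q ->].
  have phiP : phi P = 0 by apply/kerP/rdvd_refl.
  have rd i : rel_derivation (mmap (@mpolyC n K) F : {rmorphism {mpoly K[l]} -> Pn})
     (fun q => (msubst F q)^`M(i)).
    split=> [p1 q1|p1 q1|t]; first by rewrite /msubst rmorphD mderivD.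
      by rewrite /msubst rmorphM mderivM.
    by rewrite /msubst mmapC mderivC.
  under eq_bigr => i _.
    rewrite mderivM rmorphD !rmorphM phiP mul0r addr0 [in P^`M(i)]eP (rel_derivationE (rd i)).
    rewrite rmorph_sum !mulr_suml.
    under eq_bigr => j _ do rewrite /= {1}/msubst mmapX mmap1U rmorphM /=.
    over.
  rewrite exchange_big big1 // => j _ /=.
  have := congr1 (fun A : 'rV_l => A 0 j) wD; rewrite !mxE => h.
  rewrite -[RHS](mulr0 (phi (mmap (@mpolyC n K) F Q^`M(j)) * phi q)) -[in RHS]h mulr_sumr.
  by apply: eq_bigr => i _; rewrite !mxE; ring.
have [T hT] := exists_constant_frame frac ker.
have [lam lam0 H] := point_ratio frac ker.
exists T; rewrite -frame_denE in hT; split; move/kerP; first exact/eqP.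
by rewrite H; apply/eqP; rewrite !mulf_neq0.
Qed.

(* Kostant's identity: a nonconstant ratio would vanish or have a pole along an invariant prime divisor. *)
Theorem kostant_identity : exists2 k : K, k != 0 &
  forall T T', a T T' = k *: (b T * b T').
Proof.
have [u [v [u0 v0 Huv]]] := exists_ratio_pair.
(* A pair of least total size serves as the fraction in lowest terms: a common prime could be
   cancelled. *)
pose Pm m := exists u v, [/\ u != 0, v != 0, ratio_pair u v & m = (msize u + msize v)%N].
have [m [[{u0 v0 Huv}u [{}v [u0 v0 Huv em]]] mmin]] : exists m, Pm m /\ forall k, Pm k -> (m <= k)%N.
  by apply: classical_min; exists (msize u + msize v)%N, u, v.
have nocommon P : rprime P -> rdvd P u -> rdvd P v -> False.
  move=> pP [u' eu] [v' ev]; have [P0 _ _] := pP.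
  have u'0 : u' != 0 by apply: contraNneq u0 => h; rewrite eu h mulr0.
  have v'0 : v' != 0 by apply: contraNneq v0 => h; rewrite ev h mulr0.
  have : Pm (msize u' + msize v')%N.
    exists u', v'; split=> // T T'; apply: (mulfI P0); rewrite [LHS]mulrA [RHS]mulrA -ev -eu; exact: Huv.
  move/mmin; rewrite leqNgt em eu ev !msizeM // => /negP; apply.
  by have := msize_rprime pP; move: (msize P) (msize u') (msize v') => p1 p2 p3; lia.
(* The argument is the same for zeros and poles, so numerator and denominator are treated alike. *)
have small w w' : w != 0 -> w' != 0 -> (forall P, rprime P -> rdvd P w -> ~ rdvd P w') ->
    (forall P, rprime P -> rdvd P w -> ~ rdvd P w' -> G_invariant c P) ->
    (forall P T, rprime P -> rdvd P w -> ~ rdvd P (b T) -> ~ rdvd P (a T T) -> rdvd P w') ->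
    (msize w <= 1)%N.
  move=> w0 w'0 h1 h2 h3; rewrite leqNgt; apply/negP => /exists_rprime_dvd [P pP Pw].
  have nP := h1 P pP Pw; have [T [hb ha]] := no_prime_factor pP (h2 P pP Pw nP).
  by apply: nP; apply: (h3 P T).
have su : (msize u <= 1)%N.
  apply: (small u v u0 v0) => [P pP Pu Pv|P pP Pu Pv|P T pP Pu hb ha].
  - exact: nocommon Pu Pv.
  - exact: (prime_factor_invariant u0 (ratio_deriv Huv) pP Pu Pv).
  have : rdvd P (v * a T T) by rewrite Huv; apply: rdvd_mulr.
  by case/(rprime_dvdM pP).
have sv : (msize v <= 1)%N.
  apply: (small v u v0 u0) => [P pP Pv Pu|P pP Pv Pu|P T pP Pv hb ha].
  - exact: nocommon Pu Pv.
  - apply: (prime_factor_invariant v0 _ pP Pv Pu) => x xn.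
    by rewrite mulrC -(ratio_deriv Huv xn) mulrC.
  have : rdvd P (u * (b T * b T)) by rewrite -Huv; apply: rdvd_mulr.
  by case/(rprime_dvdM pP) => // /(rprime_dvdM pP) [].
rewrite (msize1_polyC su) in u0 Huv; rewrite (msize1_polyC sv) in v0 Huv.
rewrite !mpolyC_eq0 in u0 v0.
exists (u@_0%MM / v@_0%MM); first by rewrite mulf_neq0 // invr_neq0.
move=> T T'; have := Huv T T'; rewrite !mul_mpolyC => h.
by rewrite mulrC -scalerA -h scalerA mulVf // scale1r.
Qed.

End KostantIdentity.

(** * sl2-triples *)

Section SpectrumRoots.
Variable (K : closedFieldType).
Hypothesis char0 : [pchar K] =i pred0.

(** Choose [s] vanishing at all values other than z_i0: what remains is the multiplicity of z_i0,
    nonzero in characteristic 0, times q(z_i0) s(z_i0). *)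
Lemma power_sum_root n (z : 'I_n -> K) (q : {poly K}) :
  (forall s, \sum_i (q * s).[z i] = 0) -> forall i, q.[z i] = 0.
Proof.
move=> h i0; set s := \prod_(i | z i != z i0) ('X - (z i)%:P).
have s0 : s.[z i0] != 0.
  rewrite /s horner_prod; apply/prodf_neq0 => i hi.
  by rewrite hornerXsubC subr_eq0 eq_sym.
have := h s; rewrite (bigID (fun i => z i == z i0)) /= [X in _ + X]big1 ?addr0; last first.
  by move=> i hi; rewrite hornerM /s horner_prod (bigD1 i) //= hornerXsubC subrr mul0r mulr0.
rewrite (eq_bigr (fun _ => (q * s).[z i0])); last by move=> i /eqP ->.
rewrite sumr_const hornerM -mulr_natl => /eqP; rewrite !mulf_eq0 (negPf s0) orbF.
have : (#|[pred i | z i == z i0]| != 0)%N by rewrite -lt0n; apply/card_gt0P; exists i0; rewrite inE.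
by move/(natr_neq0 char0)/negPf => -> /= /eqP.
Qed.

Lemma spectrum_annihilator n (N : 'M[K]_n) (z : 'I_n -> K) q :
  (forall p, \tr (mxp N p) = \sum_i p.[z i]) -> mxp N q = 0 -> forall i, q.[z i] = 0.
Proof. by move=> htr hq; apply: power_sum_root => s; rewrite -htr mxpM hq mul0mx mxtrace0. Qed.

End SpectrumRoots.

(** A nonzero multiple of each positive power of [F] is a commutator with [H]; so all these traces
    vanish, and with them the eigenvalues of [F]. *)
Lemma commutator_nilpotent (K : closedFieldType) n (F H : 'M[K]_n) a : [pchar K] =i pred0 ->
  a != 0 -> F *m H - H *m F = a *: F -> F ^+ n = 0.
Proof.
move=> char0 a0 HFH.
have FkH k : F ^+ k *m H - H *m F ^+ k = (k%:R * a) *: F ^+ k.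
  elim: k => [|k IH]; first by rewrite expr0 mulmx1 mul1mx mul0r scale0r subrr.
  have -> : F ^+ k.+1 *m H - H *m F ^+ k.+1 =
      F *m (F ^+ k *m H - H *m F ^+ k) + (F *m H - H *m F) *m F ^+ k.
    by rewrite exprS -mulmxE mulmxBr mulmxBl !mulmxA addrA subrK.
  rewrite IH HFH -scalemxAr -scalemxAl mulmxE -exprS -scalerDl.
  by rewrite -[k.+1]addn1 natrD mulrDl mul1r.
have trF k : \tr (F ^+ k.+1) = 0.
  have := congr1 mxtrace (FkH k.+1); rewrite raddfB /= mxtrace_mulC subrr mxtraceZ.
  by move/eqP; rewrite eq_sym !mulf_eq0 (negPf (natr_neq0 char0 _)) // (negPf a0) => /eqP.
have [z [hz htr]] := mx_spectrum F.
have z0 i : z i = 0.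
  rewrite -[z i]hornerX; apply: (power_sum_root char0) => s.
  rewrite -htr mxpM mxpX mulmx_sumr raddf_sum big1 //= => j _.
  by rewrite -scalemxAr mxtraceZ mulmxE -exprS trF mulr0.
rewrite -[F](mxpX F) -mxpXn -hz; congr mxp; rewrite -[n in LHS]card_ord -prodr_const.
by apply: eq_bigr => i _; rewrite z0 subr0.
Qed.

Section Sl2Power.
Variables (K : fieldType) (n : nat) (E F H : 'M[K]_n).
Hypothesis HFE : F *m E - E *m F = H.
Hypothesis HFH : F *m H - H *m F = - (2%:R *: F).

Lemma sl2_FpowE k : F ^+ k.+1 *m E = E *m F ^+ k.+1 + k.+1%:R *: ((H - k%:R%:M) *m F ^+ k).
Proof.
have FE : F *m E = E *m F + H by rewrite -HFE addrC subrK.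
have FH a : F *m (H - a%:M) = (H - (a + 2%:R)%:M) *m F.
  have FH0 : F *m H = H *m F - 2%:R *: F by rewrite -HFH addrC subrK.
  rewrite mulmxBr mulmxBl mul_mx_scalar mul_scalar_mx FH0 (scalerDl F a) opprD -addrA.
  by congr (_ + _); rewrite addrC.
elim: k => [|k IH]; first by rewrite expr1 expr0 mulmx1 raddf0 subr0 scale1r.
have e1 : F *m (E *m F ^+ k.+1) = E *m F ^+ k.+2 + H *m F ^+ k.+1.
  by rewrite mulmxA FE mulmxDl -mulmxA mulmxE -exprS.
have e2 : F *m ((H - k%:R%:M) *m F ^+ k) = (H - (k%:R + 2%:R)%:M) *m F ^+ k.+1.
  by rewrite mulmxA FH -mulmxA mulmxE -exprS.
rewrite exprS -mulmxE -mulmxA IH mulmxDr e1 -scalemxAr e2 -addrA; congr (_ + _).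
rewrite !mulmxBl !mul_scalar_mx !scalerBr !scalerA.
have -> : (k.+2)%:R = 1 + k.+1%:R :> K by rewrite mulrS.
rewrite scalerDl scale1r -addrA; congr (_ + (_ - _)); congr (_ *: _).
by rewrite -natrD -!natrM -mulrS -natrM; congr (_%:R); lia.
Qed.

End Sl2Power.

(** * Weights of a representation of sl2 on row vectors *)

Section Sl2Matrices.
Variable (K : closedFieldType).
Hypothesis char0 : [pchar K] =i pred0.
Variables (n : nat) (E F H : 'M[K]_n).
Hypothesis HFE : F *m E - E *m F = H.
Hypothesis HEH : E *m H - H *m E = 2%:R *: E.
Hypothesis HFH : F *m H - H *m F = - (2%:R *: F).

Lemma sl2_nilpotent_F : F ^+ n = 0.
Proof.
apply: (@commutator_nilpotent _ _ F H (- 2%:R)) => //; last by rewrite scaleNr.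
by rewrite oppr_eq0 natr_neq0.
Qed.

Lemma sl2_nilpotent_E : E ^+ n = 0.
Proof. by apply: (@commutator_nilpotent _ _ E H 2%:R) => //; rewrite natr_neq0. Qed.

Lemma sl2_E_shift (a : K) : E *m (H - a%:M) = (H - (a - 2%:R)%:M) *m E.
Proof.
have EH : E *m H = H *m E + 2%:R *: E by rewrite -HEH addrC subrK.
rewrite mulmxBr mulmxBl mul_mx_scalar mul_scalar_mx EH (scalerBl a) opprB -addrA.
by congr (_ + _).
Qed.

Lemma mxp_XsubC (a : K) : mxp H ('X - a%:P) = H - a%:M.
Proof. by rewrite mxpD mxpX -polyCN mxpC raddfN. Qed.

Lemma sl2_E_shift_prod (s : seq K) :
  E *m mxp H (\prod_(a <- s) ('X - a%:P)) = mxp H (\prod_(a <- s) ('X - (a - 2%:R)%:P)) *m E.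
Proof.
elim: s => [|a s IH]; first by rewrite !big_nil !mxp1 mulmx1 mul1mx.
rewrite !big_cons !mxpM mulmxA mxp_XsubC sl2_E_shift -mulmxA IH mulmxA.
by rewrite mxp_XsubC.
Qed.

(** The weights of a highest weight vector are natural numbers. Applying [E] to v F^(k+1) = 0 shows
    that v (H - k) is again a highest weight vector, killed by F^k. *)
Lemma sl2_highest_weight (v : 'rV_n) k : v *m E = 0 -> v *m F ^+ k = 0 ->
  v *m mxp H (\prod_(j < k) ('X - (j%:R)%:P)) = 0.
Proof.
elim: k v => [|k IH] v vE; first by rewrite expr0 mulmx1 => ->; rewrite mul0mx.
move=> vF; rewrite big_ord_recr /= mulrC mxpM mulmxA mxp_XsubC; apply: IH.
  have := sl2_E_shift (k%:R + 2%:R); rewrite addrK => h.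
  by rewrite -mulmxA -h mulmxA vE mul0mx.
have := congr1 (mulmx v) (sl2_FpowE HFE HFH k).
rewrite mulmxDr !mulmxA vF vE !mul0mx add0r -scalemxAr => /esym/eqP.
by rewrite scaler_eq0 (negPf (natr_neq0 char0 _)) //= mulmxA => /eqP.
Qed.

Lemma sl2_integral_weights : exists s : seq int,
  mxp H (\prod_(a <- s) ('X - (a%:~R)%:P)) = 0.
Proof.
suff main j : exists s : seq int, forall v : 'rV_n, v *m E ^+ j = 0 ->
    v *m mxp H (\prod_(a <- s) ('X - (a%:~R)%:P)) = 0.
  have [s hs] := main n; exists s; apply/row_matrixP => i; rewrite row0 rowE; apply: hs.
  by rewrite sl2_nilpotent_E mulmx0.
elim: j => [|j [s IH]]; first by exists [::] => v; rewrite expr0 mulmx1 => ->; rewrite mul0mx.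
(* v E^j is a highest weight vector, with weights among 0, ..., n - 1; moving E^j across the product
   shifts them by -2j and leaves a vector killed by E^j. *)
exists ([seq a - (2 * j)%:Z | a <- [seq k%:Z | k <- iota 0 n]] ++ s) => v vE.
have hE : v *m E ^+ j *m mxp H (\prod_(a <- [seq k%:Z | k <- iota 0 n]) ('X - (a%:~R)%:P)) = 0.
  have -> : \prod_(a <- [seq k%:Z | k <- iota 0 n]) ('X - (a%:~R)%:P) = \prod_(k < n) ('X - (k%:R)%:P) :> {poly K}.
    by rewrite big_map -(big_mkord xpredT (fun k => 'X - (k%:R)%:P)) /index_iota subn0.
  by apply: sl2_highest_weight; [rewrite -mulmxA mulmxE -exprSr|rewrite sl2_nilpotent_F mulmx0].
have shift i (t : seq int) : E ^+ i *m mxp H (\prod_(a <- t) ('X - (a%:~R)%:P)) =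
   mxp H (\prod_(a <- [seq a - (2 * i)%:Z | a <- t]) ('X - (a%:~R)%:P)) *m E ^+ i.
  elim: i t => [|i IHi] t.
    by rewrite expr0 mulmx1 mul1mx muln0 big_map; under [in RHS]eq_bigr do rewrite subr0.
  rewrite exprSr -mulmxE -mulmxA -(big_map (fun a : int => a%:~R) xpredT (fun a => 'X - a%:P)).
  rewrite sl2_E_shift_prod big_map mulmxA.
  have := IHi [seq a - 2 | a <- t]; rewrite !big_map.
  under eq_bigr do rewrite intrB.
  move=> ->; rewrite -mulmxA; congr (mxp H _ *m _); apply: eq_bigr => a _.
  by congr ('X - (_%:~R)%:P); lia.
move: hE; rewrite -mulmxA shift mulmxA => hE.
by rewrite big_cat mxpM mulmxA; apply: IH.
Qed.

Lemma sl2_F_shift_prod (s : seq K) :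
  mxp H (\prod_(a <- s) ('X - a%:P)) *m F = F *m mxp H (\prod_(a <- s) ('X - (a - 2%:R)%:P)).
Proof.
have HF (a : K) : (H - a%:M) *m F = F *m (H - (a - 2%:R)%:M).
  have e : H *m F = F *m H + 2%:R *: F by rewrite -[2%:R *: F]opprK -HFH opprB addrC subrK.
  rewrite mulmxBr mulmxBl mul_mx_scalar mul_scalar_mx e (scalerBl a) opprB -addrA.
  by congr (_ + _).
elim: s => [|a s IH]; first by rewrite !big_nil !mxp1 mulmx1 mul1mx.
by rewrite !big_cons !mxpM -mulmxA IH mulmxA mxp_XsubC HF -mulmxA mxp_XsubC.
Qed.

(** The mirror image of [sl2_highest_weight]: under v F E = 0 the weights of [v] are at most 0. *)
Lemma sl2_FE_weight (v : 'rV_n) k : v *m (F *m E) = 0 -> v *m E ^+ k = 0 ->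
  v *m mxp H (\prod_(j < k) ('X - (- j%:R)%:P)) = 0.
Proof.
have dual m : E ^+ m.+1 *m F = F *m E ^+ m.+1 - m.+1%:R *: ((H + m%:R%:M) *m E ^+ m).
  rewrite (@sl2_FpowE K n F E (- H)); last 2 first.
  - by rewrite -HFE opprB.
  - by rewrite mulmxN mulNmx -HEH opprB opprK addrC.
  by rewrite -opprD mulNmx scalerN.
have cFE : F *m E *m H = H *m (F *m E).
  have e1 : E *m H = H *m E + 2%:R *: E by rewrite -HEH addrC subrK.
  have e2 : F *m H = H *m F - 2%:R *: F by rewrite -HFH addrC subrK.
  by rewrite -mulmxA e1 mulmxDr mulmxA e2 mulmxBl -scalemxAr -scalemxAl subrK -mulmxA.
elim: k v => [|k IH] v vFE; first by rewrite expr0 mulmx1 => ->; rewrite mul0mx.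
move=> vE; rewrite big_ord_recr /= mulrC mxpM mulmxA mxp_XsubC; apply: IH.
  rewrite -mulmxA mulmxBl mul_scalar_mx -cFE mulmxBr -scalemxAr [v *m (_ *m _ *m H)]mulmxA vFE.
  by rewrite mul0mx scaler0 subr0.
have := congr1 (mulmx v) (dual k).
rewrite mulmxBr mulmxA vE mul0mx [v *m (F *m _)]mulmxA exprS -mulmxE.
rewrite -!mulmxA [F *m (E *m _)]mulmxA [v *m (F *m E *m _)]mulmxA vFE mul0mx sub0r.
rewrite -scalemxAr => /esym/eqP; rewrite oppr_eq0.
have -> : H + k%:R%:M = H - (- k%:R)%:M by apply: esym; rewrite (raddfN (@scalar_mx K n)) opprK.
by rewrite scaler_eq0 (negPf (natr_neq0 char0 _)) //= => /eqP.
Qed.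

(** The vector v F is a highest weight vector, with weights at least 0, but [v] has weights at most
    0, so v F has weights at most -2. Its two annihilators in H are coprime. *)
Lemma sl2_ker_im (v : 'rV_n) : v *m F *m E = 0 -> v *m F = 0.
Proof.
rewrite -mulmxA => vFE; set u := v *m F.
have uE : u *m E = 0 by rewrite -mulmxA.
have u1 := sl2_highest_weight uE (etrans (congr1 (mulmx u) sl2_nilpotent_F) (mulmx0 _ u)).
have v2 := sl2_FE_weight vFE (etrans (congr1 (mulmx v) sl2_nilpotent_E) (mulmx0 _ v)).
have u2 : u *m mxp H (\prod_(j < n) ('X - (- j%:R - 2%:R)%:P)) = 0.
  have := sl2_F_shift_prod [seq - (j%:R : K) | j <- index_iota 0 n].
  rewrite !big_map !(big_mkord xpredT) => h.
  by rewrite -mulmxA -h mulmxA v2 mul0mx.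
set p1 := \prod_(j < n) _ in u1; set p2 := \prod_(j < n) _ in u2.
have cop : coprimep p1 p2.
  rewrite /p1; apply: (big_ind (fun p => coprimep p p2)) => [|p q hp hq|j _].
  - exact: coprime1p.
  - by rewrite coprimepMl hp.
  rewrite /p2; apply: (big_ind (fun p => coprimep _ p)) => [|p q hp hq|k _].
  - exact: coprimep1.
  - by rewrite coprimepMr hp.
  rewrite coprimep_XsubC root_XsubC; apply/eqP => h.
  have jk : (j + k + 2 != 0)%N by rewrite addnC.
  have := natr_neq0 char0 jk; rewrite !natrD -addrA; move: h => /eqP; rewrite eq_sym => /eqP ->.
  by rewrite -opprD addNr eqxx.
case/Bezout_eq1_coprimepP: cop => [[a b] /= hab].
rewrite -[u]mulmx1 -(mxp1 H) -hab mxpD mulmxDr (mulrC a) (mulrC b) !mxpM !mulmxA u1 u2 !mul0mx.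
by rewrite addr0.
Qed.

(** The trace is a sum of squares of integers. If it vanishes, all weights are 0 and [H] is
    nilpotent, although [e] has weight 2. *)
Lemma sl2_trace_HH (e : 'rV_n) : e *m H = 2%:R *: e -> e != 0 -> \tr (H *m H) != 0.
Proof.
move=> eH e0; apply/eqP => tr0.
have [s hs] := sl2_integral_weights; have [z [hz htr]] := mx_spectrum H.
have zint i : exists a : int, z i = a%:~R.
  have := spectrum_annihilator char0 htr hs i; rewrite horner_prod => /eqP.
  rewrite prodf_seq_eq0 => /hasP [a _ /=]; rewrite hornerXsubC subr_eq0 => /eqP ->.
  by exists a.
have [m hm] := choice _ zint.
have : (\sum_i m i ^+ 2)%:~R = 0 :> K.
  rewrite rmorph_sum -[RHS]tr0.
  have -> : \tr (H *m H) = \tr (mxp H ('X * 'X)) by rewrite mxpM mxpX.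
  rewrite htr; apply: eq_bigr => i _ /=.
  by rewrite hornerM hornerX hm rmorphXn expr2.
move=> h; have : \sum_i m i ^+ 2 = 0 by apply/eqP/negPn/negP => /(intr_neq0 char0); rewrite h eqxx.
move/eqP; rewrite psumr_eq0 => [/allP m0|i _]; last exact: sqr_ge0.
have z0 i : z i = 0.
  by have := m0 i (mem_index_enum _); rewrite sqrf_eq0 => /eqP mi; rewrite hm mi.
have Hn : H ^+ n = 0.
  rewrite -[H](mxpX H) -mxpXn -hz; congr mxp; rewrite -[n in LHS]card_ord -prodr_const.
  by apply: eq_bigr => i _; rewrite z0 subr0.
have eHk k : e *m H ^+ k = (2%:R ^+ k) *: e.
  elim: k => [|k IH]; first by rewrite !expr0 mulmx1 scale1r.
  by rewrite exprSr -mulmxE mulmxA IH -scalemxAl eH scalerA -exprSr.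
have := eHk n; rewrite Hn mulmx0 => /esym/eqP.
by rewrite scaler_eq0 (negPf e0) orbF expf_eq0 (negPf (natr_neq0 char0 _)) // andbF.
Qed.

End Sl2Matrices.

Section Sl2Triple.
Variables (K : closedFieldType).
Hypothesis char0 : [pchar K] =i pred0.
Variables (n : nat) (c : 'I_n -> 'I_n -> 'rV[K]_n).
Hypothesis Hlie : is_lie c.
Variables (e h f : 'rV[K]_n).
Hypothesis He0 : e != 0.
Hypothesis Htriple : sl2_triple c e h f.
Local Notation ad := (ad c).

Lemma triple_FE : ad f *m ad e - ad e *m ad f = ad h.
Proof. by case: Htriple => _ [_ <-]; rewrite ad_br. Qed.
Lemma triple_EH : ad e *m ad h - ad h *m ad e = 2%:R *: ad e.
Proof. by case: Htriple => e1 _; rewrite -ad_br // e1 adZ. Qed.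
Lemma triple_FH : ad f *m ad h - ad h *m ad f = - (2%:R *: ad f).
Proof. by case: Htriple => _ [e1 _]; rewrite -ad_br // e1 adN adZ. Qed.

(** By invariance (h, h) = 2 (e, f) for the Killing form. This legitimates the division in
    [nform]. *)
Lemma killing_ef_neq0 : killing c e f != 0.
Proof.
have hh : \tr (ad h *m ad h) = 2%:R * killing c e f.
  case: Htriple => _ [e2 e3]; rewrite -[LHS]/(killing c h h) -{1}e3 killing_inv //.
  by rewrite (brC Hlie) e2 opprK killingZr.
have eH : e *m ad h = 2%:R *: e by case: Htriple => e1 _; rewrite mul_ad.
have := sl2_trace_HH char0 triple_FE triple_EH triple_FH eH He0.
by rewrite hh mulf_eq0 negb_or => /andP [].
Qed.

Lemma ker_e_im_f (v : 'rV_n) : v *m ad f *m ad e = 0 -> v *m ad f = 0.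
Proof. exact: (sl2_ker_im char0 triple_FE triple_EH triple_FH). Qed.

End Sl2Triple.

Lemma mnm_neq0 n (m : 'X_{1..n}) : m != 0%MM -> exists i, (m i != 0)%N.
Proof.
move=> m0; apply: NNPP => hn; case/negP: m0; apply/eqP/mnmP => i; rewrite mnm0E.
by apply/eqP/negPn/negP => hi; apply: hn; exists i.
Qed.

Lemma mderiv_linear_form (K : fieldType) r (w : 'I_r -> K) a :
  (\sum_j w j *: 'X_j)^`M(a) = (w a)%:MP_[r].
Proof.
rewrite raddf_sum (bigD1 a) //= big1 ?addr0 => [|j /negPf ja].
  rewrite mderivZ mderivX mnm1E eqxx scale1r.
  have -> : (U_(a) - U_(a))%MM = 0%MM :> 'X_{1..r} by apply/mnmP=> m; rewrite mnmBE subnn mnm0E.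
  by rewrite mpolyX0 -mul_mpolyC mulr1.
by rewrite mderivZ mderivX mnm1E ja scale0r scaler0.
Qed.

(** * The Jacobian criterion *)

Section Counting.
Variable K : fieldType.

Lemma msize_prod_exp r m (G : 'I_m -> {mpoly K[r]}) D (u : 'I_m -> nat) :
  (forall i, (msize (G i) <= D.+1)%N) ->
  (msize (\prod_i G i ^+ u i) <= (\sum_i u i * D).+1)%N.
Proof.
have mul (p q : {mpoly K[r]}) a b : (msize p <= a.+1)%N -> (msize q <= b.+1)%N -> (msize (p * q) <= (a + b).+1)%N.
  move=> hp hq; have [->|p0] := eqVneq p 0; first by rewrite mul0r msize0.
  have [->|q0] := eqVneq q 0; first by rewrite mulr0 msize0.
  by rewrite msizeM //; clear -hp hq; move: (msize p) (msize q) hp hq; lia.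
move=> hG; apply: (big_ind2 (fun (p : {mpoly K[r]}) k => (msize p <= k.+1)%N)) => [|p a q b|i _].
- by rewrite msize1.
- exact: mul.
elim: (u i) => [|k IH]; first by rewrite expr0 msize1.
by rewrite exprS mulSn; apply: mul.
Qed.

(** Dimension count: if m > r, there are more monomials in [G] with exponents below N than monomials
    in r variables that can occur in them, so some combination vanishes. *)
Lemma alg_indep_leq r m (G : 'I_m -> {mpoly K[r]}) : alg_indep G -> (m <= r)%N.
Proof.
move=> hG; rewrite leqNgt; apply/negP => rm.
pose D := (\sum_i msize (G i))%N.
have hD i : (msize (G i) <= D.+1)%N.
  by apply: leqW; rewrite /D (bigD1 i) //= leq_addr.
(* Exponents below N yield degrees below B, and N exceeds (mD + 1)^r, so B^r = N^r (mD + 1)^r <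
   N^(r+1) <= N^m. *)
pose N := ((m * D).+1 ^ r).+1; pose B := (N * (m * D).+1)%N.
pose mn k (w : {ffun 'I_k -> 'I_N}) := [multinom (w i : nat) | i < k].
pose mnB (w : {ffun 'I_r -> 'I_B}) := [multinom (w i : nat) | i < r].
pose A : 'M[K]_(#|{: {ffun 'I_m -> 'I_N}}|, #|{: {ffun 'I_r -> 'I_B}}|) :=
  \matrix_(i, j) (msubst G 'X_[mn m (enum_val i)])@_(mnB (enum_val j)).
have cards : (#|{: {ffun 'I_r -> 'I_B}}| < #|{: {ffun 'I_m -> 'I_N}}|)%N.
  rewrite !card_ffun !card_ord /B expnMn.
  apply: (@leq_trans (N ^ r * N)%N); first by rewrite ltn_pmul2l ?expn_gt0.
  by rewrite -expnSr leq_pexp2l.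
have : kermx A != 0.
  rewrite -mxrank_eq0 mxrank_ker -lt0n subn_gt0.
  by apply: leq_ltn_trans cards; apply: rank_leq_col.
case/rowV0Pn => w /sub_kermxP wA w0.
pose Q : {mpoly K[m]} := \sum_i w 0 i *: 'X_[mn m (enum_val i)].
suff Q0 : Q = 0.
  case/negP: w0; apply/eqP/rowP => i; rewrite mxE.
  have := congr1 (fun p => p@_(mn m (enum_val i))) Q0.
  rewrite mcoeff0 /Q raddf_sum (bigD1 i) //= mcoeffZ mcoeffX eqxx mulr1 big1 ?addr0 // => j ji.
  rewrite mcoeffZ mcoeffX; case: eqP => [e|]; last by rewrite mulr0.
  case/negP: ji; apply/eqP/enum_val_inj/ffunP => k; apply/val_inj.
  by have := congr1 (fun mm : 'X_{1..m} => mm k) e; rewrite !mnmE.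
apply: hG; apply/mpolyP => v; rewrite mcoeff0.
have [hv|] := boolP [forall i, (v i < B)%N].
  pose wv : {ffun 'I_r -> 'I_B} := [ffun i => Ordinal (forallP hv i)].
  have ev : v = mnB wv by apply/mnmP => i; rewrite mnmE ffunE.
  have := congr1 (fun M : 'rV_ _ => M 0 (enum_rank wv)) wA; rewrite !mxE => h.
  rewrite /Q /msubst rmorph_sum raddf_sum -[RHS]h; apply: eq_bigr => i _ /=.
  by rewrite mmapZ mul_mpolyC mcoeffZ mxE enum_rankK -ev.
rewrite negb_forall => /existsP [i0]; rewrite -leqNgt => hi0.
rewrite /Q /msubst rmorph_sum raddf_sum big1 // => i _ /=.
rewrite mmapZ mul_mpolyC mcoeffZ mmapX; apply/eqP; rewrite mulf_eq0; apply/orP; right.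
rewrite mcoeff_eq0; apply: msize_mdeg_ge.
apply: leq_trans (msize_prod_exp _ hD) _.
apply: (@leq_trans (v i0)); last by rewrite mdegE (bigD1 i0) //= leq_addr.
apply: leq_trans hi0; rewrite /B.
apply: (@leq_trans (\sum_(j < m) N.-1 * D).+1).
  by rewrite ltnS; apply: leq_sum => j _; rewrite leq_mul2r mnmE -ltnS [N.-1.+1]prednK // ltn_ord orbT.
rewrite sum_nat_const card_ord /N /=.
by move: (_ ^ r)%N => a; nia.
Qed.

End Counting.

Section Jacobian.
Variable K : closedFieldType.
Hypothesis char0 : [pchar K] =i pred0.

Lemma mderiv0_const n (p : {mpoly K[n]}) : (forall i, p^`M(i) = 0) -> p = (p@_0)%:MP.
Proof.
move=> h; apply/mpolyP => m; rewrite mcoeffC.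
have [->|m0] := eqVneq m 0%MM; first by rewrite mulr1.
have [i hi] := mnm_neq0 m0.
have em : m = (m - U_(i) + U_(i))%MM.
  by apply/mnmP => j; rewrite mnmDE mnmBE mnm1E; case: eqP => [<-|_]; rewrite ?subnK ?lt0n // subn0 addn0.
rewrite mulr0 em; have := mcoeff_mderiv i p (m - U_(i)); rewrite h mcoeff0 -mulr_natr => /esym/eqP.
by rewrite mulf_eq0 (negPf (natr_neq0 char0 _)) // orbF => /eqP.
Qed.

Lemma msize_mderiv n (p : {mpoly K[n]}) i k : (msize p <= k.+1)%N -> (msize p^`M(i) <= k)%N.
Proof.
move=> h; rewrite msizeE; apply/bigmax_leqP_seq => m; rewrite mcoeff_msupp mcoeff_mderiv => h0 _.
have : (m + U_(i))%MM \in msupp p.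
  by rewrite mcoeff_msupp; apply: contraNneq h0 => ->; rewrite mul0rn.
by move/msize_mdeg_lt; rewrite mdegD mdeg1 addn1 => h1; rewrite -ltnS (leq_trans h1).
Qed.

Variable r : nat.
Local Notation Pr := {mpoly K[r]}.

Lemma mderiv_msubst m (G : 'I_m -> Pr) Q a :
  (msubst G Q)^`M(a) = \sum_j msubst G Q^`M(j) * (G j)^`M(a).
Proof.
have rd : rel_derivation (mmap (@mpolyC r K) G : {rmorphism {mpoly K[m]} -> Pr})
    (fun q => (msubst G q)^`M(a)).
  split=> [p1 q1|p1 q1|t]; first by rewrite /msubst rmorphD mderivD.
    by rewrite /msubst rmorphM mderivM.
  by rewrite /msubst mmapC mderivC.
rewrite (rel_derivationE rd); apply: eq_bigr => j _ /=.
by rewrite /msubst mmapX mmap1U.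
Qed.

Lemma map_gradient m (P : 'I_m -> Pr) (gamma : 'rV[K]_r) :
  map_mx (meval (fun b => gamma 0 b)) (gradient_mx P) = diff_mx P gamma.
Proof. by apply/matrixP => i j; rewrite !mxE. Qed.

Lemma row_free_frame m (A : 'M[K]_(m, r)) : row_free A -> exists T : 'M_(m, r), \det (A *m T^T) != 0.
Proof.
case/row_freeP => B AB; exists B^T; by rewrite trmxK AB det1 oner_eq0.
Qed.

Lemma frame_row_free m (A T : 'M[K]_(m, r)) : \det (A *m T^T) != 0 -> row_free A.
Proof.
rewrite -unitfE -unitmxE => h; apply/row_freeP; exists (T^T *m invmx (A *m T^T)).
by rewrite mulmxA mulmxV.
Qed.

(** Differentiating a relation Q gives a linear relation between the gradients, which is trivial. So
    the partial derivatives of Q are relations of smaller size; by induction they vanish and Q is a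
    constant. *)
Lemma jacobian_indep m (P : 'I_m -> Pr) gamma : row_free (diff_mx P gamma) -> alg_indep P.
Proof.
move=> fD; have [T hT] := row_free_frame fD.
pose A := gradient_mx P *m (map_mx (@mpolyC r K) T)^T.
have dA : \det A != 0.
  apply: contraNneq hT => h; have := congr1 (meval (fun b => gamma 0 b)) h.
  rewrite -det_map_mx map_mxM map_gradient meval0 -map_trmx => <-; apply/eqP; congr (\det (_ *m _)).
  by apply/matrixP => i j; rewrite !mxE /= mevalC.
have indep (q : 'rV[Pr]_m) : q *m gradient_mx P = 0 -> q = 0.
  move=> hq; have qA : q *m A = 0 by rewrite /A mulmxA hq mul0mx.
  have : q *m (A *m \adj A) = 0 by rewrite mulmxA qA mul0mx.
  by rewrite mul_mx_adj mul_mx_scalar => /eqP; rewrite scalemx_eq0 (negPf dA) => /eqP.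
suff main k Q : (msize Q <= k)%N -> msubst P Q = 0 -> Q = 0 by move=> Q; apply: (main (msize Q)).
elim: k Q => [|k IH] Q; first by rewrite leqn0 msize_poly_eq0 => /eqP.
move=> sQ hQ; have Q' j : Q^`M(j) = 0.
  apply: IH; first exact: msize_mderiv.
  suff /rowP /(_ j) : \row_j msubst P Q^`M(j) = 0 :> 'rV_m by rewrite !mxE.
  apply: indep; apply/rowP => a; rewrite !mxE.
  rewrite -[RHS](mderiv0 K a) -[in RHS]hQ mderiv_msubst.
  by apply: eq_bigr => i _; rewrite !mxE.
rewrite (mderiv0_const Q') in hQ *; move: hQ; rewrite /msubst mmapC => /eqP.
by rewrite mpolyC_eq0 => /eqP ->.
Qed.

Definition adjoin m (G : 'I_m -> Pr) (x : Pr) (i : 'I_m.+1) : Pr :=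
  if unlift ord_max i is Some j then G j else x.

Lemma msubst_adjoin m (G : 'I_m -> Pr) x p :
  msubst (adjoin G x) p = (map_poly (mmap (@mpolyC r K) G) (muni p)).[x].
Proof.
elim/mpoly_alg_ind: p => [a|i|p q hp hq|p q hp hq].
- by rewrite /msubst mmapC muniC map_polyC /= hornerC mmapC.
- rewrite /msubst mmapX mmap1U /adjoin; case: unliftP => [j|] ->.
    have -> : lift ord_max j = widen_ord (leqnSn m) j by apply/val_inj; rewrite /= /bump leqNgt ltn_ord.
    by rewrite muni_widen map_polyC /= hornerC mmapX mmap1U.
  by rewrite muni_max map_polyX hornerX.
- rewrite /msubst in hp hq *; by rewrite rmorphD /= hp hq muniD rmorphD hornerD.
- rewrite /msubst in hp hq *; by rewrite rmorphM /= hp hq muniM rmorphM hornerM.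
Qed.

Lemma mderiv_horner m (G : 'I_m -> Pr) x (q : {poly {mpoly K[m]}}) :
  exists w : 'I_m -> Pr, forall a,
   ((map_poly (mmap (@mpolyC r K) G) q).[x])^`M(a) =
   (map_poly (mmap (@mpolyC r K) G) q^`()).[x] * x^`M(a) + \sum_i w i * (G i)^`M(a).
Proof.
elim/poly_ind: q => [|q c [w IH]].
  exists (fun _ => 0) => a; rewrite deriv0 !rmorph0 !horner0 mderiv0 mul0r add0r big1 // => i _.
  by rewrite mul0r.
exists (fun i => w i * x + msubst G c^`M(i)) => a.
rewrite derivD derivM derivX derivC addr0 mulr1 !rmorphD !rmorphM /= map_polyX map_polyC /=.
rewrite !hornerE mderivD mderivM IH -[mmap _ _ c]/(msubst G c) mderiv_msubst.
under [in RHS]eq_bigr do rewrite mulrDl mulrAC.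
rewrite big_split /= -mulr_suml.
by ring.
Qed.

(** Differentiate a relation of least degree in x: by minimality its derivative in x does not
    vanish, and serves as [v]. *)
Lemma algebraic_differential m (G : 'I_m -> Pr) x : alg_indep G -> ~ alg_indep (adjoin G x) ->
  exists (v : Pr) (w : 'I_m -> Pr), v != 0 /\ forall a, v * x^`M(a) = \sum_i w i * (G i)^`M(a).
Proof.
move=> hG hx; pose gm : {rmorphism _ -> Pr} := mmap (@mpolyC r K) G.
pose Pm k := exists q : {poly {mpoly K[m]}}, [/\ q != 0, (map_poly gm q).[x] = 0 & size q = k].
have [k [[q [q0 hq sq]] kmin]] : exists k, Pm k /\ forall j, Pm j -> (k <= j)%N.
  apply: classical_min; apply: NNPP => hn; apply: hx => p hp; apply: NNPP => p0.
  apply: hn; exists (size (muni p)), (muni p); split=> //; last by rewrite -msubst_adjoin.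
  by apply: contra_notN p0 => /eqP h; rewrite -(munmultiK p) h raddf0.
have q'0 : (map_poly gm q^`()).[x] != 0.
  apply/eqP => h; have sq' : (size q^`() < size q)%N by apply: lt_size_deriv.
  have q'z : q^`() = 0.
    apply/eqP/negPn/negP => q'n; have : Pm (size q^`()) by exists q^`().
    by move/kmin; rewrite -sq leqNgt sq'.
  have qc : q = (q`_0)%:P.
    apply/polyP => i; rewrite coefC; case: i => [|i] //=.
    have := congr1 (fun p : {poly _} => p`_i) q'z; rewrite coef_deriv coef0 -mulr_natl => /eqP.
    rewrite mulf_eq0 -mpolyC1 -mpolyCMn mpolyC_eq0 (negPf (natr_neq0 char0 _)) //= => /eqP //.
  move: hq q0; rewrite qc map_polyC hornerC polyC_eq0 => /hG ->; by rewrite eqxx.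
have [w hw] := mderiv_horner G x q; exists (map_poly gm q^`()).[x], (fun i => - w i); split=> // a.
have := hw a; rewrite -/gm hq mderiv0 => /esym/eqP; rewrite addr_eq0 => /eqP ->.
by rewrite -sumrN; apply: eq_bigr => i _; rewrite mulNr.
Qed.

Lemma maximal_indep l (P : 'I_l -> Pr) : alg_indep P ->
  exists m (G : 'I_m -> Pr) (s : 'I_l -> 'I_m),
    [/\ alg_indep G, injective s, forall i, G (s i) = P i & forall x, ~ alg_indep (adjoin G x)].
Proof.
move=> hP; apply: NNPP => hn.
suff main k : exists m (G : 'I_m -> Pr) (s : 'I_l -> 'I_m),
    [/\ alg_indep G, injective s, forall i, G (s i) = P i & (k <= m)%N].
  by have [m [G [s [/alg_indep_leq h _ _ /leq_trans /(_ h)]]]] := main r.+1; rewrite ltnn.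
elim: k => [|k [m [G [s [hG si hs km]]]]]; first by exists l, P, id; split=> // i j.
have [x hx] : exists x, alg_indep (adjoin G x).
  by apply: NNPP => hn'; apply: hn; exists m, G, s; split=> // x hx; apply: hn'; exists x.
exists m.+1, (adjoin G x), (fun i => lift ord_max (s i)); split=> // [i j /lift_inj /si //|i].
by rewrite /adjoin liftK hs.
Qed.

(** Extend [P] to a maximal independent family [G]. Up to nonzero factors v_j, the differentials of
    the variables are combinations of the dG_i. Where no v_j vanishes the dG_i span, and as there
    are at most r of them they are independent. *)
Lemma indep_jacobian l (P : 'I_l -> Pr) : alg_indep P -> exists gamma, row_free (diff_mx P gamma).
Proof.
case/maximal_indep => m [G [s [hG si hs hmax]]].
have mr := alg_indep_leq hG.
have ex j : exists vw : Pr * ('I_m -> Pr), vw.1 != 0 /\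
    forall a, vw.1 * ('X_j : Pr)^`M(a) = \sum_i vw.2 i * (G i)^`M(a).
  by have [v [w h]] := algebraic_differential hG (hmax 'X_j); exists (v, w).
have [vw hvw] := choice _ ex.
have : \prod_j (vw j).1 != 0 by apply/prodf_neq0 => j _; have [] := hvw j.
case/(mpoly_nonzero_eval char0) => t; rewrite rmorph_prod => /prodf_neq0 /= ht.
pose gamma := \row_b t b; exists gamma.
have et : (fun b => gamma 0 b) =1 t by move=> b; rewrite mxE.
pose W : 'M_(r, m) := \matrix_(j, i) ((vw j).2 i).@[t].
have WG : W *m diff_mx G gamma = diag_mx (\row_j ((vw j).1).@[t]).
  apply/matrixP => j a; have [_ h] := hvw j.
  have h' := congr1 (meval t) (h a); rewrite mevalM in h'.
  rewrite !mxE (eq_bigr (fun i => ((vw j).2 i * (G i)^`M(a)).@[t])); last first.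
    by move=> i _; rewrite !mxE mevalM; congr (_ * _); apply: meval_eq.
  apply: etrans (esym (raddf_sum (meval t) _ _ _)) _; apply: etrans (esym h') _.
  rewrite mderivX mnm1E; case: (j =P a) => [->|_]; last by rewrite scale0r meval0 mulr0 mulr0n.
  have -> : (U_(a) - U_(a))%MM = 0%MM :> 'X_{1..r} by apply/mnmP=> i; rewrite mnmBE subnn mnm0E.
  by rewrite mpolyX0 scale1r meval1 mulr1 mulr1n.
have fG : row_free (diff_mx G gamma).
  have : (r <= \rank (diff_mx G gamma))%N.
    apply: leq_trans (mxrankM_maxr W _); rewrite WG.
    have -> : \rank (diag_mx (\row_j ((vw j).1).@[t])) = r; last by [].
    apply: mxrank_unit; rewrite unitmxE det_diag unitfE; apply/prodf_neq0 => j _.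
    by rewrite mxE ht.
  by move=> h; rewrite /row_free eqn_leq rank_leq_row (leq_trans mr).
case/row_freeP: fG => B hB; apply/row_freeP; exists (colsub s B).
have -> : diff_mx P gamma = rowsub s (diff_mx G gamma).
  by apply/matrixP => i a; rewrite !mxE hs.
by apply/matrixP => i j; rewrite mul_rowsub_mx mulmx_colsub hB !mxE (inj_eq si).
Qed.

End Jacobian.

(** * Restriction to rays *)

Section Grading.
Variables (K : fieldType).
Implicit Types n d : nat.

Definition order_ge n d (p : {mpoly K[n]}) := forall m, p@_m != 0 -> (d <= mdeg m)%N.

Definition ray n (t : 'I_n -> K) : {mpoly K[n]} -> {poly K} := mmap (@polyC K) (fun b => t b *: 'X).

Lemma ray_mmap1 n (t : 'I_n -> K) m :
  mmap1 (fun b => t b *: 'X : {poly K}) m = (mmap1 t m) *: 'X^(mdeg m).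
Proof.
rewrite /mmap1 mdegE -prodrXr -scaler_prod; apply: eq_bigr => i _.
by rewrite exprZn.
Qed.

Lemma horner_ray n (t : 'I_n -> K) p s : (ray t p).[s] = p.@[fun b => s * t b].
Proof.
rewrite /ray; elim/mpoly_alg_ind: p => [a|i|p q hp hq|p q hp hq].
- by rewrite mmapC hornerC mevalC.
- by rewrite mmapX mmap1U hornerZ hornerX mevalXU mulrC.
- by rewrite mmapD hornerD hp hq mevalD.
- by rewrite rmorphM /= hornerM hp hq mevalM.
Qed.

Lemma ray_homog n (t : 'I_n -> K) d p : p \is d.-homog -> ray t p = (p.@[t])%:P * 'X^d.
Proof.
move/dhomogP => hp; rewrite /ray /mmap /meval /mmap rmorph_sum mulr_suml big_seq [RHS]big_seq.
apply: eq_bigr => m hm; rewrite ray_mmap1 (hp _ hm) -mul_polyC rmorphM mulrA //.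
Qed.

Lemma ray_order n (t : 'I_n -> K) d p : order_ge d p -> exists u, ray t p = u * 'X^d.
Proof.
move=> hp; exists (\sum_(m <- msupp p) (p@_m)%:P * (mmap1 t m *: 'X^(mdeg m - d))).
rewrite /ray /mmap mulr_suml big_seq [RHS]big_seq; apply: eq_bigr => m.
rewrite mcoeff_msupp => /hp dm; rewrite ray_mmap1 -mulrA; congr (_ * _).
by rewrite -scalerAl -exprD subnK.
Qed.

Lemma homog_mderiv n d (p : {mpoly K[n]}) b : p \is d.+1.-homog -> p^`M(b) \is d.-homog.
Proof.
move/dhomogP => hp; apply/dhomogP => m; rewrite mcoeff_msupp mcoeff_mderiv => h0.
have /hp : (m + U_(b))%MM \in msupp p.
  by rewrite mcoeff_msupp; apply: contraNneq h0 => ->; rewrite mul0rn.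
by rewrite /= mdegD mdeg1 addn1 => -[].
Qed.

Lemma order_mderiv n d (p : {mpoly K[n]}) b : order_ge d.+1 p -> order_ge d p^`M(b).
Proof.
move=> hp m; rewrite mcoeff_mderiv => h0.
have := hp (m + U_(b))%MM; rewrite mdegD mdeg1 addn1 ltnS; apply.
by apply: contraNneq h0 => ->; rewrite mul0rn.
Qed.

Lemma initpart_homog n (p : {mpoly K[n]}) : initpart p \is (mindeg p).-homog.
Proof. exact: pihomogP. Qed.

Lemma mcoeff_initpart n (p : {mpoly K[n]}) m :
  (initpart p)@_m = if mdeg m == mindeg p then p@_m else 0.
Proof.
rewrite /initpart raddf_sum big_mkcond /=.
have [hm|hm] := boolP (m \in msupp p); last first.
  have h0 : p@_m = 0 by apply/eqP; rewrite mcoeff_eq0.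
  rewrite h0 if_same big_seq big1 // => m' hm'; case: ifP => // _.
  rewrite mcoeffZ mcoeffX; case: eqP => [e|]; last by rewrite mulr0.
  by rewrite e (negPf hm) in hm'.
rewrite (bigD1_seq m) ?msupp_uniq //= big1 ?addr0 => [|m' /negPf h].
  by case: ifP => _ //; rewrite mcoeffZ mcoeffX eqxx mulr1.
by case: ifP => _ //; rewrite mcoeffZ mcoeffX h mulr0.
Qed.

Lemma mindeg_le n (p : {mpoly K[n]}) m : p@_m != 0 -> (mindeg p <= mdeg m)%N.
Proof.
rewrite -mcoeff_msupp /mindeg; elim: (msupp p) => [|a s IH] //.
rewrite big_cons inE => /orP [/eqP ->|/IH h]; first exact: geq_minl.
by apply: leq_trans h; apply: geq_minr.
Qed.

Lemma mindeg_attained n (p : {mpoly K[n]}) : p != 0 -> exists2 m, p@_m != 0 & mdeg m = mindeg p.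
Proof.
move=> p0; have h0 := mlead_supp p0.
suff [h|[m hm e]] : msize p = mindeg p \/ exists2 m, m \in msupp p & mdeg m = mindeg p.
- have := mindeg_le (p := p) (m := mlead p); rewrite -mcoeff_msupp => /(_ h0).
  by rewrite -h leqNgt msize_mdeg_lt.
- by exists m; rewrite -?mcoeff_msupp.
rewrite /mindeg; elim: (msupp p) => [|a s IH]; first by rewrite big_nil; left.
rewrite big_cons /minn; case: ifP => _; first by right; exists a; rewrite ?inE ?eqxx.
by case: IH => [e|[m ms e]]; [left|right; exists m; rewrite ?inE ?ms ?orbT].
Qed.

Lemma initpart_neq0 n (p : {mpoly K[n]}) : p != 0 -> initpart p != 0.
Proof.
case/mindeg_attained => m hm e; apply: contraNneq hm => h.
by have := mcoeff_initpart p m; rewrite e eqxx h mcoeff0 => <-.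
Qed.

Lemma mindeg_gt0 n (p : {mpoly K[n]}) : p != 0 -> p.@[fun _ => 0] = 0 -> (0 < mindeg p)%N.
Proof.
case/mindeg_attained => m hm e h; rewrite lt0n -e; apply: contraNneq hm => /eqP.
rewrite mdeg_eq0 => /eqP ->; apply/eqP; rewrite -[RHS]h mevalE.
have ev m' : \prod_i (0 : K) ^+ (m' : 'X_{1..n}) i = (m' == 0%MM)%:R.
  have [->|m'0] := eqVneq m' 0%MM; first by rewrite big1 // => i _; rewrite mnm0E expr0.
  have [i hi] := mnm_neq0 m'0.
  by rewrite (bigD1 i) //= expr0n (negPf hi) mul0r.
have [h0|h0] := boolP (0%MM \in msupp p).
  rewrite (bigD1_seq 0%MM) ?msupp_uniq //= ev eqxx mulr1 big1 ?addr0 // => m' /negPf hm'.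
  by rewrite ev hm' mulr0.
rewrite big_seq big1 => [|m' hm']; first by apply/eqP; rewrite mcoeff_eq0.
by rewrite ev; case: eqP => [e'|]; rewrite ?mulr0 //; rewrite e' (negPf h0) in hm'.
Qed.

(** Along a ray through 0, [initpart p] supplies the leading coefficient of the partial derivative;
    all other terms have one more factor 'X. *)
Lemma ray_mderiv n (t : 'I_n -> K) p b : (0 < mindeg p)%N ->
  exists u, ray t p^`M(b) = (((initpart p)^`M(b)).@[t]%:P + u * 'X) * 'X^((mindeg p).-1).
Proof.
move=> d0; have hI := initpart_homog p; move: hI; rewrite -(prednK d0) => hI.
have hq : order_ge (mindeg p).-1.+2 (p - initpart p).
  move=> m; rewrite mcoeffB mcoeff_initpart => h; rewrite prednK //.
  have h0 : p@_m != 0 by apply: contraNneq h => ->; rewrite if_same subrr.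
  rewrite ltn_neqAle mindeg_le // andbT eq_sym.
  by apply: contraNneq h => ->; rewrite eqxx subrr.
have [u hu] := ray_order t (order_mderiv (b := b) hq); exists u.
have {1}-> : p = initpart p + (p - initpart p) by rewrite addrC subrK.
rewrite mderivD /ray mmapD -/(ray t _) -/(ray t _) hu (ray_homog t (homog_mderiv b hI)).
by rewrite exprS mulrA mulrDl.
Qed.

Lemma homog_msubst n m d (h : 'I_n -> {mpoly K[m]}) p :
  (forall i, h i \is 1.-homog) -> p \is d.-homog -> msubst h p \is d.-homog.
Proof.
move=> hh /dhomogP hp; rewrite /msubst /mmap big_seq; apply: rpred_sum => mo hmo.
rewrite mul_mpolyC; apply: dhomogZ; rewrite -(hp _ hmo) /mmap1 /= mdegE.
apply: (big_ind2 (fun (p : {mpoly K[m]}) k => p \is k.-homog)) => [|q a q' b|i _].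
- exact: dhomog1.
- exact: dhomogM.
by have := dhomogMn (mo i) (hh i); rewrite mul1n.
Qed.

Lemma mdegree_homog n d (p : {mpoly K[n]}) : p != 0 -> p \is d.-homog -> mdegree p = d.
Proof. by move=> p0 /dhomogP h; rewrite /mdegree -mlead_deg //= (h _ (mlead_supp p0)). Qed.

Lemma euler_homog n d (p : {mpoly K[n]}) : p \is d.-homog -> \sum_i 'X_i * p^`M(i) = d%:R *: p.
Proof.
move/dhomogP => hp; apply/mpolyP => m; rewrite mcoeffZ raddf_sum /=.
have e i : ('X_i * p^`M(i))@_m = (m i)%:R * p@_m.
  have [mi|mi] := posnP (m i).
    rewrite mi mul0r; apply/eqP; rewrite mcoeff_eq0; apply/negP => /msuppM_le /allpairsP [[a b] /=].
    rewrite msuppX inE => -[/eqP -> _ em]; move: mi; rewrite em mnmDE mnm1E eqxx //.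
  have em : m = (U_(i) + (m - U_(i)))%MM.
    by apply/mnmP => j; rewrite mnmDE mnmBE mnm1E; case: eqP => [<-|_]; rewrite ?subnKC // subn0.
  have := mcoeffMX p^`M(i) U_(i)%MM (m - U_(i))%MM; rewrite -em mulrC => ->.
  rewrite mcoeff_mderiv addmC -em.
  by rewrite mnmBE mnm1E eqxx subn1 prednK // mulr_natl.
rewrite (eq_bigr _ (fun i _ => e i)) -mulr_suml -natr_sum -mdegE.
have [h|/negPf] := boolP (m \in msupp p); first by rewrite (hp _ h).
by rewrite mcoeff_msupp => /negbFE /eqP ->; rewrite !mulr0.
Qed.

End Grading.

Section LinearAlgebra.

Lemma det_congruence (K : fieldType) m n (C : 'M[K]_(m, n)) : m = n -> row_free C ->
  exists2 k : K, k != 0 & forall A, \det (C *m A *m C^T) = k * \det A.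
Proof.
move=> mn; subst n; rewrite row_free_unit unitmxE unitfE => C0.
by exists (\det C * \det C); [rewrite mulf_neq0|move=> A; rewrite !det_mulmx det_tr; ring].
Qed.

Lemma rank_factorization (K : fieldType) m n l (A : 'M[K]_(m, n)) : (\rank A <= l)%N ->
  exists (T : 'M_(l, m)) (T' : 'M_(l, n)), A = T^T *m T'.
Proof.
move=> hl; exists ((col_base A *m pid_mx (\rank A) : 'M_(m, l))^T), (pid_mx (\rank A) *m row_base A).
rewrite trmxK mulmxA -(mulmxA (col_base A)) mul_pid_mx minnn (minn_idPr hl) pid_mx_1 mulmx1.
by rewrite mulmx_base.
Qed.

Lemma det_completion (K : fieldType) r l (A : 'M[K]_r) : (r - \rank A <= l)%N ->
  exists T T' : 'M_(l, r), \det (A + T^T *m T') != 0.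
Proof.
(* In the factorization of [A] through [pid_mx], this adds the missing diagonal entries; its rank is
   the corank of [A], at most [l]. *)
move=> hr; pose B := col_ebase A *m copid_mx (\rank A) *m row_ebase A.
have [|T [T' e]] := @rank_factorization K r r l B.
  apply: leq_trans hr; apply: leq_trans (mxrankM_maxl _ _) _.
  by apply: leq_trans (mxrankM_maxr _ _) _; rewrite rank_copid_mx ?rank_leq_row.
exists T, T'; rewrite -e /B -{1}[A]mulmx_ebase -mulmxDl -mulmxDr.
rewrite /copid_mx addrC subrK mulmx1 -unitfE -unitmxE unitmx_mul.
by rewrite col_ebase_unit row_ebase_unit.
Qed.

Lemma completion_rank (K : fieldType) r l (A : 'M[K]_r) (T T' : 'M_(l, r)) :
  \det (A + T^T *m T') != 0 -> (r - \rank A <= l)%N.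
Proof.
rewrite -unitfE -unitmxE => u; rewrite leq_subLR -{1}(mxrank_unit u).
apply: leq_trans (mxrank_add _ _) _; rewrite leq_add2l.
by apply: leq_trans (mxrankM_maxr _ _) (rank_leq_row _).
Qed.

Lemma order_compare (K : fieldType) (A B : {poly K}) a b : 'X^a * A = 'X^b * B ->
  [/\ (a < b)%N -> A.[0] = 0, (b < a)%N -> B.[0] = 0 & a = b -> A = B].
Proof.
have Xn k : 'X^k != 0 :> {poly K} by rewrite expf_neq0 // polyX_eq0.
have main (A' B' : {poly K}) a' b' : 'X^a' * A' = 'X^b' * B' -> (a' < b')%N -> A'.[0] = 0.
  move=> e ab; move: e; rewrite -(subnKC ab) addSn -addnS exprD -mulrA => /(mulfI (Xn _)) ->.
  by rewrite exprS !hornerM hornerX !mul0r.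
move=> e; split=> [|ba|ab]; first exact: main e.
  exact: (main B A b a (esym e) ba).
by move: e; rewrite ab => /(mulfI (Xn _)).
Qed.

Lemma poly_horner_inj (K : fieldType) (p q : {poly K}) : [pchar K] =i pred0 ->
  (forall s, p.[s] = q.[s]) -> p = q.
Proof.
move=> char0 h; apply/eqP; rewrite -subr_eq0; apply/negPn/negP => /(poly_nonroot char0) [s].
by rewrite hornerD hornerN h subrr eqxx.
Qed.

End LinearAlgebra.

(** * The slice *)

Section Slice.
Variables (K : closedFieldType).
Hypothesis char0 : [pchar K] =i pred0.
Variables (n : nat) (c : 'I_n -> 'I_n -> 'rV[K]_n).
Hypothesis Hlie : is_lie c.
Hypothesis HG : gram c \in unitmx.
Variables (e h f : 'rV[K]_n).
Hypothesis He0 : e != 0.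
Hypothesis Htriple : sl2_triple c e h f.
Variables (r : nat) (Be Bf : 'M[K]_(r, n)).
Hypothesis HBe : row_free Be.
Hypothesis HBe' : (Be :=: kermx (ad c e))%MS.
Hypothesis HBf : row_free Bf.
Hypothesis HBf' : (Bf :=: kermx (ad c f))%MS.
Local Notation ad := (ad c).
Local Notation br := (br c).
Local Notation G := (gram c).
Local Notation nform := (nform c e f).
Local Notation kf := (killing c e f).
Local Notation pairing := (pairing c e f Be Bf).

Lemma kf0 : kf != 0. Proof. exact: (killing_ef_neq0 char0 Hlie He0 Htriple). Qed.

(** Sends x to the coordinates of (x, -) on g_f; it is also the differential of the substitution in
    [psi]. *)
Definition slice_mx : 'M_(n, r) := kf^-1 *: (G *m Bf^T).
Local Notation N := slice_mx.

Lemma nformE x y : nform x y = (kf^-1 *: (x *m G *m y^T)) 0 0.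
Proof. by rewrite mxE mul_gram mulrC. Qed.

Lemma nform_slice x (t : 'rV_r) : nform x (t *m Bf) = (x *m N *m t^T) 0 0.
Proof. by rewrite nformE trmx_mul /slice_mx -scalemxAr -scalemxAl !mulmxA. Qed.

Lemma slice_mxE i b : nform (delta_mx 0 i) (row b Bf) = N i b.
Proof.
by rewrite [row b Bf]rowE nform_slice -rowE trmx_delta -colE !mxE.
Qed.

Lemma pairingE : pairing = Be *m N.
Proof.
apply/matrixP=> a b; rewrite mxE [row b Bf]rowE nform_slice trmx_delta -colE -row_mul.
by rewrite !mxE.
Qed.

Lemma Be_ad : Be *m ad e = 0.
Proof. by apply/sub_kermxP; rewrite HBe'. Qed.
Lemma Bf_ad : Bf *m ad f = 0.
Proof. by apply/sub_kermxP; rewrite HBf'. Qed.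

Lemma ad_f_slice : ad f *m N = 0.
Proof.
by rewrite /slice_mx -scalemxAr mulmxA ad_gram_skew // mulNmx -mulmxA -trmx_mul Bf_ad trmx0 mulmx0 oppr0 scaler0.
Qed.

Lemma rank_ad_f : (r + \rank (ad f))%N = n.
Proof.
have : \rank Bf = \rank (kermx (ad f)) by rewrite HBf'.
rewrite mxrank_ker (eqP HBf) => ->.
by rewrite subnK // rank_leq_row.
Qed.

Lemma rank_ad_e : (r + \rank (ad e))%N = n.
Proof.
have : \rank Be = \rank (kermx (ad e)) by rewrite HBe'.
rewrite mxrank_ker (eqP HBe) => ->.
by rewrite subnK // rank_leq_row.
Qed.

Lemma rank_slice : \rank N = r.
Proof.
rewrite /slice_mx mxrank_scale_nz ?invr_neq0 ?kf0 // eqmxMfull ?row_full_unit //.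
by rewrite mxrank_tr (eqP HBf).
Qed.

Lemma slice_kernel (v : 'rV_n) : v *m N = 0 -> (v <= ad f)%MS.
Proof.
move/sub_kermxP => hv; have h1 : (ad f <= kermx N)%MS by apply/sub_kermxP/ad_f_slice.
have [_ eq] := mxrank_leqif_sup h1; apply: submx_trans hv _; rewrite -eq.
rewrite mxrank_ker rank_slice; apply/eqP; have := rank_ad_f; move: (\rank _) => k; lia.
Qed.

(* [g_e] meets [[g, f]] trivially, and [[g, f]] is the orthogonal of [g_f]. *)
Lemma pairing_unit : pairing \in unitmx.
Proof.
rewrite -row_free_unit -kermx_eq0; apply/eqP/row_matrixP => i; rewrite row0.
set w := row i _; have wP : w *m pairing = 0 by apply/sub_kermxP/row_sub.
have : (w *m Be <= ad f)%MS by apply: slice_kernel; rewrite -mulmxA -pairingE.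
case/submxP => v hv; have := ker_e_im_f char0 Hlie Htriple (v := v).
rewrite -hv -mulmxA Be_ad mulmx0 => /(_ erefl) wB.
by apply: (row_free_inj HBe); rewrite wB mul0mx.
Qed.

Local Notation P := (invmx pairing).
Variables (k : nat) (Bv : 'M[K]_(k, n)).
Hypothesis HBv : row_free Bv.
Hypothesis HBv' : (Bv :=: ad f)%MS.
Local Notation C := (col_mx Be Bv).

Lemma Bv_slice : Bv *m N = 0.
Proof. by apply/sub_kermxP; rewrite HBv'; apply/sub_kermxP/ad_f_slice. Qed.

Lemma slice_dim : (r + k)%N = n.
Proof. by have := rank_ad_f; rewrite -HBv' (eqP HBv). Qed.

Lemma slice_frame_free : row_free C.
Proof.
rewrite -kermx_eq0; apply/eqP/row_matrixP => i; rewrite row0.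
set w := row i _; have : w *m C = 0 by apply/sub_kermxP/row_sub.
rewrite -[w]hsubmxK mul_row_col => hw.
have w1 : lsubmx w = 0.
  have w1 : lsubmx w *m pairing = 0.
    have := mulmxDl (lsubmx w *m Be) (rsubmx w *m Bv) N.
    by rewrite hw mul0mx -!mulmxA Bv_slice mulmx0 addr0 -pairingE.
  apply: (can_inj (mulmxK pairing_unit)); by rewrite w1 mul0mx.
move: hw; rewrite w1 mul0mx add0r => hw.
have -> : rsubmx w = 0 by apply: (row_free_inj HBv); rewrite hw mul0mx.
by rewrite row_mx0.
Qed.

(** The Lie-Poisson matrix at the point (z, -) of the dual, that is, the form (u, v) -> ([u, v],
    z). *)
Definition kirillov z : 'M_n := kf^-1 *: (ad z *m G).

Lemma kirillovD s x y : kirillov (x + s *: y) = kirillov x + s *: kirillov y.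
Proof. by rewrite /kirillov adD adZ mulmxDl scalerDr -scalemxAl !scalerA mulrC. Qed.

Lemma kirillovE u v z : (u *m kirillov z *m v^T) 0 0 = nform (br u v) z.
Proof.
by rewrite /kirillov -scalemxAr -scalemxAl mulmxA mxE mul_gram mul_ad killing_inv // (killingC c z) mulrC.
Qed.

Lemma kirillov_tr z : (kirillov z)^T = - kirillov z.
Proof.
by rewrite /kirillov linearZ /= trmx_mul gram_tr ad_gram_skew // -scalerN opprK.
Qed.

Lemma Be_kirillov : Be *m kirillov e = 0.
Proof. by rewrite /kirillov -scalemxAr mulmxA Be_ad mul0mx scaler0. Qed.

Lemma kirillov_Be : kirillov e *m Be^T = 0.
Proof.
by apply: trmx_inj; rewrite trmx_mul trmxK kirillov_tr mulmxN Be_kirillov trmx0 oppr0.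
Qed.

(** The form at [e] has radical g_e, so its rank n - r is concentrated on the complement [f, g]. *)
Lemma transversal_unit : Bv *m kirillov e *m Bv^T \in unitmx.
Proof.
have eC : C *m kirillov e *m C^T = block_mx 0 0 0 (Bv *m kirillov e *m Bv^T).
  by rewrite tr_col_mx mul_col_mx Be_kirillov mul_col_row !mul0mx -mulmxA kirillov_Be mulmx0.
rewrite -row_free_unit /row_free eqn_leq rank_leq_row /=.
have : \rank (C *m kirillov e *m C^T) = k.
  have fC : row_full C^T by rewrite /row_full mxrank_tr (eqP slice_frame_free) slice_dim.
  rewrite mxrankMfree; last by rewrite /row_free mxrank_tr; move: fC; rewrite /row_full !mxrank_tr (eqP slice_frame_free) slice_dim.
  rewrite eqmxMfull; last by rewrite /row_full (eqP slice_frame_free) slice_dim.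
  rewrite /kirillov mxrank_scale_nz ?invr_neq0 ?kf0 // mxrankMfree ?row_free_unit //.
  have := rank_ad_e; have := slice_dim; move: (\rank _) => d; lia.
by rewrite eC rank_diag_block_mx mxrank0 add0n => ->.
Qed.

Definition slice_point (s : K) (t : 'rV[K]_r) (i : 'I_n) := nform (delta_mx 0 i) (e + s *: (t *m Bf)).

Lemma nformDr x y z s : nform x (y + s *: z) = nform x y + s * nform x z.
Proof. by rewrite /Defs.nform killingDr killingZr mulrDl mulrA. Qed.

Lemma lie_poisson_slice s t :
  map_mx (meval (slice_point s t)) (lie_poisson c) = kirillov e + s *: kirillov (t *m Bf).
Proof.
rewrite lie_poisson_eval // -kirillovD /kirillov; set z := _ + _.
have -> : \row_i slice_point s t i = kf^-1 *: (z *m G).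
  by apply/rowP => i; rewrite [LHS]mxE [RHS]mxE mul_gramE (killingC c z) mulrC.
by rewrite -scalemxAl mulmxK // adZ -scalemxAl.
Qed.

Lemma psi_slice q s (t : 'rV_r) :
  (psi c e f Bf q).@[fun b => s * t 0 b] = q.@[slice_point s t].
Proof.
rewrite /psi /msubst; elim/mpoly_alg_ind: q => [a|i|p q hp hq|p q hp hq].
- by rewrite mmapC !mevalC.
- rewrite mmapX mmap1U mevalD mevalC mevalXU /slice_point nformDr; congr (_ + _).
  rewrite raddf_sum nform_slice.
  have -> : delta_mx 0 i *m N = row i N by rewrite rowE.
  rewrite mxE mulr_sumr; apply: eq_bigr => b _ /=.
  by rewrite mevalZ mevalXU slice_mxE !mxE mulrCA.
- by rewrite mmapD !mevalD hp hq.
- by rewrite rmorphM /= !mevalM hp hq.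
Qed.

Lemma psi_mderiv q b : (psi c e f Bf q)^`M(b) = \sum_i (N i b) *: psi c e f Bf q^`M(i).
Proof.
rewrite {1}/psi mderiv_msubst; apply: eq_bigr => i _; rewrite -/(psi c e f Bf _).
by rewrite mderivD mderivC add0r mderiv_linear_form mulrC mul_mpolyC slice_mxE.
Qed.

(** * Orders of vanishing along rays of the slice *)

Section Generators.
Variables (l : nat).
Hypothesis Hrank : lie_rank c l.
Variable F : 'I_l -> {mpoly K[n]}.
Hypothesis HF : homog_gen_system c F.
Local Notation D := (gradient_mx F).
Local Notation psiF i := (psi c e f Bf (F i)).

Lemma gradient_slice s (t : 'rV_r) : map_mx (meval (slice_point s t)) D *m N =
  \matrix_(i, b) ((psiF i)^`M(b)).@[fun b => s * t 0 b].
Proof.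
apply/matrixP=> i b; rewrite !mxE psi_mderiv raddf_sum; apply: eq_bigr => j _ /=.
by rewrite mevalZ psi_slice !mxE mulrC.
Qed.

Definition ray_jacobian (t : 'rV[K]_r) : 'M[{poly K}]_(l, r) :=
  \matrix_(i, b) ray (t 0) ((psiF i)^`M(b)).
Definition ray_den t (T : 'M[K]_(l, r)) : {poly K} :=
  \det (ray_jacobian t *m map_mx polyC (P *m T^T)).

Lemma horner_ray_den t T s :
  (ray_den t T).[s] = \det (map_mx (meval (slice_point s t)) D *m (N *m P *m T^T)).
Proof.
rewrite /ray_den -!horner_evalE -det_map_mx map_mxM !mulmxA gradient_slice -mulmxA.
congr (\det (_ *m _)); first by apply/matrixP=> i b; rewrite !mxE -horner_ray.
by apply/matrixP=> i b; rewrite !mxE /= horner_evalE hornerC.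
Qed.

Definition stab_form (t : 'rV[K]_r) := Be *m kirillov (t *m Bf) *m Be^T.
(* The frame determinant along the ray [e + 'X y] in the basis [col_mx Be Bv], with the factor
   ['X] removed from each of the [r] rows indexed by [Be]. *)
Definition ray_num t (T T' : 'M[K]_(l, r)) : {poly K} :=
  \det (block_mx (map_mx polyC (stab_form t + T^T *m T'))
     (map_mx polyC (Be *m kirillov (t *m Bf) *m Bv^T))
     ('X *: map_mx polyC (Bv *m kirillov (t *m Bf) *m Be^T))
     (map_mx polyC (Bv *m kirillov e *m Bv^T) + 'X *: map_mx polyC (Bv *m kirillov (t *m Bf) *m Bv^T))).

Lemma horner_ray_num t T T' s : (ray_num t T T').[s] =
  \det (block_mx (stab_form t + T^T *m T') (Be *m kirillov (t *m Bf) *m Bv^T)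
    (s *: (Bv *m kirillov (t *m Bf) *m Be^T))
    (Bv *m kirillov e *m Bv^T + s *: (Bv *m kirillov (t *m Bf) *m Bv^T))).
Proof.
have pK p q (A : 'M[K]_(p, q)) : map_mx (horner_eval s) (map_mx polyC A) = A.
  by apply/matrixP=> i j; rewrite !mxE /= horner_evalE hornerC.
have pX p q (A : 'M[K]_(p, q)) : map_mx (horner_eval s) ('X *: map_mx polyC A) = s *: A.
  by apply/matrixP=> i j; rewrite !mxE /= horner_evalE hornerM hornerX hornerC.
by rewrite /ray_num -horner_evalE -det_map_mx map_block_mx !pX !pK map_mxD pX pK.
Qed.

Lemma ray_num0 t T T' : (ray_num t T T').[0] =
  \det (stab_form t + T^T *m T') * \det (Bv *m kirillov e *m Bv^T).
Proof. by rewrite horner_ray_num !scale0r addr0 det_ublock. Qed.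

(** Kostant's identity along the ray, in the basis [C]. The [r] rows of [Be] carry a factor s
    because g_e is the radical of the form at [e]. *)
Lemma ray_identity : exists2 q : K, q != 0 & forall t T T',
  'X^r * ray_num t T T' = 'X^l * (q%:P * (ray_den t T * ray_den t T')).
Proof.
have [Fhom [Finv Fgen]] := HF.
have [q q0 Hq] := kostant_identity char0 Hlie HG Hrank Finv Fgen.
have [k1 k10 Hk1] := det_congruence slice_dim slice_frame_free.
exists (k1 * q) => [|t T T']; first by rewrite mulf_neq0.
apply: (poly_horner_inj char0) => s; rewrite !hornerM !hornerXn hornerC !horner_ray_den.
set Dt := map_mx _ D.
(* The frame of g whose coordinates in [C] are [T] on g_e and 0 on [f, g]. *)
pose S (T : 'M[K]_(l, r)) := T *m P^T *m N^T.
have CS (U : 'M[K]_(l, r)) : S U *m C^T = row_mx U 0.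
  have -> : S U *m C^T = U *m (C *m N *m P)^T by rewrite /S !trmx_mul !mulmxA.
  rewrite mul_col_mx -pairingE Bv_slice mul_col_mx mulmxV ?pairing_unit // mul0mx.
  by rewrite tr_col_mx trmx1 trmx0 mul_mx_row mulmx1 mulmx0.
have ST (U : 'M[K]_(l, r)) : (S U)^T = N *m P *m U^T by rewrite /S !trmx_mul !trmxK mulmxA.
(* One frame is scaled by s, so that the border term on g_e is divisible by s like the rest of its
   rows; this produces the factor s^l on the right. *)
have := congr1 (meval (slice_point s t)) (Hq (S T) (s *: S T')).
rewrite mevalZ mevalM.
rewrite (frame_numE _ (meval (slice_point s t))) !(frame_denE _ (meval (slice_point s t))) -/Dt.
have mK (U : 'M[K]_(l, n)) : map_mx (meval (slice_point s t)) (map_mx (@mpolyC n K) U) = U.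
  by apply/matrixP=> i j; rewrite !mxE /= mevalC.
rewrite !mK lie_poisson_slice => H.
have {}H : k1 * (\det (kirillov e + s *: kirillov (t *m Bf) + (S T)^T *m (s *: S T'))) =
    s ^+ l * (k1 * q * (\det (Dt *m (N *m P *m T^T)) * \det (Dt *m (N *m P *m T'^T)))).
  rewrite {}H linearZ /= -scalemxAr detZ !ST.
  by move: (\det _) (\det _) (s ^+ l) => x y z; ring.
rewrite -{}H -Hk1.
set A := _ + _ + _.
have -> : C *m A *m C^T = block_mx s%:M 0 0 1%:M *m
  block_mx (stab_form t + T^T *m T') (Be *m kirillov (t *m Bf) *m Bv^T)
    (s *: (Bv *m kirillov (t *m Bf) *m Be^T))
    (Bv *m kirillov e *m Bv^T + s *: (Bv *m kirillov (t *m Bf) *m Bv^T)).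
  have e1 : C *m ((S T)^T *m (s *: S T')) *m C^T = block_mx (s *: (T^T *m T')) 0 0 0.
    have -> : C *m ((S T)^T *m (s *: S T')) *m C^T = s *: ((S T *m C^T)^T *m (S T' *m C^T)).
      by rewrite (trmx_mul (S T)) trmxK -!scalemxAr -scalemxAl !mulmxA.
    rewrite !CS tr_row_mx mul_col_row trmx0 !mul0mx !mulmx0.
    by rewrite scale_block_mx !scaler0.
  rewrite /A mulmxDr mulmxDl e1 /stab_form; move: (kirillov (t *m Bf)) => Y; rewrite mulmxDr mulmxDl.
  rewrite tr_col_mx mul_col_mx Be_kirillov mul_col_row !mul0mx -(mulmxA Bv) kirillov_Be mulmx0.
  move: (Bv *m kirillov e *m Bv^T) => M22.
  rewrite -scalemxAr -scalemxAl mul_col_mx mul_col_row scale_block_mx !add_block_mx.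
  by rewrite mulmx_block !mul0mx !mul1mx !mul_scalar_mx !add0r !addr0 scalerDr.
by rewrite horner_ray_num det_mulmx det_lblock det_scalar det1 mulr1.
Qed.

(** [gamma *m P^T] gives the coordinates of the element y of g_f for which (y, -) restricts to
    [gamma] on g_e. *)
Lemma stab_mx_form gamma : stab_mx c Be gamma = stab_form (gamma *m P^T).
Proof.
apply/matrixP=> a b.
have -> : stab_form (gamma *m P^T) a b = nform (br (row a Be) (row b Be)) (gamma *m P^T *m Bf).
  rewrite -kirillovE /stab_form -row_mul; move: (Be *m kirillov _) => A.
  by rewrite [LHS]mxE [RHS]mxE; apply: eq_bigr => j _; rewrite !mxE.
rewrite mxE; set v := br _ _.
have vB : (v <= Be)%MS.
  rewrite HBe'; apply/sub_kermxP; rewrite br_ad_derivation //.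
  by rewrite -!row_mul Be_ad !row0 br0l br0r addr0.
rewrite nform_slice -{2}(mulmxKpV vB) -(mulmxA _ Be) -pairingE trmx_mul trmxK.
by rewrite -(mulmxA (v *m _)) mulKVmx ?pairing_unit // mulmxA mulmxKV ?pairing_unit.
Qed.

Lemma stab_dim_form gamma : stab_dim c Be gamma = (r - \rank (stab_form (gamma *m P^T)))%N.
Proof. by rewrite /stab_dim mxrank_ker stab_mx_form. Qed.

Hypothesis Hind : index_is c Be l.

Lemma ray_num_neq0 gamma : stab_dim c Be gamma = l ->
  exists T T', (ray_num (gamma *m P^T) T T').[0] != 0.
Proof.
rewrite stab_dim_form => h1; have [|T [T' hT]] := @det_completion _ r l (stab_form (gamma *m P^T)).
  by rewrite h1.
exists T, T'; rewrite ray_num0 mulf_neq0 //.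
by rewrite -unitfE -unitmxE transversal_unit.
Qed.

Lemma ray_num_regular gamma T T' : (ray_num (gamma *m P^T) T T').[0] != 0 -> stab_dim c Be gamma = l.
Proof.
rewrite ray_num0 mulf_eq0 negb_or => /andP [/completion_rank h1 _].
by apply/eqP; rewrite eqn_leq Hind.2 stab_dim_form h1.
Qed.

(** Otherwise row i of every ray Jacobian vanishes, and by [ray_identity] so does [ray_num], against
    the existence of a form with stabilizer of dimension [l]. *)
Lemma psi_nonconstant i : exists b, (psiF i)^`M(b) != 0.
Proof.
apply: NNPP => hn; have [[gamma hg] _] := Hind.
have [T [T' h0]] := ray_num_neq0 hg; have [q q0 H] := ray_identity.
have d0 t U : ray_den t U = 0.
  rewrite /ray_den (expand_det_row _ i) big1 // => j _; rewrite mxE big1 ?mul0r // => b _.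
  rewrite mxE; case: (eqVneq (psiF i)^`M(b) 0) => [->|hb]; last by case: hn; exists b.
  by rewrite /ray mmap0 mul0r.
move: h0; have := H (gamma *m P^T) T T'; rewrite !d0 !mulr0 => /eqP.
by rewrite mulf_eq0 expf_eq0 polyX_eq0 andbF /= => /eqP ->; rewrite horner0 eqxx.
Qed.

(* An invariant without constant term vanishes on the nilpotent [e]: [[h, e] = 2 e] is tangent to the orbit. *)
Lemma psi_vanishes i : (psiF i).@[fun _ => 0] = 0.
Proof.
have [Fhom [Finv Fgen]] := HF.
have -> : (psiF i).@[fun _ => 0] = (F i).@[slice_point 0 0].
  by rewrite -psi_slice; apply: meval_eq => b; rewrite mul0r.
have [d hd] := Fhom i.
have d0 : d != 0%N.
  apply/eqP => d0; have [b] := psi_nonconstant i.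
  have -> : F i = ((F i)@_0)%:MP.
    apply: msize1_polyC; rewrite msizeE; apply/bigmax_leqP_seq => m hm _.
    by rewrite (dhomogP _ _ _ hd _ hm) d0.
  by rewrite /psi /msubst mmapC mderivC eqxx.
have := congr1 (map_mx (meval (slice_point 0 0))) (gradient_annihilates char0 Hlie HG Hrank Fgen).
rewrite map_mxM map_mx0 lie_poisson_slice scale0r addr0 -map_trmx => h1.
have pt : \row_j slice_point 0 0 j = kf^-1 *: (e *m G).
  by apply/rowP => j; rewrite [LHS]mxE [RHS]mxE mul_gramE (killingC c e (delta_mx 0 j)) mulrC /slice_point scale0r addr0.
have h2 : (\row_j slice_point 0 0 j) *m (map_mx (meval (slice_point 0 0)) D)^T = 0.
  have hk : h *m kirillov e = - (2%:R *: \row_j slice_point 0 0 j).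
    case: Htriple => he _; rewrite pt /kirillov -scalemxAr mulmxA mul_ad (brC Hlie) he mulNmx.
    by rewrite -scalemxAl scalerN !scalerA mulrC.
  have := congr1 (mulmx h) h1; rewrite mulmxA mulmx0 hk mulNmx -scalemxAl => /eqP.
  by rewrite oppr_eq0 scaler_eq0 (negPf (natr_neq0 char0 _)) //= => /eqP.
have := congr1 (meval (slice_point 0 0)) (euler_homog hd); rewrite mevalZ => h3.
have : d%:R * (F i).@[slice_point 0 0] = 0.
  apply: etrans (esym h3) _; apply: etrans (raddf_sum (meval (slice_point 0 0)) _ _ _) _.
  have := congr1 (fun M : 'rV_l => M 0 i) h2; rewrite !mxE => h4; rewrite -[RHS]h4.
  apply: eq_bigr => j _; apply: etrans (mevalM _ _ _) _; by rewrite mevalXU !mxE.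
by move/eqP; rewrite mulf_eq0 (negPf (natr_neq0 char0 d0)) => /eqP.
Qed.

Lemma psi_neq0 i : psiF i != 0.
Proof. by have [b] := psi_nonconstant i; apply: contraNneq => ->; rewrite mderiv0. Qed.

Lemma mindeg_psi_gt0 i : (0 < mindeg (psiF i))%N.
Proof. exact: mindeg_gt0 (psi_neq0 i) (psi_vanishes i). Qed.

Local Notation eFs := (fun i => eF c e f Be Bf (F i)).

Lemma kappa_e_invK q : kappa_e c e f Be Bf (kappa_e_inv c e f Be Bf q) = q.
Proof.
rewrite /kappa_e /kappa_e_inv /msubst; elim/mpoly_alg_ind: q => [a|i|p q hp hq|p q hp hq].
- by rewrite !mmapC.
- rewrite mmapX mmap1U raddf_sum /=.
  under eq_bigr => a _ do rewrite mmapZ mul_mpolyC mmapX mmap1U scaler_sumr.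
  rewrite exchange_big (bigD1 i) //= [X in _ + X]big1 ?addr0 => [|b /negPf bi].
    under eq_bigr do rewrite scalerA.
    rewrite -scaler_suml; have := congr1 (fun M : 'M_r => M i i) (mulVmx pairing_unit).
    by rewrite !mxE eqxx => ->; rewrite scale1r.
  under eq_bigr do rewrite scalerA.
  rewrite -scaler_suml; have := congr1 (fun M : 'M_r => M i b) (mulVmx pairing_unit).
  by rewrite !mxE eq_sym bi => ->; rewrite scale0r.
- by rewrite !mmapD hp hq.
- by rewrite !rmorphM /= hp hq.
Qed.

Lemma mdegree_eF i : mdegree (eF c e f Be Bf (F i)) = mindeg (psiF i).
Proof.
apply: mdegree_homog; last first.
  apply: homog_msubst (initpart_homog _) => b; apply: rpred_sum => a _; apply: dhomogZ.
  by rewrite dhomogX /= mdeg1.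
apply: contraNneq (initpart_neq0 (psi_neq0 i)) => h0.
by rewrite -[initpart _]kappa_e_invK -/(eF c e f Be Bf (F i)) h0 /kappa_e /msubst mmap0.
Qed.

Definition init_jacobian (t : 'rV[K]_r) : 'M[K]_(l, r) :=
  \matrix_(i, b) ((initpart (psiF i))^`M(b)).@[t 0].

Lemma diff_mx_eF gamma : diff_mx eFs gamma = init_jacobian (gamma *m P^T) *m P.
Proof.
apply/matrixP=> i a; rewrite !mxE /eF /kappa_e_inv mderiv_msubst raddf_sum.
apply: eq_bigr => b _ /=; rewrite mevalM !mxE; congr (_ * _).
  elim/mpoly_alg_ind: (_^`M(b)) => [x|j|p q hp hq|p q hp hq].
  - by rewrite /msubst mmapC !mevalC.
  - rewrite /msubst mmapX mmap1U mevalXU !mxE raddf_sum; apply: eq_bigr => a' _ /=.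
    by rewrite mevalZ mevalXU !mxE mulrC.
  - by rewrite /msubst mmapD !mevalD -!/(msubst _ _) hp hq.
  - by rewrite /msubst rmorphM /= !mevalM -!/(msubst _ _) hp hq.
by rewrite mderiv_linear_form mevalC.
Qed.

(** Row i of the ray Jacobian is divisible by 'X to the power [mindeg] minus 1, and what is left at
    0 is the gradient of the initial part. *)
Lemma ray_den_order t T : exists B : {poly K},
  ray_den t T = 'X^(\sum_i (mindeg (psiF i)).-1) * B /\ B.[0] = \det (init_jacobian t *m (P *m T^T)).
Proof.
have ex (ib : 'I_l * 'I_r) : exists u : {poly K}, ray (t 0) (psiF ib.1)^`M(ib.2) =
    (((initpart (psiF ib.1))^`M(ib.2)).@[t 0]%:P + u * 'X) * 'X^((mindeg (psiF ib.1)).-1).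
  by apply: ray_mderiv; apply: mindeg_psi_gt0.
have [u hu] := choice _ ex.
pose E : 'M[{poly K}]_(l, r) := \matrix_(i, b) (((initpart (psiF i))^`M(b)).@[t 0]%:P + u (i, b) * 'X).
exists (\det (E *m map_mx polyC (P *m T^T))); split.
  rewrite -prodrXr /ray_den; have -> : ray_jacobian t = diag_mx (\row_i 'X^((mindeg (psiF i)).-1)) *m E.
    by apply/matrixP=> i b; rewrite mul_diag_mx !mxE (hu (i, b)) mulrC.
  rewrite -mulmxA det_mulmx det_diag; congr (_ * _).
  by apply: eq_bigr => i _; rewrite mxE.
rewrite -horner_evalE -det_map_mx map_mxM; congr (\det (_ *m _)).
  by apply/matrixP=> i b; rewrite !mxE /= horner_evalE hornerD hornerC hornerM hornerX mulr0 addr0.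
by apply/matrixP=> i b; rewrite !mxE /= horner_evalE hornerC.
Qed.

Local Notation delta := (\sum_i (mindeg (psiF i)).-1)%N.

Lemma sum_mdegree_eF : (\sum_i mdegree (eF c e f Be Bf (F i)) = delta + l)%N.
Proof.
apply: (@etrans _ _ (delta + \sum_(i < l) 1)%N); last by rewrite sum1_card card_ord.
rewrite -big_split; apply: eq_bigr => i _.
by rewrite mdegree_eF /= addn1 prednK ?mindeg_psi_gt0.
Qed.

Lemma ray_leading : exists2 q : K, q != 0 & forall gamma T T', exists B : {poly K},
  'X^r * ray_num (gamma *m P^T) T T' = 'X^(l + 2 * delta) * B /\
  B.[0] = q * (\det (diff_mx eFs gamma *m T^T) * \det (diff_mx eFs gamma *m T'^T)).
Proof.
have [q q0 H] := ray_identity; exists q => // gamma T T'; set t := gamma *m P^T.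
have [B [eB B0]] := ray_den_order t T; have [B' [eB' B'0]] := ray_den_order t T'.
exists (q%:P * (B * B')); split; last first.
  by rewrite !hornerM hornerC B0 B'0 !mulmxA !diff_mx_eF.
rewrite H eB eB' mul2n -addnn !exprD; move: ('X^l) ('X^delta) => x y; ring.
Qed.

(** Independent differentials make the right side of [ray_leading], taken with [T' = T], vanish to
    order exactly l + 2 delta, while the left side has order at least r. *)
Lemma row_free_diff gamma : row_free (diff_mx eFs gamma) -> (r <= l + 2 * delta)%N.
Proof.
case/row_free_frame => T hT; have [q q0 /(_ gamma T T) [B [e1 B0]]] := ray_leading.
have [_ h2 _] := order_compare e1; rewrite leqNgt; apply/negP => /h2 /eqP.
by rewrite B0 !mulf_eq0 (negPf q0) (negPf hT).
Qed.

(** At a form with stabilizer of dimension [l] the left side of [ray_leading] has order exactly r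
    for a suitable pair of frames. *)
Lemma degree_bound : (l + 2 * delta <= r)%N.
Proof.
have [[gamma /ray_num_neq0 [T [T' hT]]] _] := Hind.
have [q q0 /(_ gamma T T') [B [e1 B0]]] := ray_leading.
by have [h1 _ _] := order_compare e1; rewrite leqNgt; apply: contraNN hT => /h1 ->.
Qed.

Lemma regular_row_free gamma : r = (l + 2 * delta)%N ->
  row_free (diff_mx eFs gamma) <-> stab_dim c Be gamma = l.
Proof.
move=> er; have [q q0 H] := ray_leading; split=> [/row_free_frame [T hT]|].
  have [B [e1 B0]] := H gamma T T; have [_ _ /(_ er) e2] := order_compare e1.
  by apply: (@ray_num_regular _ T T); rewrite e2 B0 !mulf_neq0.
case/ray_num_neq0 => T [T' hT]; have [B [e1 B0]] := H gamma T T'.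
have [_ _ /(_ er) e2] := order_compare e1.
apply: (@frame_row_free _ _ _ _ T); apply: contraNneq hT => h0.
by rewrite e2 B0 h0 mul0r mulr0.
Qed.

Lemma slice_theorem : let s := (\sum_(i < l) mdegree (eF c e f Be Bf (F i)))%N in
  [/\ (2 * s <= r + l)%N, alg_indep eFs <-> (2 * s = r + l)%N
    & (2 * s = r + l)%N -> forall gamma : 'rV[K]_r,
        row_free (diff_mx eFs gamma) <-> stab_dim c Be gamma = l].
Proof.
rewrite /= sum_mdegree_eF; have hle := degree_bound.
(* The degrees sum to delta + l, so the equality of the theorem says that the two exponents in
   [ray_leading] coincide. *)
have es : (2 * (delta + l) = r + l)%N <-> r = (l + 2 * delta)%N by move: delta => d; lia.
split.
- by move: hle; move: delta => d; lia.
- rewrite es; split=> [/(indep_jacobian char0) [gamma /row_free_diff h1]|er].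
    by apply/eqP; rewrite eqn_leq h1.
  have [[gamma hg] _] := Hind; apply: (jacobian_indep char0 (gamma := gamma)).
  exact/(regular_row_free gamma er).
- by move=> /es er gamma; apply: regular_row_free.
Qed.

End Generators.

End Slice.

Theorem theorem2p1 (K : closedFieldType) (charK0 : [pchar K] =i pred0)
  (n : nat) (c : 'I_n -> 'I_n -> 'rV[K]_n)
  (Hlie : is_lie c) (Hss : semisimple c)
  (l : nat) (Hrank : lie_rank c l)
  (e h f : 'rV[K]_n) (He0 : e != 0) (Henil : ad_nilpotent c e)
  (Hnonreg : cent_dim c e <> l)
  (Htriple : sl2_triple c e h f)
  (r : nat) (Be Bf : 'M[K]_(r, n))
  (HBe : row_free Be) (HBe' : (Be :=: kermx (ad c e))%MS)
  (HBf : row_free Bf) (HBf' : (Bf :=: kermx (ad c f))%MS)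
  (Hind : index_is c Be l)
  (F : 'I_l -> {mpoly K[n]}) (HF : homog_gen_system c F) :
  let eFs := fun i => eF c e f Be Bf (F i) in
  let s := (\sum_(i < l) mdegree (eFs i))%N in
  [/\ (2 * s <= r + l)%N,
      alg_indep eFs <-> (2 * s = r + l)%N
    & (2 * s = r + l)%N ->
      forall gamma : 'rV[K]_r,
        row_free (diff_mx eFs gamma) <-> stab_dim c Be gamma = l].
Proof.
have HG := cartan_criterion charK0 Hlie Hss.
exact: (slice_theorem charK0 Hlie HG He0 Htriple HBe HBe' HBf HBf'
  (row_base_free (ad c f)) (eq_row_base (ad c f)) Hrank HF Hind).
Qed.
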